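(* Let $q\in(0,1)$, $\theta\in\mathbb N$, $t=q^\theta$, $N\in\mathbb N$, $\lambda\in\mathbb{GT}_N$ and $x\in\mathbb C\setminus\{0,q,q^2,\dots,q^{\theta N-1}\}$. Then $$\frac{P_\lambda(x,t,t^2,\dots,t^{N-1};q,t)}{P_\lambda(1,t,t^2,\dots,t^{N-1};q,t)}=\ln(1/q)\prod_{i=1}^{\theta N-1}\frac{1-q^i}{x-q^i}\cdot\frac1{2\pi\sqrt{-1}}\oint_{\mathcal C_0}\frac{x^z}{\prod_{i=1}^N\prod_{j=0}^{\theta-1}\big(1-q^{z-(\lambda_i+\theta(N-i)+j)}\big)}\,dz,$$ where $\mathcal C_0$ is a closed, positively oriented contour enclosing the real poles $\{\lambda_i+\theta(N-i)+j:\ i=1,\dots,N,\ j=0,\dots,\theta-1\}$ of the integrand and no other poles. For instance, the rectangular contour with vertices $-M-r\sqrt{-1}$, $-M+r\sqrt{-1}$, $M+r\sqrt{-1}$, $M-r\sqrt{-1}$, for any $0<r<-\frac{2\pi}{\ln q}$ and any $M>\max\{0,-\lambda_N,\lambda_1+\theta N-1\}$, is a suitable contour.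
   Context: $\mathbb{GT}_N$ is the set of signatures of length $N$: $\lambda=(\lambda_1\ge\dots\ge\lambda_N)\in\mathbb Z^N$. For $\lambda\in\mathbb{GT}_N$ with $\lambda_N\ge 0$, $P_\lambda(x_1,\dots,x_N;q,t)$ is the (monic) Macdonald symmetric polynomial: these are the unique symmetric polynomials over $\mathbb C(q,t)$ with $P_\lambda=m_\lambda+\sum_{\mu<\lambda}c_{\lambda,\mu}m_\mu$ (dominance order, $m_\mu$ monomial symmetric polynomials) which are pairwise orthogonal for $(f,g)=\big[f(x_1,\dots,x_N)g(x_1^{-1},\dots,x_N^{-1})\prod_{i\ne j}\prod_{k\ge0}\frac{1-q^kx_ix_j^{-1}}{1-q^ktx_ix_j^{-1}}\big]_0$, $[\cdot]_0$ = constant term. For general $\lambda\in\mathbb{GT}_N$, $P_\lambda=(x_1\cdots x_N)^{-p}P_{(\lambda_1+p,\dots,\lambda_N+p)}$ for any integer $p\geq 0$ with $\lambda_N+p\ge0$ (well defined). $x^z=\exp(z\ln x)$ with $\ln$ the principal branch if $x\notin(-\infty,0)$, and, if $x\in(-\infty,0)$, the branch of the logarithm on the plane cut along $(-\sqrt{-1}\,\infty,0]$ that is real on $(0,\infty)$. *)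

(* Defs.v *)
From HB Require Import structures.
From mathcomp Require Import all_boot all_order all_algebra.
From mathcomp Require Import fraction complex.
From mathcomp Require mpoly.

Set Implicit Arguments.
Unset Strict Implicit.
Unset Printing Implicit Defensive.

Import Order.TTheory GRing.Theory Num.Theory.

Local Open Scope ring_scope.

(* The notations of mpoly clash with those of MathComp-Analysis: mpoly is only
   imported inside this module, and MathComp-Analysis only after it.         *)
Module Macdonald.
Import mpoly.

(* F[q,t]; the outer variable is t, the inner one is q, so that the
   coefficient of q^a t^b in p is p`_b`_a.                                   *)
Notation qtpoly F := {poly {poly F}}.
Notation qtfrac F := {fraction {poly {poly F}}}.

Definition qvar (F : fieldType) : qtpoly F := 'X%:P.
Definition tvar (F : fieldType) : qtpoly F := 'X.

Definition qt_eval (F : fieldType) (q t : F) (p : qtpoly F) : F :=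
  p.[t%:P].[q].

(* A nonnegative signature of length N is a multinomial with nonincreasing
   entries.                                                                  *)
Definition is_part (N : nat) (m : 'X_{1..N}) : bool :=
  [forall i : 'I_N, forall j : 'I_N, (i <= j)%N ==> (m j <= m i)%N].

Definition dom_lt (N : nat) (mu la : 'X_{1..N}) : bool :=
  [&& mdeg mu == mdeg la, mu != la &
      [forall k : 'I_N, (\sum_(i < N | (i <= k)%N) mu i
                           <= \sum_(i < N | (i <= k)%N) la i)%N]].

Definition monsym (R : nzRingType) (N : nat) (mu : 'X_{1..N}) : {mpoly R[N]} :=
  \sum_(m : 'X_{1..N < (mdeg mu).+1} | perm_eq (m : 'X_{1..N}) mu) 'X_[m].

(* Laurent polynomials in x_1, ..., x_N are represented by polynomials in
   N + N variables x_1, ..., x_N, y_1, ..., y_N where y_i stands for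
   x_i^{-1}. *)
Section Laurent.
Context (R : comNzRingType) (N : nat).
Implicit Types f : {mpoly R[N]}.

Definition xvar (i : 'I_N) : {mpoly R[N + N]} := 'X_(lshift N i).
Definition yvar (i : 'I_N) : {mpoly R[N + N]} := 'X_(rshift N i).

Definition at_x f : {mpoly R[N + N]} := f \mPo [tuple xvar i | i < N].
Definition at_x_inv f : {mpoly R[N + N]} := f \mPo [tuple yvar i | i < N].

Definition const_term (f : {mpoly R[N + N]}) : R :=
  \sum_(m <- msupp f | [forall i : 'I_N, m (lshift N i) == m (rshift N i)])
     f@_m.

End Laurent.

(* The weight prod_{i <> j} prod_{k >= 0} (1 - q^k u) / (1 - q^k t u), with
   u = x_i / x_j, is a power series in q and t whose coefficients are Laurent
   polynomials in x. The k-th factor is 1 modulo q^k and its denominator is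
   expanded as the geometric series sum_n (q^k t u)^n, so the truncation to
   k, n < D has the same coefficient of q^a t^b as soon as a, b < D.         *)
Definition weight_trunc (F : fieldType) (N D : nat) :
    {mpoly (qtpoly F)[N + N]} :=
  \prod_(i < N) \prod_(j < N | j != i) \prod_(k < D)
    let u := xvar (qtpoly F) i * yvar (qtpoly F) j in
    (1 - (qvar F ^+ k) *: u)
      * \sum_(n < D) ((qvar F ^+ k * tvar F) *: u) ^+ n.

(* The coefficient of q^a t^b in the constant term
   [f(x) g(1/x) prod_{i <> j} prod_k (1 - q^k x_i/x_j)/(1 - q^k t x_i/x_j)]_0,
   a power series in q and t when f and g have coefficients in F[q,t].       *)
Definition form_coef (F : fieldType) (N : nat) (f g : {mpoly (qtpoly F)[N]})
    (a b : nat) : F :=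
  (const_term (at_x f * at_x_inv g * weight_trunc F N (maxn a b).+1))`_b`_a.

(* (P, Q) = 0. The form is bilinear with values in a domain, so the
   denominators in F[q,t] of P and Q can be cleared first.                   *)
Definition orth (F : fieldType) (N : nat) (P Q : {mpoly (qtfrac F)[N]}) : Prop :=
  exists (c d : qtpoly F) (f g : {mpoly (qtpoly F)[N]}),
    [/\ c != 0, d != 0,
        tofrac c *: P = map_mpoly (@tofrac _) f,
        tofrac d *: Q = map_mpoly (@tofrac _) g
      & forall a b : nat, form_coef f g a b = 0].

Definition polyfamily (F : fieldType) (N : nat) : Type :=
  'X_{1..N} -> {mpoly (qtfrac F)[N]}.

(* P la is the Macdonald polynomial P_la(x_1, ..., x_N; q, t) for every
   nonnegative signature la of length N.                                     *)
Definition is_macdonald (F : fieldType) (N : nat) (P : polyfamily F N) : Prop :=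
  [/\ forall la, is_part la -> P la \is symmetric,
      forall la, is_part la -> exists c : 'X_{1..N} -> qtfrac F,
        P la = monsym _ la
             + \sum_(mu : 'X_{1..N < (mdeg la).+1} |
                      is_part mu && dom_lt mu la) c mu *: monsym _ mu
    & forall la mu, is_part la -> is_part mu -> la != mu ->
        orth (P la) (P mu)].

Definition shift_part (N : nat) (la : N.-tuple int) (p : nat) : 'X_{1..N} :=
  [multinom `|(tnth la i + p%:Z)%R|%N | i < N].

End Macdonald.

From mathcomp Require Import all_classical all_reals all_analysis.
Import numFieldNormedType.Exports.

Export Macdonald.

Local Open Scope classical_set_scope.
Local Open Scope complex_scope.
Local Open Scope ring_scope.

(* The value at (q,t) of a rational function, regular at this point. *)
Definition qtfrac_eval (F : fieldType) (q t : F) (a : qtfrac F) : F :=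
  xget 0 [set v : F | exists n d : qtpoly F,
    [/\ qt_eval q t d != 0, a = tofrac n / tofrac d
      & v = qt_eval q t n / qt_eval q t d]].

(* P_la(x_1, ..., x_N; q, t) for a signature la with la_N + p >= 0. *)
Definition macdonald_eval (F : fieldType) (N : nat) (P : polyfamily F N)
    (q t : F) (p : nat) (la : N.-tuple int) (x : 'I_N -> F) : F :=
  (\prod_(i < N) x i) ^- p
    * mpoly.meval x (mpoly.map_mpoly (qtfrac_eval q t) (P (shift_part la p))).

Definition signature (N : nat) (la : N.-tuple int) : bool :=
  sorted (fun a b : int => b <= a) la.

Section Contours.
Context (R : realType).
Local Notation C := R[i].
Local Notation Re := (@complex.Re R).
Local Notation Im := (@complex.Im R).

Definition cexp (z : C) : C :=
  (expR (Re z))%:C * (cos (Im z) +i* sin (Im z)).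

Definition cabs (z : C) : R := Num.sqrt (Re z ^+ 2 + Im z ^+ 2).

(* The argument in ]-pi, pi]. On the negative half-line it is pi, which is
   also the value there of the branch with cut along the negative imaginary
   half-line and real on the positive half-line.                             *)
Definition carg (z : C) : R :=
  if 0 <= Im z then acos (Re z / cabs z) else - acos (Re z / cabs z).

Definition clog (z : C) : C := ln (cabs z) +i* carg z.

Definition cpow (x z : C) : C := cexp (z * clog x).

(* A contour is made of finitely many arcs g, each parametrised by [0, 1].
   As a C^1 function on [0, 1] extends to a C^1 function on R, the arcs are
   taken C^1 on R, which avoids one-sided derivatives.                       *)
Definition C1_fun (f : R -> R) : Prop :=
  (forall s, derivable f s 1) /\ continuous (derive1 f).

Definition C1_arc (g : R -> C) : Prop :=
  C1_fun (fun s => Re (g s)) /\ C1_fun (fun s => Im (g s)).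

Definition velocity (g : R -> C) (s : R) : C :=
  derive1 (fun u => Re (g u)) s +i* derive1 (fun u => Im (g u)) s.

Definition closed_contour (n : nat) (g : 'I_n -> R -> C) : Prop :=
  (forall k, C1_arc (g k)) /\ (forall k, g k 1 = g (ordS k) 0).

Definition on_contour (n : nat) (g : 'I_n -> R -> C) (z : C) : Prop :=
  exists k, exists2 s : R, 0 <= s <= 1 & z = g k s.

Definition cintegral01 (h : R -> C) : C :=
  Rintegral lebesgue_measure `[0, 1] (fun s => Re (h s))
    +i* Rintegral lebesgue_measure `[0, 1] (fun s => Im (h s)).

Definition contour_integral (n : nat) (g : 'I_n -> R -> C) (f : C -> C) : C :=
  \sum_(k < n) cintegral01 (fun s => f (g k s) * velocity (g k) s).

Definition two_pi_i : C := 0 +i* (2 * pi).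

Definition winding_number (n : nat) (g : 'I_n -> R -> C) (w : C) : C :=
  two_pi_i^-1 * contour_integral g (fun z => (z - w)^-1).

Definition node (N theta : nat) (la : N.-tuple int) (i : 'I_N) (j : 'I_theta)
    : int :=
  tnth la i + (theta * (N - i.+1) + j)%N%:Z.

Definition denominator (q : R) (theta N : nat) (la : N.-tuple int) (z : C) : C :=
  \prod_(i < N) \prod_(j < theta) (1 - cpow q%:C (z - (node la i j)%:~R)).

Definition integrand (q : R) (theta N : nat) (la : N.-tuple int) (x z : C) : C :=
  cpow x z / denominator q theta la z.

(* For x <> 0 the numerator x^z of the integrand has no zero, so that its poles
   are the zeros of the denominator. The contour is closed, winds once
   counterclockwise around each of the real poles, and not at all around the
   other ones.                                                               *)
Definition suitable (q : R) (theta N : nat) (la : N.-tuple int)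
    (n : nat) (g : 'I_n -> R -> C) : Prop :=
  let real_poles := [set w : C | exists i (j : 'I_theta),
                                   w = (node la i j)%:~R] in
  closed_contour g /\
  forall w, denominator q theta la w = 0 ->
    [/\ ~ on_contour g w,
        real_poles w -> winding_number g w = 1
      & ~ real_poles w -> winding_number g w = 0].

(* The positively oriented boundary of [-M, M] x [-r, r]. *)
Definition rectangle (M r : R) (k : 'I_4) (s : R) : C :=
  let v := tnth [tuple (- M) -i* r; M -i* r; M +i* r; (- M) +i* r] in
  v k + s%:C * (v (ordS k) - v k).

End Contours.

(* Main.v *)
Require Import Defs.
From HB Require Import structures.
From mathcomp Require Import all_boot all_order all_algebra all_fingroup.
From mathcomp Require Import fraction complex zify ring lra.
From mathcomp Require mpoly.

Set Implicit Arguments.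
Unset Strict Implicit.
Unset Printing Implicit Defensive.

Import Order.TTheory GRing.Theory Num.Theory.
Local Open Scope ring_scope.

(** The generating function in X of Macdonald's q-difference operators is
    self-adjoint for the constant-term form and triangular in the dominance
    order, so that P_la is an eigenfunction with eigenvalue
    prod_i (1 + X t^(N-i) q^(la_i)). At t = q^theta, evaluating this equation
    at (x, t, ..., t^(N-1)) leaves only the values of P_la at x and at q x, and
    eliminating one of the unknown sums gives a first-order q-difference
    equation in x. Its Laurent polynomial solution is supported on the nodes
    la_i + theta (N-i) + j and vanishes at q, ..., q^(theta N - 1), which
    determines it up to a constant: the ratio is a sum over the nodes.

    On the other side, partial fractions reduce the contour integral to
    oint e^(az) / (1 - e^(-bz)) dz. There e^(-bz) is replaced by (1 - bz/m)^m,
    whose partial fractions over the m-th roots of unity express the integral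
    through winding numbers, and m tends to infinity: the same node sum comes
    out, without a general residue theorem. *)

(** The constant-term form is a power series in q and t, and [P la] has coefficients in a field of
    fractions, with no evident reason to be regular at the given point. Self-adjointness and
    positivity are therefore established at numerical points q = s in (0,1), t = s^k, where the
    weight is a finite product and complex conjugation is available. These points are dense, so the
    eigenvalue equation follows over the field of fractions; read there coefficient by coefficient,
    it shows that [P la] is regular at (q, q^theta), since some X separates the eigenvalues of two
    distinct partitions, and only then can it be specialised.

    Positivity enters as follows: the defect D P - E P is made of smaller polynomials and is
    orthogonal to all of them, so it vanishes.

    The parameter X is used twice. The equations at X and at X / t combine so that a single unknown
    sum is left, and reading the coefficient of x^k at X = - t / q^k removes that sum as well, which
    leaves a two-term recurrence in k. *)

Module MacdonaldTheory.
Import mpoly.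

(** * The dominance order and alternants *)

Section Combinatorics.
Context (N : nat).
Implicit Types (m mu nu : 'X_{1..N}) (s w : 'S_N).

Local Notation "m # s" := [multinom m (s i) | i < N]
  (at level 40, left associativity, format "m # s").

Definition stair : 'X_{1..N} := [multinom (N - i.+1)%N | i < N].

(* |m + delta|^2 increases strictly along the dominance order, so that inductions
   over dominance are inductions over this number. *)
Definition sqnorm m : nat := (\sum_i (m i + stair i) ^ 2)%N.

Definition dot m1 m2 : nat := (\sum_i m1 i * m2 i)%N.

Lemma stair_anti (i j : 'I_N) : (stair i < stair j)%N = (j < i)%N.
Proof. by rewrite !mnmE; have := ltn_ord i; have := ltn_ord j; lia. Qed.

Lemma stair_inj (i j : 'I_N) : stair i = stair j -> i = j.
Proof.
move=> e; apply/val_inj/eqP; have := stair_anti i j; have := stair_anti j i.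
by rewrite e ltnn => /esym/negbT + /esym/negbT; rewrite /=; lia.
Qed.

Lemma is_partP m :
  reflect (forall i j : 'I_N, (i <= j)%N -> (m j <= m i)%N) (is_part m).
Proof.
apply: (iffP forallP) => [h i j ij|h i].
  by have /forallP/(_ j)/implyP := h i; exact.
by apply/forallP => j; apply/implyP; exact: h.
Qed.

Lemma stair_part : is_part stair.
Proof.
by apply/is_partP => i j ij; rewrite leqNgt stair_anti -leqNgt.
Qed.

Lemma dot_perm m1 m2 s : dot (m1#s) (m2#s) = dot m1 m2.
Proof.
rewrite /dot (reindex_inj (@perm_inj _ s)) /=.
rewrite [RHS](reindex_inj (@perm_inj _ s)) /=.
rewrite [RHS](reindex_inj (@perm_inj _ s)) /= [LHS](reindex_inj (@perm_inj _ s^-1)%g) /=.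
rewrite [RHS](reindex_inj (@perm_inj _ s^-1)%g) /=.
by apply: eq_bigr => i _; rewrite !mnmE !permKV.
Qed.

Lemma dot_swap m (i j : 'I_N) : (i < j)%N -> (m i < m j)%N ->
  (dot m stair < dot (m#(tperm i j)) stair)%N.
Proof.
move=> ij mij; have nij : j != i by rewrite -val_eqE /=; lia.
rewrite /dot (bigD1 i) //= (bigD1 j) //= [ltnRHS](bigD1 i) //= [in ltnRHS](bigD1 j) //=.
rewrite !mnmE tpermL tpermR.
set A := (\sum_(_ | _) _)%N; set B := (\sum_(_ | _) _)%N.
have -> : A = B.
  by apply: eq_bigr => k /andP[ki kj]; rewrite !mnmE tpermD // eq_sym.
rewrite !addnA ltn_add2r; have := ltn_ord j; nia.
Qed.

Lemma part_perm_uniq m s : is_part m -> is_part (m#s) -> m#s = m.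
Proof.
move=> /is_partP pm /is_partP pms; apply/mnmP.
have srt (m' : 'X_{1..N}) : (forall i j : 'I_N, (i <= j)%N -> (m' j <= m' i)%N) ->
    sorted geq [seq m' i | i <- enum 'I_N].
  move=> h; apply: (homo_sorted (e := fun i j : 'I_N => (i <= j)%N)).
    by move=> i j; exact: h.
  have : sorted leq (map val (enum 'I_N)).
    by rewrite val_enum_ord; apply: (sub_sorted _ (iota_sorted 0 N)).
  by rewrite sorted_map.
have : [seq (m#s) i | i <- enum 'I_N] = [seq m i | i <- enum 'I_N].
  apply: (sorted_eq (leT := geq)).
  - by move=> a b c; rewrite /geq /=; lia.
  - by move=> a b; rewrite /geq /=; lia.
  - exact: srt.
  - exact: srt.
  have -> : [seq (m#s) i | i <- enum 'I_N] = [seq m i | i <- map s (enum 'I_N)].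
    by rewrite -[RHS]map_comp; apply/eq_map => i; rewrite /= mnmE.
  apply: perm_map; apply: uniq_perm; rewrite ?enum_uniq //.
    by rewrite map_inj_uniq ?enum_uniq //; exact: perm_inj.
  move=> i; rewrite mem_enum; apply/mapP; exists (s^-1 i)%g; rewrite ?mem_enum //.
  by rewrite permKV.
move=> e i; have {e} := congr1 (fun l => nth 0%N l i) e; rewrite /=.
by rewrite (nth_map i) ?size_enum_ord // (nth_map i) ?size_enum_ord // !nth_ord_enum.
Qed.

(** Rearrangement inequality: a rearrangement maximising the product with [stair] has no inversion
    by [dot_swap], so it is a partition, and [m] is the only partition in its orbit. *)
Lemma dot_max_part m : is_part m ->
  forall s, (dot (m#s) stair <= dot m stair)%N
         /\ (dot (m#s) stair = dot m stair -> m#s = m).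
Proof.
move=> pm.
have maxpart s : (forall s', (dot (m#s') stair <= dot (m#s) stair)%N) -> m#s = m.
  move=> hs; apply: part_perm_uniq => //; apply/is_partP => i j ij.
  rewrite leqNgt; apply/negP => lt; have {}ij : (i < j)%N.
    rewrite ltn_neqAle ij andbT; apply: contraTneq lt => e.
    by rewrite (val_inj e) ltnn.
  by have := dot_swap ij lt; rewrite -mpermM ltnNge hs.
pose s0 := [arg max_(s > (1 : 'S_N)%g) dot (m#s) stair].
have s0P s' : (dot (m#s') stair <= dot (m#s0) stair)%N.
  by rewrite /s0; case: arg_maxnP => // s _; apply.
have e0 := maxpart _ s0P.
move=> s; split; first by rewrite -{2}e0.
by move=> e; apply: maxpart => s'; rewrite e -{2}e0.
Qed.

Lemma sort_part m : exists s, is_part (m#s).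
Proof.
pose s0 := [arg max_(s > (1 : 'S_N)%g) dot (m#s) stair].
have s0P s' : (dot (m#s') stair <= dot (m#s0) stair)%N.
  by rewrite /s0; case: arg_maxnP => // s _; apply.
exists s0; apply/is_partP => i j ij.
rewrite leqNgt; apply/negP => lt; have {}ij : (i < j)%N.
  rewrite ltn_neqAle ij andbT; apply: contraTneq lt => e.
  by rewrite (val_inj e) ltnn.
by have := dot_swap ij lt; rewrite -mpermM ltnNge s0P.
Qed.

Lemma stair_perm_part w : is_part (stair#w) -> w = 1%g.
Proof.
move=> h; have /mnmP e := part_perm_uniq stair_part h.
apply/permP => i; rewrite perm1; apply: stair_inj; by have := e i; rewrite mnmE.
Qed.

Lemma sqnormE m m' : (\sum_i (m i + m' i) ^ 2 = dot m m + 2 * dot m m' + dot m' m')%N.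
Proof.
rewrite /dot big_distrr -!big_split /=; apply: eq_bigr => i _; nia.
Qed.

(** Expanding the squares, |mu + delta|^2 - |nu + delta|^2 is twice the change of the product of nu
    and delta under a permutation, which is nonpositive. In case of equality [nu#s = nu#w], so nu +
    delta permuted by [w] is the decreasing sequence mu + delta; hence [stair#w] decreases too, and
    w = 1. This is the combinatorial content of triangularity. *)
Lemma sqnorm_perm mu nu s w : is_part mu -> is_part nu ->
  (nu#s + stair#w = mu + stair)%MM ->
  (sqnorm mu <= sqnorm nu)%N /\ (sqnorm mu = sqnorm nu -> w = 1%g).
Proof.
move=> pmu pnu e.
have e' i : (mu i + stair i)%N = ((nu#s) i + (stair#w) i)%N.
  by move/mnmP/(_ i): e; rewrite !mnmDE.
have eN : sqnorm mu = (\sum_i ((nu#s) i + (stair#w) i)^2)%N.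
  by apply: eq_bigr => i _; rewrite e'.
have ew : dot (nu#s) (stair#w) = dot (nu#(w^-1 * s)%g) stair.
  by rewrite -(dot_perm (nu#(w^-1 * s)%g) stair w) mpermM mpermK.
rewrite eN /sqnorm !sqnormE !dot_perm ew.
have [le eq] := dot_max_part pnu (w^-1 * s)%g.
split; first by lia.
move=> h; apply: stair_perm_part.
have {}eq : nu#(w^-1 * s)%g = nu by apply: eq; lia.
have {}eq : nu#s = nu#w.
  by rewrite -[in RHS]eq mpermM mpermK.
apply/is_partP => i j ij; have := e' i; have := e' j; rewrite eq.
rewrite !(mnmE (fun i => stair (w i))) !(mnmE (fun i => nu (w i))).
have /is_partP/(_ _ _ ij) := pmu; have /is_partP/(_ _ _ ij) := stair_part.
have /is_partP pn := pnu; have /is_partP ps := stair_part.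
case: (leqP (w i) (w j)) => [/ps //|/ltnW wji].
have := pn _ _ wji; have := ps _ _ wji; lia.
Qed.

(** Layer-cake form of Abel summation: [b] is the sum over [v] of the indicators of {i : v < b i},
    and these sets are initial segments because [b] is nonincreasing. *)
Lemma abel_leq (b x y : 'I_N -> nat) :
  (forall i j : 'I_N, (i <= j)%N -> (b j <= b i)%N) ->
  (forall k : 'I_N, (\sum_(i < N | (i <= k)%N) x i <= \sum_(i < N | (i <= k)%N) y i)%N) ->
  (\sum_i b i * x i <= \sum_i b i * y i)%N.
Proof.
move=> hb hxy; pose B := \max_i b i.
have bB i : (b i <= B)%N by apply: leq_bigmax.
have layer (z : 'I_N -> nat) :
    (\sum_i b i * z i = \sum_(v < B) \sum_(i | (v < b i)%N) z i)%N.
  rewrite (exchange_big_dep xpredT) //=; apply: eq_bigr => i _.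
  by rewrite -(big_ord_widen _ (fun=> z i) (bB i)) sum_nat_const card_ord.
rewrite !layer; apply: leq_sum => v _.
case: (pickP (fun i => v < b i)%N) => [i0 hi0|h0]; last by rewrite !big_pred0.
have [k hk kmax] := @arg_maxnP _ i0 (fun i => v < b i)%N (fun i : 'I_N => val i) hi0.
have E i : (v < b i)%N = (i <= k)%N.
  by apply/idP/idP => [/kmax //|ik]; apply: leq_trans hk (hb _ _ ik).
by rewrite !(eq_bigl _ _ E).
Qed.

(** |mu + delta|^2 - |nu + delta|^2 = 2 <nu + delta, mu - nu> + |mu - nu|^2, where the first term is
    nonnegative by [abel_leq]. *)
Lemma dom_sqnorm mu nu : is_part nu -> dom_lt nu mu ->
  (sqnorm nu < sqnorm mu)%N.
Proof.
move=> pnu /and3P[_ neq /forallP h].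
have ab := abel_leq (b := fun i => (nu i + stair i)%N) (x := nu) (y := mu) _ h.
have {}ab : (\sum_i (nu i + stair i) * nu i <= \sum_i (nu i + stair i) * mu i)%N.
  apply: ab => i j ij; have /is_partP/(_ _ _ ij) := pnu.
  have /is_partP/(_ _ _ ij) := stair_part; lia.
have [i0 ni0] : exists i, mu i != nu i.
  apply/existsP; rewrite -negb_forall; apply: contraNN neq => /forallP h'.
  by apply/eqP/mnmP => i; rewrite (eqP (h' i)).
(* With truncated subtraction, (a - b) + (b - a) is |a - b|. *)
have lt : (0 < \sum_i ((mu i - nu i) + (nu i - mu i)) ^ 2)%N.
  by rewrite (bigD1 i0) //= ltn_addr // expn_gt0; move: ni0; lia.
suff : (sqnorm mu + 2 * (\sum_i (nu i + stair i) * nu i)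
        = sqnorm nu + 2 * (\sum_i (nu i + stair i) * mu i)
        + \sum_i ((mu i - nu i) + (nu i - mu i)) ^ 2)%N by lia.
rewrite /sqnorm !big_distrr -!big_split /=; apply: eq_bigr => i _.
by case: (leqP (mu i) (nu i)) => hi; nia.
Qed.

Lemma mdeg_sqnorm m : (mdeg m <= sqnorm m)%N.
Proof. by rewrite mdegE; apply: leq_sum => i _; nia. Qed.

Lemma strict_sub_stair m : (forall i j : 'I_N, (i < j)%N -> (m j < m i)%N) ->
  (stair <= m)%MM /\ is_part (m - stair)%MM.
Proof.
move=> h.
have gap (i j : 'I_N) : (i <= j)%N -> (m j + (j - i) <= m i)%N.
  move=> ij; have := subnKC ij; move: (j - i)%N => d.
  elim: d j {ij} => [|d IH] j e; first by rewrite addn0 in e; rewrite (val_inj e) addn0.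
  have jN : (j.-1 < N)%N by have := ltn_ord j; lia.
  have := IH (Ordinal jN); have := h (Ordinal jN) j; rewrite /=; lia.
have N0 (i : 'I_N) : (N.-1 < N)%N by have := ltn_ord i; lia.
have le : (stair <= m)%MM.
  apply/mnm_lepP => i; rewrite mnmE; have := gap i (Ordinal (N0 i)).
  by have := ltn_ord i; rewrite /=; lia.
split=> //; apply/is_partP => i j ij; rewrite !mnmBE.
have := gap i j ij; have /mnm_lepP/(_ i) := le; have /mnm_lepP/(_ j) := le.
by rewrite !mnmE; have := ltn_ord j; lia.
Qed.

End Combinatorics.

(** * Alternating polynomials and division by the Vandermonde determinant *)

Section Alternant.
Context (R : comNzRingType) (N : nat).
Implicit Types (m M mu nu : 'X_{1..N}) (s w : 'S_N) (p : {mpoly R[N]}).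
Implicit Types (psi : 'S_N -> 'X_{1..N} -> R).

Local Notation "m # s" := [multinom m (s i) | i < N]
  (at level 40, left associativity, format "m # s").

Lemma mcoeffXM k p M :
  ('X_[k] * p)@_M = if (k <= M)%MM then p@_(M - k) else 0.
Proof.
rewrite mulrC; case: ifPn => [le|nle].
  by rewrite -{1}(submK le) addmC mcoeffMX.
apply/memN_msupp_eq0; rewrite (perm_mem (msuppMX _ _)); apply: contra nle.
by case/mapP => m' _ ->; apply: lem_addr.
Qed.

Definition mscale (phi : 'X_{1..N} -> R) p : {mpoly R[N]} :=
  \sum_(m <- msupp p) (phi m * p@_m) *: 'X_[m].

Lemma mcoeff_mscale phi p m : (mscale phi p)@_m = phi m * p@_m.
Proof.
rewrite raddf_sum /=; under eq_bigr do rewrite mcoeffZ mcoeffX.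
have [pm|pm] := boolP (m \in msupp p).
  rewrite (bigD1_seq m) ?msupp_uniq //= eqxx mulr1 big1 ?addr0 // => k /negbTE ->.
  by rewrite mulr0.
rewrite (memN_msupp_eq0 pm) mulr0 big_seq big1 // => k kp.
by case: eqP => [e|_]; rewrite ?mulr0 //; rewrite e (negbTE pm) in kp.
Qed.

(** With [psi] = 1 this is the Vandermonde alternant times [p]; with [eigpsi] it is that alternant
    times the image of [p] under Macdonald's operator. The operator, which involves a division, is
    thus handled through its numerator. *)
Definition alternant psi p : {mpoly R[N]} :=
  \sum_(w : 'S_N) (-1) ^+ w *: ('X_[stair N#w] * mscale (psi w) p).

Lemma mcoeff_alternant psi p M :
  (alternant psi p)@_M =
  \sum_(w : 'S_N | (stair N#w <= M)%MM)
    (-1) ^+ w * (psi w (M - stair N#w)%MM * p@_(M - stair N#w)).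
Proof.
rewrite raddf_sum /= [RHS]big_mkcond /=; apply: eq_bigr => w _.
by rewrite mcoeffZ mcoeffXM; case: ifP => _; rewrite ?mulr0 // mcoeff_mscale.
Qed.

(** The compatibility that makes [alternant psi] send symmetric polynomials to alternating ones. *)
Definition equivariant psi := forall s w m, psi (s * w)%g (m#s) = psi w m.

Lemma alternant_anti psi p s M : equivariant psi -> p \is symmetric ->
  (alternant psi p)@_(M#s) = (-1) ^+ s * (alternant psi p)@_M.
Proof.
move=> hpsi sp; rewrite !mcoeff_alternant mulr_sumr (reindex_inj (mulgI s)) /=.
have leE w : (stair N#(s * w)%g <= M#s)%MM = (stair N#w <= M)%MM.
  apply/mnm_lepP/mnm_lepP => h i.
    by have := h (s^-1 i)%g; rewrite !mnmE permM permKV.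
  by have := h (s i); rewrite !mnmE permM.
apply: eq_big => [w|w _]; first exact: leE.
have -> : (M#s - stair N#(s * w)%g)%MM = (M - stair N#w)%MM#s.
  by apply/mnmP => i; rewrite !(mnmE, mnmBE) permM.
by rewrite hpsi msym_coeff // odd_permM signr_addb -mulrA.
Qed.

Definition antisym (A : {mpoly R[N]}) :=
  forall s M, A@_(M#s) = (-1) ^+ s * A@_M.

(** An exponent with two equal entries is fixed by a transposition, which makes its coefficient its
    own opposite; every other exponent sorts to a strictly decreasing one, that is, to a partition
    plus [stair]. *)
Lemma antisym_eq0 (A : {mpoly R[N]}) : (forall x : R, x = - x -> x = 0) ->
  antisym A -> (forall mu, is_part mu -> A@_(mu + stair N) = 0) -> A = 0.
Proof.
move=> char2 anti h; apply/mpolyP => M; rewrite mcoeff0.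
have [s ps] := sort_part M.
suff : A@_(M#s) = 0 by rewrite anti => /eqP; rewrite mulr_sign; case: odd_perm; rewrite ?oppr_eq0 => /eqP.
move: (M#s) ps => {M s}M /is_partP pM.
have [/existsP[i /existsP[j /andP[ij /eqP e]]]|nex] :=
    boolP [exists i : 'I_N, exists j : 'I_N, (i < j)%N && (M i == M j)].
  apply: char2; rewrite -{1}(_ : M#(tperm i j) = M).
    by rewrite anti odd_tperm -val_eqE /= neq_ltn ij expr1 mulN1r.
  by apply/mnmP => k; rewrite mnmE; case: tpermP => [->|->|].
have [|le part] := @strict_sub_stair _ M.
  move=> i j ij; rewrite ltn_neqAle pM ?(ltnW ij) // andbT.
  apply: contraNN nex => /eqP e; apply/existsP; exists i; apply/existsP; exists j.
  by rewrite ij e eqxx.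
by rewrite -(submK le) h.
Qed.

(** By [sqnorm_perm], a term with w != 1 would come from a partition of the support with [sqnorm]
    larger than that of [mu]; only the identity reaches the exponent mu + delta. *)
Lemma alternant_top psi p mu : is_part mu -> p \is symmetric ->
  (forall nu, is_part nu -> p@_nu != 0 -> (sqnorm nu <= sqnorm mu)%N) ->
  (alternant psi p)@_(mu + stair N) = psi 1%g mu * p@_mu.
Proof.
move=> pmu sp h; rewrite mcoeff_alternant.
have st1 : stair N#(1 : 'S_N)%g = stair N by apply/mnmP => i; rewrite mnmE perm1.
rewrite (bigD1 1%g) /=; last by rewrite st1 lem_addl.
rewrite st1 addmK odd_perm1 expr0 mul1r big1 ?addr0 // => w /andP[le nw].
set m := (_ - _)%MM; have [->|nz] := eqVneq p@_m 0; first by rewrite !mulr0.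
have [s ps] := sort_part m.
have pnz : p@_(m#s) != 0 by rewrite msym_coeff.
have e : ((m#s)#(s^-1)%g + stair N#w = mu + stair N)%MM.
  by rewrite -mpermM mulVg mperm1 submK.
have [le1 eq1] := sqnorm_perm pmu ps e.
have le2 := h _ ps pnz.
by rewrite eq1 ?eqxx // in nw; apply/eqP; rewrite eqn_leq le1 le2.
Qed.

Definition lower (B : nat) p :=
  p \is symmetric /\ forall nu, is_part nu -> p@_nu != 0 -> (sqnorm nu < B)%N.

Lemma lower_eq0 p : lower 0 p -> p = 0.
Proof.
case=> sp h; apply/mpolyP => m; rewrite mcoeff0; apply/eqP/negPn/negP => nz.
have [s ps] := sort_part m.
by have := h _ ps; rewrite msym_coeff // nz => /(_ isT).
Qed.

Definition one_psi : 'S_N -> 'X_{1..N} -> R := fun _ _ => 1.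

Lemma alternant_one p : alternant one_psi p = alternant one_psi 1 * p.
Proof.
have e w q : mscale (one_psi w) q = q.
  by apply/mpolyP => m; rewrite mcoeff_mscale mul1r.
rewrite /alternant mulr_suml; apply: eq_bigr => w _.
by rewrite !e mulr1 scalerAl.
Qed.

Definition triangular (Q : 'X_{1..N} -> {mpoly R[N]}) B :=
  forall mu, is_part mu -> (sqnorm mu < B)%N ->
    [/\ Q mu \is symmetric, (Q mu)@_mu = 1
      & forall nu, is_part nu -> nu != mu -> (Q mu)@_nu != 0 ->
          (sqnorm nu < sqnorm mu)%N].

(** The degree bound only makes the index set finite: by [mdeg_sqnorm] it excludes no partition with
    [sqnorm] equal to [B]. *)
Definition layer (Q : 'X_{1..N} -> {mpoly R[N]}) B (a : 'X_{1..N} -> R) :=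
  \sum_(mu : 'X_{1..N < B.+1} | is_part mu && (sqnorm mu == B)) a mu *: Q mu.

Lemma triangularW Q B : triangular Q B.+1 -> triangular Q B.
Proof. by move=> hQ mu pmu lt; apply: hQ => //; apply: ltnW. Qed.

Lemma layerP Q B a : triangular Q B.+1 ->
  [/\ layer Q B a \is symmetric,
      forall nu, is_part nu -> (layer Q B a)@_nu != 0 -> (sqnorm nu <= B)%N
    & forall nu, is_part nu -> sqnorm nu = B -> (layer Q B a)@_nu = a nu].
Proof.
move=> hQ; split=> [|nu pnu|nu pnu eB].
- apply: rpred_sum => mu /andP[pmu /eqP e]; apply: rpredZ.
  by case: (hQ mu); rewrite ?e.
- rewrite raddf_sum /=; apply: contraNT; rewrite -ltnNge => lt.
  apply/eqP; apply: big1 => mu /andP[pmu /eqP e]; rewrite mcoeffZ.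
  have [|_ _ h] := hQ mu pmu; first by rewrite e.
  have [->|nz] := eqVneq (Q mu)@_nu 0; first by rewrite mulr0.
  have [e'|ne] := eqVneq nu mu; first by rewrite e' e ltnn in lt.
  by have := h _ pnu ne nz; lia.
rewrite raddf_sum /=.
have dnu : (mdeg nu < B.+1)%N by rewrite ltnS -eB mdeg_sqnorm.
rewrite (bigD1 (BMultinom dnu)) /=; last by rewrite pnu eB eqxx.
have [|_ e1 h] := hQ nu pnu; first by rewrite eB.
rewrite mcoeffZ e1 mulr1 big1 ?addr0 // => mu /andP[/andP[pmu /eqP emu] ne].
have [|_ _ hmu] := hQ mu pmu; first by rewrite emu.
have ne' : nu != bmnm mu by rewrite eq_sym.
rewrite mcoeffZ; have [->|nz] := eqVneq (Q mu)@_nu 0; first by rewrite mulr0.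
by have := hmu _ pnu ne' nz; rewrite emu eB ltnn.
Qed.

Lemma lower_layer Q B f : triangular Q B.+1 -> lower B.+1 f ->
  lower B (f - layer Q B (fun mu => f@_mu)).
Proof.
move=> hQ [sf hf]; have [sg gle gB] := layerP (fun mu => f@_mu) hQ.
move: (layer _ _ _) sg gle gB => g sg gle gB.
split=> [|nu pnu]; first exact: rpredB.
rewrite mcoeffB; apply: contraNT; rewrite -leqNgt => le.
have [e|ne] := eqVneq (sqnorm nu) B; first by rewrite gB // subrr.
have [->|nz] := eqVneq f@_nu 0; last by have := hf _ pnu nz; lia.
have [->|nz] := eqVneq g@_nu 0; first by rewrite subrr.
by have := gle _ pnu nz; lia.
Qed.

(* Unitriangularity of the family makes every alternating polynomial divisible
   by the Vandermonde determinant: remove its extreme coefficients by multiples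
   of [alternant one_psi (Q mu)]. *)
Lemma antisym_div Q B : (forall x : R, x = - x -> x = 0) -> triangular Q B ->
  forall A, antisym A ->
  (forall mu, is_part mu -> A@_(mu + stair N) != 0 -> (sqnorm mu < B)%N) ->
  exists2 f, lower B f & A = alternant one_psi 1 * f.
Proof.
move=> char2; elim: B => [|B IH] hQ A anti hA.
  exists 0; last first.
    rewrite mulr0; apply: antisym_eq0 => // mu pmu.
    by apply/eqP/negPn/negP => /(hA _ pmu).
  by split=> [|nu]; rewrite ?rpred0 // mcoeff0 eqxx.
have [sg gle gB] := layerP (fun mu => A@_(mu + stair N)) hQ.
move: (layer _ _ _) sg gle gB => g sg gle gB.
have antig s M : (alternant one_psi 1 * g)@_(M#s)
    = (-1) ^+ s * (alternant one_psi 1 * g)@_M.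
  by rewrite -alternant_one alternant_anti.
have anti' : antisym (A - alternant one_psi 1 * g).
  by move=> s M; rewrite !mcoeffB anti antig mulrBr.
have [||f [sf hf] eA] := IH _ _ anti'; first exact: triangularW.
  move=> mu pmu; rewrite mcoeffB; apply: contraNT; rewrite -leqNgt => le.
  rewrite -alternant_one alternant_top //; last first.
    by move=> nu pnu /gle -/(_ pnu) h; apply: leq_trans h le.
  rewrite mul1r; have [e|ne] := eqVneq (sqnorm mu) B; first by rewrite gB // subrr.
  have [->|nz] := eqVneq A@_(mu + stair N) 0.
    have [->|nz] := eqVneq g@_mu 0; first by rewrite subrr.
    by have := gle _ pmu nz; lia.
  by have := hA _ pmu nz; lia.
exists (f + g); last by rewrite mulrDr -eA subrK.
split=> [|nu pnu]; first exact: rpredD.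
rewrite mcoeffD; apply: contraNT; rewrite -ltnNge => lt.
have [->|nz] := eqVneq f@_nu 0; last by have := hf _ pnu nz; lia.
have [->|nz] := eqVneq g@_nu 0; last by have := gle _ pnu nz; lia.
by rewrite addr0.
Qed.

Lemma alternantB psi psi' p :
  alternant (fun w m => psi w m - psi' w m) p = alternant psi p - alternant psi' p.
Proof.
apply/mpolyP => M; rewrite mcoeffB !mcoeff_alternant -sumrB.
by apply: eq_bigr => w _; rewrite -mulrBr -mulrBl.
Qed.

Lemma alternant_cst a p : alternant (fun _ _ => a) p = a *: (alternant one_psi 1 * p).
Proof.
rewrite -alternant_one; apply/mpolyP => M; rewrite mcoeffZ !mcoeff_alternant mulr_sumr.
by apply: eq_bigr => w _; rewrite mul1r mulrCA.
Qed.

End Alternant.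

(** * The constant-term form and the eigenvalue equation *)

Section Average.
Context (C : numFieldType) (N : nat) (root : nat -> C).
Hypothesis rootP : forall n, (0 < n)%N -> n.-primitive_root (root n).
Implicit Types (c x : 'I_N -> C) (phi : ('I_N -> C) -> C).

Definition avg n c phi : C :=
  n%:R ^- N * \sum_(a : {ffun 'I_N -> 'I_n}) phi (fun i => c i * root n ^+ a i).

(** A constant term is recovered as a mean over a translate, by [c], of the group of n-th roots of
    unity, for all large n. Requiring this for every [c] makes the notion stable under rescaling of
    the variables and leaves the choice of the sample points free. *)
Definition has_ct phi (v : C) := exists n0, forall n, (n0 <= n)%N ->
  forall c, (forall i, c i != 0) -> avg n c phi = v.

Lemma root_neq0 n : (0 < n)%N -> root n != 0.
Proof.
move=> n0; have := prim_expr_order (rootP n0); apply: contra_eq_neq => ->.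
by rewrite expr0n gtn_eqF // eq_sym oner_eq0.
Qed.

Lemma eq_avg n c phi phi' : (0 < n)%N -> (forall i, c i != 0) ->
  (forall x, (forall i, x i != 0) -> phi x = phi' x) -> avg n c phi = avg n c phi'.
Proof.
move=> n0 hc e; congr (_ * _); apply: eq_bigr => a _; apply: e => i.
by rewrite mulf_neq0 // expf_neq0 // root_neq0.
Qed.

Lemma has_ct_ext phi phi' v : (forall x, (forall i, x i != 0) -> phi x = phi' x) ->
  has_ct phi v -> has_ct phi' v.
Proof.
move=> e [n0 h]; exists n0.+1 => n ln c hc; rewrite -(h n _ c) ?(ltnW ln) //.
by apply: eq_avg => // [|x hx]; [apply: leq_ltn_trans ln|rewrite e].
Qed.

Lemma has_ctZ k phi v : has_ct phi v -> has_ct (fun x => k * phi x) (k * v).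
Proof.
case=> n0 h; exists n0 => n ln c hc.
by rewrite -(h n ln c hc) /avg -mulr_sumr mulrCA.
Qed.

Lemma has_ct_sum (I : Type) (r : seq I) (P : pred I) (phi : I -> ('I_N -> C) -> C) v :
  (forall i, P i -> has_ct (phi i) (v i)) ->
  has_ct (fun x => \sum_(i <- r | P i) phi i x) (\sum_(i <- r | P i) v i).
Proof.
move=> h; elim: r => [|i r [n1 h1]].
  by exists 0 => n _ c _; rewrite /avg big_nil big1 ?mulr0 // => a _; rewrite big_nil.
have [Pi|nPi] := boolP (P i); last first.
  exists n1 => n ln c hc; rewrite big_cons (negbTE nPi) -(h1 n ln c hc).
  by congr (_ * _); apply: eq_bigr => a _; rewrite big_cons (negbTE nPi).
have [n0 h0] := h i Pi; exists (maxn n0 n1) => n; rewrite geq_max => /andP[l0 l1] c hc.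
rewrite big_cons Pi -(h0 n l0 c hc) -(h1 n l1 c hc) -mulrDr -big_split /=.
by congr (_ * _); apply: eq_bigr => a _; rewrite big_cons Pi.
Qed.

(* The mean of a Laurent monomial over the torus c_i * mu_n is its constant term
   for every c, so the substitution x_i -> 1 / (tau_i x_i) preserves constant terms. *)
Lemma has_ct_inv (tau : 'I_N -> C) phi v : (forall i, tau i != 0) ->
  has_ct phi v -> has_ct (fun x => phi (fun i => (tau i * x i)^-1)) v.
Proof.
move=> ht [n0 h]; exists n0.+1 => n ln c hc.
have n_gt0 : (0 < n)%N by apply: leq_ltn_trans ln.
have hr := root_neq0 n_gt0.
pose c' i := (tau i * c i)^-1 * root n.
have hc' i : c' i != 0 by rewrite mulf_neq0 // invr_eq0 mulf_neq0.
rewrite -(h n (ltnW ln) c' hc'); congr (_ * _).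
have revK (g : {ffun 'I_N -> 'I_n}) :
   [ffun i => rev_ord ([ffun i => rev_ord (g i)] i)] = g.
  by apply/ffunP => i; rewrite !ffunE rev_ordK.
rewrite (reindex_inj (h := fun a : {ffun 'I_N -> 'I_n} => [ffun i => rev_ord (a i)])) /=;
  last by move=> a b e; rewrite -(revK a) e revK.
apply: eq_bigr => a _; congr phi; apply: boolp.funext => i.
rewrite ffunE /c' /= mulrA invfM -mulrA; congr (_ * _).
have e : root n ^+ (n - (a i).+1) * (root n * root n ^+ a i) = 1.
  by rewrite -exprS -exprD subnK // (prim_expr_order (rootP n_gt0)).
apply: (mulfI (x := root n ^+ (n - (a i).+1))); first by rewrite expf_neq0.
by rewrite mulfV ?expf_neq0 // e.
Qed.

Definition pair_inv x : 'I_(N + N) -> C :=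
  fun k => match split k with inl i => x i | inr i => (x i)^-1 end.

Lemma pair_invl x i : pair_inv x (lshift N i) = x i.
Proof. by rewrite /pair_inv; case: split_ordP => j /eqP; rewrite ?eq_lshift ?eq_lrshift // => /eqP ->. Qed.

Lemma pair_invr x i : pair_inv x (rshift N i) = (x i)^-1.
Proof. by rewrite /pair_inv; case: split_ordP => j /eqP; rewrite ?eq_rshift ?eq_rlshift // => /eqP ->. Qed.

Lemma sum_root n (p r : nat) : (p < n)%N -> (r < n)%N ->
  \sum_(a < n) (root n ^+ a) ^+ p * (root n ^+ a) ^- r = (n * (p == r))%:R.
Proof.
move=> pn rn; have n0 : (0 < n)%N by apply: leq_ltn_trans pn.
have hr := root_neq0 n0.
pose z := root n ^+ p / root n ^+ r.
have -> : \sum_(a < n) (root n ^+ a) ^+ p * (root n ^+ a) ^- r = \sum_(a < n) z ^+ a.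
  by apply: eq_bigr => a _; rewrite expr_div_n -!exprM ![(_ * a)%N]mulnC.
have zE : (z == 1) = (p == r).
  rewrite -(inj_eq (mulIf (expf_neq0 r hr))) divfK ?expf_neq0 // mul1r.
  by rewrite (eq_prim_root_expr (rootP n0)) !modn_small.
have [e|ne] := eqVneq p r.
  have /eqP z1 : z == 1 by rewrite zE e.
  rewrite muln1 (eq_bigr (fun=> 1)) ?sumr_const ?card_ord // => a _.
  by rewrite z1 expr1n.
rewrite muln0; have z1 : z - 1 != 0 by rewrite subr_eq0 zE.
apply: (mulfI z1); rewrite -subrX1 mulr0; apply/eqP; rewrite subr_eq0.
by rewrite expr_div_n -!exprM ![(_ * n)%N]mulnC !exprM (prim_expr_order (rootP n0)) !expr1n divr1.
Qed.

(** The degree bound keeps all exponents below n, so that congruence of exponents modulo n is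
    equality. *)
Lemma avg_monomial n c (m : 'X_{1..N + N}) : (0 < n)%N -> (forall i, c i != 0) ->
  (mdeg m < n)%N ->
  avg n c (fun x => \prod_k pair_inv x k ^+ m k)
  = [forall i : 'I_N, m (lshift N i) == m (rshift N i)]%:R.
Proof.
move=> n0 hc mn; have hr := root_neq0 n0.
have mk k : (m k < n)%N.
  by apply: leq_ltn_trans mn; rewrite mdegE (bigD1 k) //= leq_addr.
pose F i (a : 'I_n) := (c i) ^+ m (lshift N i) / (c i) ^+ m (rshift N i)
   * ((root n ^+ a) ^+ m (lshift N i) * (root n ^+ a) ^- m (rshift N i)).
have nn : n%:R != 0 :> C by rewrite pnatr_eq0 -lt0n.
rewrite /avg (eq_bigr (fun a : {ffun 'I_N -> 'I_n} => \prod_i F i (a i))); last first.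
  move=> a _; rewrite big_split_ord /= -big_split /=; apply: eq_bigr => i _.
  by rewrite pair_invl pair_invr exprVn !exprMn invfM /F; ring.
rewrite -(bigA_distr_bigA F) /= -{1}(card_ord N) -prodr_const -prodfV -big_split /=.
have E i : n%:R^-1 * \sum_j F i j = (m (lshift N i) == m (rshift N i))%:R.
  rewrite -mulr_sumr sum_root //; case: eqP => [->|_]; last by rewrite muln0 !mulr0.
  by rewrite divff ?expf_neq0 // mul1r muln1 mulVf.
under eq_bigr do rewrite E.
case: forallP => [h|nh]; first by rewrite big1 // => i _; rewrite h.
have [i ni] : exists i : 'I_N, m (lshift N i) != m (rshift N i).
  apply/existsP; rewrite -negb_forall; apply/forallP => h; exact: nh.
by rewrite (bigD1 i) //= (negbTE ni) mul0r.
Qed.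

Lemma has_ct_const_term (F : {mpoly C[N + N]}) :
  has_ct (fun x => F.@[pair_inv x]) (const_term F).
Proof.
exists (msize F).+1 => n ln c hc; have n0 : (0 < n)%N by apply: leq_ltn_trans ln.
transitivity (\sum_(m <- msupp F) F@_m * avg n c (fun x => \prod_k pair_inv x k ^+ m k)).
  rewrite /avg; under [RHS]eq_bigr do rewrite mulrCA.
  rewrite -[RHS]mulr_sumr; congr (_ * _); under [RHS]eq_bigr do rewrite mulr_sumr.
  by rewrite [RHS]exchange_big /=; apply: eq_bigr => a _; rewrite mevalE.
rewrite /const_term [RHS]big_mkcond /=; apply: eq_big_seq => m /msize_mdeg_lt mF.
rewrite avg_monomial //; first by case: ifP; rewrite ?mulr1 ?mulr0.
exact: ltn_trans mF ln.
Qed.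

Definition laurent phi := exists F : {mpoly C[N + N]},
  forall x, (forall i, x i != 0) -> phi x = F.@[pair_inv x].

Lemma laurent_ct phi : laurent phi -> exists v, has_ct phi v.
Proof.
case=> F h; exists (const_term F).
by apply: has_ct_ext (has_ct_const_term F) => x /h.
Qed.

Lemma laurentM phi psi : laurent phi -> laurent psi -> laurent (fun x => phi x * psi x).
Proof. by case=> F hF [G hG]; exists (F * G) => x hx; rewrite mevalM hF ?hG. Qed.

Lemma laurentD phi psi : laurent phi -> laurent psi -> laurent (fun x => phi x + psi x).
Proof. by case=> F hF [G hG]; exists (F + G) => x hx; rewrite mevalD hF ?hG. Qed.

Lemma laurentC k : laurent (fun=> k).
Proof. by exists k%:MP => x _; rewrite mevalC. Qed.

Lemma laurent_ext phi psi : phi =1 psi -> laurent phi -> laurent psi.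
Proof. by move=> e [F hF]; exists F => x hx; rewrite -e hF. Qed.

Lemma laurentX i : laurent (fun x => x i).
Proof. by exists 'X_(lshift N i) => x _; rewrite mevalXU pair_invl. Qed.

Lemma laurentV i : laurent (fun x => (x i)^-1).
Proof. by exists 'X_(rshift N i) => x _; rewrite mevalXU pair_invr. Qed.

Lemma laurent_prod (I : Type) (r : seq I) (P : pred I) (phi : I -> ('I_N -> C) -> C) :
  (forall i, P i -> laurent (phi i)) -> laurent (fun x => \prod_(i <- r | P i) phi i x).
Proof.
move=> h; elim: r => [|i r IH].
  by apply: laurent_ext (laurentC 1) => x; rewrite big_nil.
have [Pi|nPi] := boolP (P i).
  by apply: laurent_ext (laurentM (h i Pi) IH) => x; rewrite big_cons Pi.
by apply: laurent_ext IH => x; rewrite big_cons (negbTE nPi).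
Qed.

Lemma laurent_sum (I : Type) (r : seq I) (phi : I -> ('I_N -> C) -> C) :
  (forall i, laurent (phi i)) -> laurent (fun x => \sum_(i <- r) phi i x).
Proof.
move=> h; elim: r => [|i r IH].
  by apply: laurent_ext (laurentC 0) => x; rewrite big_nil.
by apply: laurent_ext (laurentD (h i) IH) => x; rewrite big_cons.
Qed.

Lemma laurent_meval (f : {mpoly C[N]}) (psi : 'I_N -> ('I_N -> C) -> C) :
  (forall i, laurent (psi i)) -> laurent (fun x => f.@[fun i => psi i x]).
Proof.
move=> h; apply: (laurent_ext (phi := fun x => \sum_(m <- msupp f)
    f@_m * \prod_i psi i x ^+ m i)); first by move=> x; rewrite mevalE.
apply: laurent_sum => m; apply: laurentM; first exact: laurentC.
apply: laurent_prod => i _; elim: (m i) => [|k IH].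
  by apply: laurent_ext (laurentC 1) => x; rewrite expr0.
by apply: laurent_ext (laurentM (h i) IH) => x; rewrite exprS.
Qed.

End Average.

Section ConstTerm.
Context (R : comNzRingType) (N : nat).
Implicit Types (f g : {mpoly R[N + N]}).

(** Summing over a fixed finite index set instead of the support makes linearity visible. *)
Lemma const_termE f K : (msize f <= K)%N ->
  const_term f = \sum_(m : 'X_{1..(N + N) < K} |
    [forall i : 'I_N, m (lshift N i) == m (rshift N i)]) f@_m.
Proof.
move=> le; rewrite /const_term -[LHS]big_filter.
pose r := [seq bmnm m | m <- enum {: 'X_{1..(N + N) < K}}].
have ur : uniq r by rewrite map_inj_uniq ?enum_uniq //; exact: val_inj.
have sub : {subset msupp f <= r}.
  move=> m /msize_mdeg_lt lt; apply/mapP.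
  by exists (BMultinom (leq_trans lt le)); rewrite ?mem_enum.
rewrite big_filter.
have -> : \sum_(m : 'X_{1..(N + N) < K} |
    [forall i : 'I_N, m (lshift N i) == m (rshift N i)]) f@_m
  = \sum_(m <- r | [forall i : 'I_N, m (lshift N i) == m (rshift N i)]) f@_m.
  by rewrite big_map big_enum_cond.
rewrite [RHS](bigID (mem (msupp f))) /= [X in _ = _ + X]big1 ?addr0; last first.
  by move=> m /andP[_ /memN_msupp_eq0].
rewrite -[RHS]big_filter -[LHS]big_filter; apply: perm_big.
apply: uniq_perm; rewrite ?filter_uniq ?msupp_uniq // => m.
rewrite !mem_filter; case: (boolP (m \in msupp f)) => [h|]; last by rewrite !andbF.
by rewrite (sub _ h) !andbT.
Qed.

Lemma const_term_is_additive : additive (@const_term R N).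
Proof.
move=> f g; pose K := maxn (msize (f - g)) (maxn (msize f) (msize g)).
rewrite !(@const_termE _ K); try by rewrite !leq_max leqnn ?orbT.
by rewrite -sumrB; apply: eq_bigr => m _; rewrite mcoeffB.
Qed.

HB.instance Definition _ := GRing.isAdditive.Build {mpoly R[N + N]} R
  (@const_term R N) const_term_is_additive.

Lemma const_termZ c f : const_term (c *: f) = c * const_term f.
Proof.
pose K := maxn (msize (c *: f)) (msize f).
rewrite !(@const_termE _ K); try by rewrite !leq_max leqnn ?orbT.
by rewrite mulr_sumr; apply: eq_bigr => m _; rewrite mcoeffZ.
Qed.

End ConstTerm.

Lemma const_term_map (R S : comNzRingType) (N : nat) (h : {rmorphism R -> S})
    (f : {mpoly R[N + N]}) :
  const_term (map_mpoly h f) = h (const_term f).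
Proof.
pose K := maxn (msize (map_mpoly h f)) (msize f).
rewrite !(@const_termE _ _ _ K); try by rewrite !leq_max leqnn ?orbT.
by rewrite raddf_sum; apply: eq_bigr => m _; rewrite mcoeff_map_mpoly.
Qed.

(** * Macdonald's operators as alternants *)

Section Vandermonde.
Context (R : comNzRingType) (N : nat).
Implicit Types (x : 'I_N -> R) (p : {mpoly R[N]}) (I : {set 'I_N}).

Definition vdm x : R := \prod_(i < N) \prod_(j < N | (i < j)%N) (x j - x i).

Local Notation one_psi := (@one_psi R N).
Definition ad x : R := (alternant one_psi 1).@[x].

Lemma adE x : ad x = \sum_(w : 'S_N) (-1) ^+ w * \prod_i x i ^+ stair N (w i).
Proof.
rewrite /ad /alternant raddf_sum /=; apply: eq_bigr => w _; rewrite mevalZ.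
have -> : mscale (one_psi w) 1 = 1.
  by apply/mpolyP => m; rewrite mcoeff_mscale mul1r.
by rewrite mulr1 mevalX; congr (_ * _); apply: eq_bigr => i _; rewrite mnmE.
Qed.

(** The sign is that of the reversal of the indices, since [stair] lists the Vandermonde exponents
    backwards; it is the same for all [x]. *)
Lemma ad_vdm : exists e : bool, forall x, ad x = (-1) ^+ e * vdm x.
Proof.
pose r : 'S_N := perm (@rev_ord_inj N).
exists (odd_perm r^-1%g) => x; rewrite adE.
pose a : 'rV[R]_N := \row_i x i.
have -> : vdm x = \det (Vandermonde N a).
  by rewrite det_Vandermonde; apply: eq_bigr => i _; apply: eq_bigr => j _; rewrite !mxE.
rewrite -det_tr -det_perm mulrC -det_mulmx -col_permE /determinant.
apply: eq_bigr => w _; congr (_ * _); apply: eq_bigr => i _.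
by rewrite !mxE permE mnmE.
Qed.

Definition tshift I (t : R) x : 'I_N -> R := fun i => (if i \in I then t else 1) * x i.

(** The scalar by which the generating function of Macdonald's operators acts on the product of x^(w
    delta), from the alternant, and of x^m, from the polynomial. *)
Definition eigpsi (X q t : R) : 'S_N -> 'X_{1..N} -> R :=
  fun w m => \prod_i (1 + X * t ^+ stair N (w i) * q ^+ m i).

Lemma eigpsi_equiv X q t : equivariant (eigpsi X q t).
Proof.
move=> s w m; rewrite /eigpsi [RHS](reindex_inj (@perm_inj _ s)) /=.
by apply: eq_bigr => i _; rewrite permM mnmE.
Qed.

(** Expanding the product over i as a sum over subsets turns the powers of t and q into dilations of
    the arguments: the right-hand side is the Vandermonde alternant times Macdonald's sum over
    [I]. *)
Lemma meval_eig X q t p x : (alternant (eigpsi X q t) p).@[x] =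
  \sum_(I : {set 'I_N}) X ^+ #|I| * ad (tshift I t x) * p.@[tshift I q x].
Proof.
transitivity (\sum_(w : 'S_N) \sum_(m <- msupp p) \sum_(I : {set 'I_N})
   (-1) ^+ w * p@_m * \prod_i (x i ^+ stair N (w i) * x i ^+ m i
      * (if i \in I then X * t ^+ stair N (w i) * q ^+ m i else 1))).
  rewrite /alternant raddf_sum /=; apply: eq_bigr => w _.
  rewrite mevalZ mevalM mevalX [mscale _ _]/mscale raddf_sum /= !mulr_sumr.
  apply: eq_bigr => m _; rewrite mevalZ mevalX /eigpsi.
  under [X in _ * (_ * (X * _ * _))]eq_bigr do rewrite addrC.
  rewrite bigA_distr /= !mulr_suml !mulr_sumr.
  apply: eq_big => [I|I _]; first by rewrite inE.
  rewrite !big_split /=; under [X in _ * (X * _)]eq_bigr do rewrite mnmE.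
  move: ((-1) ^+ w) (\prod_(i < N) x i ^+ stair N (w i)) (\prod_(i < N) x i ^+ m i).
  by move: (\prod_(i < N) (if _ then _ else _)) (p@_m) => a b c d e; ring.
under [RHS]eq_bigr => I _ do rewrite adE [X in X * _]mulr_sumr mulr_suml.
rewrite [RHS]exchange_big; apply: eq_bigr => w _ /=.
rewrite exchange_big; apply: eq_bigr => I _ /=.
rewrite mevalE !mulr_sumr; apply: eq_bigr => m _.
have -> : X ^+ #|I| = \prod_i (if i \in I then X else 1).
  by rewrite -big_mkcond /= prodr_const.
transitivity ((-1) ^+ w * p@_m * ((\prod_(i < N) (if i \in I then X else 1)) *
  (\prod_(i < N) tshift I t x i ^+ stair N (w i)) * (\prod_(i < N) tshift I q x i ^+ m i))).
  rewrite -!big_split /=; congr (_ * _); apply: eq_bigr => i _.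
  rewrite /tshift !exprMn; case: ifP => _; last by rewrite !expr1n !mul1r mulr1.
  by move: (x i ^+ _) (x i ^+ _) (t ^+ _) (q ^+ _) => a b c d; ring.
move: ((-1) ^+ w) (p@_m) (\prod_(i < N) (if _ then _ else _)) => a b c.
by move: (\prod_(i < N) _) (\prod_(i < N) _) => d e; ring.
Qed.

End Vandermonde.

Lemma pair_prod (C : comNzRingType) (N : nat) (F : 'I_N -> 'I_N -> C) :
  \prod_(i < N) \prod_(j < N | j != i) F i j
  = \prod_(i < N) \prod_(j < N | (i < j)%N) (F i j * F j i).
Proof.
under [RHS]eq_bigr do rewrite big_split; rewrite big_split /=.
rewrite [X in _ = _ * X](exchange_big_dep xpredT) //= -big_split /=.
apply: eq_bigr => i _; rewrite (bigID (fun j : 'I_N => (i < j)%N)) /=.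
by congr (_ * _); apply: eq_bigl => j; rewrite -val_eqE /=; lia.
Qed.

(** * The weight at t = s^k and self-adjointness *)

Section Weight.
Context (C : numClosedFieldType) (N : nat) (root : nat -> C).
Hypothesis rootP : forall n, (0 < n)%N -> n.-primitive_root (root n).
Variables (s : C) (k : nat).
Hypotheses (s01 : 0 < s < 1).
Implicit Types (x : 'I_N -> C) (I : {set 'I_N}) (f g p : {mpoly C[N]}).

Local Notation t := (s ^+ k).

Let s0 : s != 0. Proof. by case/andP: s01 => /lt0r_neq0. Qed.

(** [wt set0] is Macdonald's weight at t = s^k. In general [wt I] is, up to the constant
    [wt_const I], this weight times the coefficient a(t_I x) / a(x) of the operator: the denominator
    cancels against the weight, and what is left is a shift by one step of the factors with i in I,
    j outside. *)
Definition wfac I (i j : 'I_N) x : C :=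
  \prod_(l < k) (1 - s ^+ (l + ((i \in I) && (j \notin I)))%N * (x i / x j)).

Definition wt I x : C := \prod_(i < N) \prod_(j < N | j != i) wfac I i j x.

(** The substitution exchanges the factors of (i, j) and (j, i): for i in I and j outside, dividing
    by s compensates the shift of the exponent. This symmetry is what makes the operator
    self-adjoint. *)
Lemma wt_inv I x : (forall i, x i != 0) ->
  wt I (fun i => (tshift I s x i)^-1) = wt I x.
Proof.
move=> hx; rewrite /wt (exchange_big_dep xpredT) //=; apply: eq_bigr => i _.
apply: eq_big => [j|j nij]; first by rewrite eq_sym.
apply: eq_bigr => l _; congr (1 - _); rewrite invrK /tshift invfM.
case: (i \in I); case: (j \in I) => /=; rewrite ?invr1 ?addn0 ?addn1 ?exprSr;
  field; rewrite ?s0 ?hx //.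
Qed.

Definition wt_const I : C :=
  \prod_(i < N) \prod_(j < N | (i < j)%N) (if (i \in I) && (j \in I) then t else 1).

Lemma wt_vdm I x : (forall i, x i != 0) ->
  vdm x * (wt_const I * wt I x) = vdm (tshift I t x) * wt set0 x.
Proof.
move=> hx; rewrite /wt !pair_prod /vdm /wt_const -!big_split /=.
apply: eq_bigr => i _; rewrite -!big_split /=; apply: eq_bigr => j ij.
(* Both sides are the product of the 1 - s^l u for 0 <= l <= k. *)
have tel u : (1 - u) * \prod_(l < k) (1 - s ^+ (l + 1)%N * u)
    = (1 - t * u) * \prod_(l < k) (1 - s ^+ (l + 0)%N * u).
  under eq_bigr do rewrite addn1; under [in RHS]eq_bigr do rewrite addn0.
  transitivity (\prod_(l < k.+1) (1 - s ^+ l * u)).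
    by rewrite big_ord_recl /= expr0 mul1r.
  by rewrite big_ord_recr /= mulrC.
rewrite /wfac !in_set0 /= /tshift.
have xi := hx i; have xj := hx j.
have e1 : x j - x i = x j * (1 - x i / x j) by field.
have e2 : x j - x i = - x i * (1 - x j / x i) by field.
have f1 : x j - t * x i = x j * (1 - t * (x i / x j)) by field.
have f2 : t * x j - x i = - x i * (1 - t * (x j / x i)) by field.
have := tel (x i / x j); have := tel (x j / x i).
move: e1 e2 f1 f2; move: (x i / x j) (x j / x i) => u v.
case: (i \in I); case: (j \in I) => /= e1 e2 f1 f2 tu tv; rewrite ?mul1r //.
- by rewrite -mulrBr; ring.
- by rewrite e1 f1 -!(mulrA (x j)) !(mulrA (1 - _)) tv.
- by rewrite e2 f2 -!(mulrA (- x i)) ![(1 - _) * (_ * _)]mulrCA tu.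
Qed.

Lemma laurent_wt I : laurent (wt I).
Proof.
apply: laurent_prod => i _; apply: laurent_prod => j _; apply: laurent_prod => l _.
apply: laurentD; first exact: laurentC.
pose c : C := - s ^+ (l + ((i \in I) && (j \notin I)))%N.
apply: (laurent_ext (phi := fun x => c * (x i * (x j)^-1))).
  by move=> x; rewrite /c mulNr.
apply: laurentM; first exact: laurentC.
by apply: laurentM; [exact: laurentX|exact: laurentV].
Qed.

Definition inv_pt x : 'I_N -> C := fun i => (x i)^-1.

Definition is_form f g (v : C) :=
  has_ct root (fun x => f.@[x] * g.@[inv_pt x] * wt set0 x) v.

Lemma laurent_inv_pt g : laurent (fun x => g.@[inv_pt x]).
Proof. by apply: laurent_meval => i; apply: laurentV. Qed.

Lemma laurent_pt g : laurent (fun x => g.@[x]).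
Proof. by apply: (@laurent_meval C N g (fun i x => x i)) => i; apply: laurentX. Qed.

Lemma form_ex f g : exists v, is_form f g v.
Proof.
apply: (laurent_ct rootP); apply: laurentM (laurent_wt _).
exact: laurentM (laurent_pt f) (laurent_inv_pt g).
Qed.

Lemma formC f g v : is_form f g v -> is_form g f v.
Proof.
move=> /(has_ct_inv (tau := fun=> 1) rootP (fun=> oner_neq0 _)).
apply: has_ct_ext => // x hx.
have E : wt set0 (fun i => (1 * x i)^-1) = wt set0 x.
  rewrite -[RHS]wt_inv //; apply: eq_bigr => i _; apply: eq_bigr => j _.
  by apply: eq_bigr => l _; rewrite /tshift !in_set0.
have e1 h : h.@[fun i => (1 * x i)^-1] = h.@[inv_pt x].
  by apply: meval_eq => i; rewrite mul1r.
have e2 h : h.@[inv_pt (fun i => (1 * x i)^-1)] = h.@[x].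
  by apply: meval_eq => i; rewrite /inv_pt mul1r invrK.
by rewrite E e1 e2 [g.@[_] * _]mulrC.
Qed.

Lemma form_linl (I : Type) (r : seq I) (P : pred I) (a : I -> C) (F : I -> {mpoly C[N]}) v g :
  (forall i, P i -> is_form (F i) g (v i)) ->
  is_form (\sum_(i <- r | P i) a i *: F i) g (\sum_(i <- r | P i) a i * v i).
Proof.
move=> h; have h' i : P i -> has_ct root (fun x => a i * ((F i).@[x] * g.@[inv_pt x] * wt set0 x)) (a i * v i).
  by move=> /h; apply: has_ctZ.
apply: has_ct_ext (has_ct_sum r h') => // x _.
rewrite raddf_sum /= !mulr_suml; apply: eq_bigr => i _.
by rewrite mevalZ !mulrA.
Qed.

Lemma formD f f' g v v' : is_form f g v -> is_form f' g v' -> is_form (f + f') g (v + v').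
Proof.
move=> h h'; have := @form_linl bool [:: true; false] xpredT (fun=> 1)
  (fun b => if b then f else f') (fun b => if b then v else v') g.
rewrite !big_cons !big_nil !addr0 !scale1r !mul1r; apply.
by case.
Qed.

Lemma formZ a f g v : is_form f g v -> is_form (a *: f) g (a * v).
Proof.
move=> h; have := @form_linl unit [:: tt] xpredT (fun=> a) (fun=> f) (fun=> v) g.
by rewrite !big_cons !big_nil !addr0; apply.
Qed.

(** With c_i = i + 1 the coordinates of every sample point have distinct moduli, so that the zeros
    of the Vandermonde determinant are never met and one may divide by it. *)
Lemma avg_inj_ext phi phi' v v' :
  (forall x, (forall i, x i != 0) -> injective x -> phi x = phi' x) ->
  has_ct root phi v -> has_ct root phi' v' -> v = v'.
Proof.
move=> e [n h] [n' h']; pose c (i : 'I_N) : C := i.+1%:R.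
have hc i : c i != 0 by rewrite pnatr_eq0.
pose K := (maxn n n').+1.
have Kn : (n <= K)%N by rewrite leqW // leq_maxl.
have Kn' : (n' <= K)%N by rewrite leqW // leq_maxr.
rewrite -(h K Kn c hc) -(h' K Kn' c hc); congr (_ * _); apply: eq_bigr => a _.
have nr1 : `|root K| = 1.
  apply/eqP; rewrite -(@pexpr_eq1 _ _ K) // -normrX (prim_expr_order (rootP _)) //.
  by rewrite normr1.
have nr i : `|c i * root K ^+ a i| = c i.
  by rewrite normrM normrX nr1 expr1n mulr1 ger0_norm ?ler0n.
apply: e => [i|i j eij].
  by rewrite -normr_eq0 nr.
apply/val_inj; have : c i = c j by rewrite -(nr i) -(nr j) eij.
by move/eqP; rewrite eqr_nat => /eqP[].
Qed.

Local Notation one_psi := (@one_psi C N).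
Local Notation A1 := (alternant one_psi 1).

Lemma ad_neq0 x : injective x -> ad x != 0.
Proof.
move=> ix; have [e ->] := ad_vdm C N; rewrite mulf_neq0 ?signr_eq0 //.
apply/prodf_neq0 => i _; apply/prodf_neq0 => j ij; rewrite subr_eq0.
by apply: contraTneq ij => /ix ->; rewrite ltnn.
Qed.

(** Both pairings expand as the same sum over [I]: the substitution x -> 1 / (s_I x) preserves
    [wt I] and exchanges the roles of f(s_I x) and g(1/x). *)
Lemma form_selfadj X f g f' g' v v' :
  A1 * f' = alternant (eigpsi X s t) f -> A1 * g' = alternant (eigpsi X s t) g ->
  is_form f' g v -> is_form g' f v' -> v = v'.
Proof.
move=> ef eg hv hv'.
pose Phi (f g : {mpoly C[N]}) I x := f.@[tshift I s x] * g.@[inv_pt x] * wt I x.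
have red (f1 f1' g1 : {mpoly C[N]}) w (vI : {set 'I_N} -> C) :
    A1 * f1' = alternant (eigpsi X s t) f1 -> is_form f1' g1 w ->
    (forall I, has_ct root (Phi f1 g1 I) (vI I)) ->
    w = \sum_(I : {set 'I_N}) X ^+ #|I| * wt_const I * vI I.
  move=> e1 hw hI.
  have hI' I : xpredT I -> has_ct root
      (fun x => X ^+ #|I| * wt_const I * Phi f1 g1 I x) (X ^+ #|I| * wt_const I * vI I).
    by move=> _; apply: has_ctZ.
  apply: avg_inj_ext hw (has_ct_sum _ hI') => x hx ix.
  apply: (mulfI (ad_neq0 ix)).
  have e2 : ad x * f1'.@[x] = \sum_(I : {set 'I_N})
      X ^+ #|I| * ad (tshift I t x) * f1.@[tshift I s x].
    by rewrite /ad -mevalM e1 meval_eig.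
  transitivity (ad x * f1'.@[x] * (g1.@[inv_pt x] * wt set0 x)); first by rewrite !mulrA.
  rewrite e2; transitivity (\sum_(I : {set 'I_N})
    ad x * (X ^+ #|I| * wt_const I * Phi f1 g1 I x)); last by apply/esym; apply: mulr_sumr.
  rewrite [LHS]mulr_suml; apply: eq_bigr => I _.
  have e3 : ad x * (wt_const I * wt I x) = ad (tshift I t x) * wt set0 x.
    by have [e he] := ad_vdm C N; rewrite !he -!mulrA wt_vdm.
  rewrite /Phi; move: e3; move: (ad x) (ad _) (wt_const I) (wt I x) (wt _ x) => a b c d e e3.
  move: (X ^+ _) (f1.@[_]) (g1.@[_]) => y z w0; ring: e3.
have hPhi I : exists v, has_ct root (Phi f g I) v.
  apply: (laurent_ct rootP); apply: laurentM (laurent_wt _).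
  apply: laurentM (laurent_inv_pt g); apply: laurent_meval => i.
  by apply: laurentM; [exact: laurentC|exact: laurentX].
have [vI hI] := boolp.choice hPhi.
rewrite (red _ _ _ _ _ ef hv hI); apply/esym.
apply: (red _ _ _ _ _ eg hv') => I.
have tau0 (i : 'I_N) : (if i \in I then s else 1) != 0.
  by case: ifP; rewrite ?oner_neq0.
apply: has_ct_ext (has_ct_inv rootP tau0 (hI I)) => // x hx.
rewrite /Phi (_ : (fun i => _) = (fun i => (tshift I s x i)^-1)) // wt_inv //.
rewrite [f.@[_] * _]mulrC; congr (_ * _ * _).
  by apply: meval_eq => i; rewrite /inv_pt invrK.
apply: meval_eq => i; rewrite /tshift /inv_pt invfM.
by case: ifP => _; rewrite ?invr1 ?mul1r ?mulVKf ?mulKf ?invrK.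
Qed.

End Weight.

(** * Positivity of the form and eigenfunctions at (s, s^k) *)

Section Eigen.
Context (C : numClosedFieldType) (N : nat) (root : nat -> C).
Hypothesis rootP : forall n, (0 < n)%N -> n.-primitive_root (root n).
Variables (s : C) (k : nat).
Hypotheses (s01 : 0 < s < 1).
Implicit Types (x : 'I_N -> C) (f g p : {mpoly C[N]}).

Local Notation t := (s ^+ k).
Local Notation one_psi := (@one_psi C N).
Local Notation A1 := (alternant one_psi 1).
Local Notation is_form := (is_form root s k).

Lemma mcoeff_ct g (m : 'X_{1..N}) :
  has_ct root (fun x => g.@[x] * \prod_i (x i)^-1 ^+ m i) g@_m.
Proof.
pose M (m' : 'X_{1..N}) : 'X_{1..(N + N)} :=
  [multinom match split k with inl i => m' i | inr i => m i end | k < N + N].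
have Ml m' i : M m' (lshift N i) = m' i.
  by rewrite mnmE; case: split_ordP => j /eqP; rewrite ?eq_lshift ?eq_lrshift // => /eqP ->.
have Mr m' i : M m' (rshift N i) = m i.
  by rewrite mnmE; case: split_ordP => j /eqP; rewrite ?eq_rshift ?eq_rlshift // => /eqP ->.
have h m' : has_ct root (fun x => \prod_k pair_inv x k ^+ M m' k) (m' == m)%:R.
  exists (mdeg (M m')).+1 => n ln c hc; rewrite avg_monomial //; last exact: leq_trans ln.
  congr (nat_of_bool _)%:R; apply/forallP/eqP => [e|-> i]; last by rewrite Ml Mr.
  by apply/mnmP => i; have := e i; rewrite Ml Mr => /eqP.
have e : g@_m = \sum_(m' <- msupp g) g@_m' * (m' == m)%:R.
  rewrite [in LHS](mpolyE g) raddf_sum /=; apply: eq_bigr => m' _.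
  by rewrite mcoeffZ mcoeffX.
rewrite e; apply: has_ct_ext (has_ct_sum _ (v := fun m' => g@_m' * (m' == m)%:R)
   (phi := fun m' x => g@_m' * \prod_k pair_inv x k ^+ M m' k) _) => // [x hx|m' _].
  rewrite mevalE mulr_suml; apply: eq_bigr => m' _; rewrite -mulrA; congr (_ * _).
  rewrite big_split_ord /=; congr (_ * _); apply: eq_bigr => i _.
    by rewrite pair_invl Ml.
  by rewrite pair_invr Mr.
exact: has_ctZ.
Qed.

Definition mconj f : {mpoly C[N]} := map_mpoly Num.conj_op f.

Lemma mcoeff_conj f m : (mconj f)@_m = (f@_m)^*%R.
Proof. exact: mcoeff_map_mpoly. Qed.

Lemma lower_conj B f : lower B f -> lower B (mconj f).
Proof.
case=> /issymP sf hf; split.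
  by apply/issymP => w; apply/mpolyP => m; rewrite mcoeff_sym !mcoeff_conj -{2}(sf w) mcoeff_sym.
by move=> nu pnu; rewrite mcoeff_conj conjC_eq0; apply: hf.
Qed.

(** At roots of unity 1/x is the conjugate of x and the weight is a product of squared moduli, so a
    zero mean forces every term to vanish. The weight is zero only where two coordinates coincide,
    and there the Vandermonde alternant vanishes instead; hence [A1 * f] vanishes at all sample
    points for all large n, and its coefficients are means over these points. *)
Lemma form_pos f : is_form f (mconj f) 0 -> f = 0.
Proof.
case=> n0 h; suff e0 : A1 * f = 0.
  have A10 : A1 != 0.
    have inj : injective (fun i : 'I_N => (nat_of_ord i)%:R : C).
      by move=> i j /eqP; rewrite eqr_nat => /eqP /val_inj.
    by apply: contraNneq (ad_neq0 inj) => e; rewrite /ad e meval0.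
  by apply: (mulfI A10); rewrite mulr0.
have s_real l : (s ^+ l)^*%R = s ^+ l.
  by rewrite conj_Creal // ger0_real // exprn_ge0 //; case/andP: s01 => /ltW.
pose one_c (_ : 'I_N) : C := 1.
have vanish n (a : {ffun 'I_N -> 'I_n}) : (n0 < n)%N ->
    (A1 * f).@[fun i => one_c i * root n ^+ a i] = 0.
  move=> ln; have n_gt0 : (0 < n)%N by apply: leq_ltn_trans ln.
  have nr1 : `|root n| = 1.
    by apply/eqP; rewrite -(@pexpr_eq1 _ _ n) // -normrX (prim_expr_order (rootP _)) ?normr1.
  pose X (a : {ffun 'I_N -> 'I_n}) i : C := one_c i * root n ^+ a i.
  have X1 b i : `|X b i| = 1 by rewrite normrM normrX nr1 expr1n normr1 mulr1.
  have X0 b i : X b i != 0 by rewrite -normr_eq0 X1 oner_eq0.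
  have Xinv b i : (X b i)^-1 = (X b i)^*%R by rewrite invC_norm X1 expr1n invr1 mul1r.
  pose H b := \prod_(i < N) \prod_(j < N | (i < j)%N) \prod_(l < k)
      `|1 - s ^+ l * (X b i / X b j)| ^+ 2.
  have phiE b : f.@[X b] * (mconj f).@[inv_pt (X b)] * wt s k set0 (X b)
      = `|f.@[X b]| ^+ 2 * H b.
    rewrite normCK; congr (_ * _ * _).
      rewrite !mevalE -[X in _ = X]/(Num.conj_op _) rmorph_sum /=.
      have -> : \sum_(i <- msupp (mconj f)) (mconj f)@_i * \prod_j inv_pt (X b) j ^+ i j
         = \sum_(i <- msupp f) (mconj f)@_i * \prod_j inv_pt (X b) j ^+ i j.
        apply: perm_big; apply: uniq_perm; rewrite ?msupp_uniq // => m.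
        by rewrite !mcoeff_msupp mcoeff_conj conjC_eq0.
      apply: eq_bigr => m _; rewrite rmorphM mcoeff_conj rmorph_prod /=.
      by congr (_ * _); apply: eq_bigr => i _; rewrite rmorphXn /inv_pt Xinv.
    rewrite /wt pair_prod; apply: eq_bigr => i _; apply: eq_bigr => j ij.
    rewrite /wfac -big_split /=; apply: eq_bigr => l _.
    rewrite !in_set0 /= addn0 normCK; congr (_ * _).
    rewrite rmorphB rmorph1 rmorphM /= s_real; congr (_ - _ * _).
    by rewrite rmorphM fmorphV /= -!Xinv invrK mulrC.
  have H0 b : 0 <= H b.
    by do 2!apply: prodr_ge0 => ? _; apply: prodr_ge0 => ? _; apply: exprn_ge0.
  have := h n (ltnW ln) one_c (fun=> oner_neq0 _).
  have nn : n%:R ^- N != 0 :> C by rewrite invr_eq0 expf_neq0 // pnatr_eq0 -lt0n.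
  rewrite /avg (eq_bigr _ (fun b _ => phiE b)) => /eqP.
  rewrite mulf_eq0 (negbTE nn) /=.
  rewrite psumr_eq0; last by move=> b _; rewrite mulr_ge0 // exprn_ge0.
  move=> /allP/(_ a (mem_index_enum a)) /=.
  rewrite mulf_eq0 expf_eq0 /= normr_eq0 mevalM -[A1.@[_]]/(ad _).
  case/orP => [/eqP -> //|]; first by rewrite mulr0.
  case/prodf_eq0 => i _ /prodf_eq0[j ij] /prodf_eq0[l _].
  rewrite expf_eq0 /= normr_eq0 subr_eq0 => /eqP e.
  have : `|s ^+ l| = 1.
    by have := congr1 Num.norm e; rewrite normr1 normrM (normrM (X a i)) normfV !X1 invr1 !mulr1.
  have s_ge0 : 0 <= s by case/andP: s01 => /ltW.
  rewrite ger0_norm ?exprn_ge0 // => sl.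
  have l0 : (l : nat) = 0%N.
    have s1 : s < 1 by case/andP: s01.
    by have := exprn_ilt1 l s_ge0 s1; rewrite sl ltxx => /esym/negbFE/eqP.
  move: e; rewrite l0 expr0 mul1r => /esym /(congr1 (fun y => y * X a j)).
  rewrite mul1r divfK // => e.
  have [e' ->] := ad_vdm C N; rewrite /vdm (bigD1 i) //= (bigD1 j) //=.
  by rewrite -/(X a j) -/(X a i) e subrr !(mul0r, mulr0).
apply/mpolyP => m; rewrite mcoeff0; have [n1 h1] := mcoeff_ct (A1 * f) m.
pose n := (maxn n0 n1).+1.
rewrite -(h1 n _ one_c (fun=> oner_neq0 _)); last by rewrite leqW // leq_maxr.
rewrite /avg big1 ?mulr0 // => a _; rewrite vanish ?mul0r //.
by rewrite ltnS leq_maxl.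
Qed.

Lemma char2 (x : C) : x = - x -> x = 0.
Proof.
move/eqP; rewrite -addr_eq0 -mulr2n -mulr_natl mulf_eq0 pnatr_eq0 /=.
by move/eqP.
Qed.

Lemma lower_orth (Q : 'X_{1..N} -> {mpoly C[N]}) p B : triangular Q B ->
  (forall mu, is_part mu -> (sqnorm mu < B)%N -> is_form p (Q mu) 0) ->
  forall f, lower B f -> is_form f p 0.
Proof.
elim: B => [|B IH] hQ horth f hf.
  rewrite (lower_eq0 hf).
  have [v hv] := form_ex rootP s k 0 p.
  by have := formZ rootP 0 hv; rewrite scaler0 mul0r.
rewrite -[f](subrK (layer Q B (fun mu => f@_mu))) -[0](addr0 0).
apply: (formD rootP).
  apply: IH (lower_layer hQ hf); first exact: triangularW.
  by move=> mu pmu lt; apply: horth => //; apply: ltnW.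
have := @form_linl C N root rootP s k _ (index_enum _)
  (fun mu : 'X_{1..N < B.+1} => is_part mu && (sqnorm mu == B))
  (fun mu => f@_mu) (fun mu => Q mu) (fun=> 0) p.
rewrite [X in is_form _ _ X]big1 => [|mu _]; last by rewrite mulr0.
by apply=> mu /andP[pmu /eqP e]; apply: (formC rootP s01); apply: horth; rewrite ?e.
Qed.

(** Write D for the operator and f for the defect D Q_la - E Q_la: it is made of smaller partitions,
    because the leading coefficient cancels. If g is made of smaller partitions so is D g, and <f,
    g> = <D Q_la, g> = <D g, Q_la> = 0; with g the conjugate of f, positivity gives f = 0. *)
Lemma macdonald_eigen (Q : 'X_{1..N} -> {mpoly C[N]}) la X : is_part la ->
  triangular Q (sqnorm la).+1 ->
  (forall mu, is_part mu -> (sqnorm mu < sqnorm la)%N -> is_form (Q la) (Q mu) 0) ->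
  alternant (eigpsi X s t) (Q la) = eigpsi X s t 1%g la *: (A1 * Q la).
Proof.
move=> pla hQ horth; have hQ' := triangularW hQ.
have [|sla la1 lalow] := hQ la pla; first by [].
pose E := eigpsi X s t 1%g la.
pose psi (w : 'S_N) (m : 'X_{1..N}) := eigpsi X s t w m - E.
have psi_eq : equivariant psi by move=> w w' m; rewrite /psi eigpsi_equiv.
have Aanti : antisym (alternant psi (Q la)).
  by move=> w M; apply: alternant_anti.
have [mu pmu|f hf ef] := antisym_div char2 hQ' Aanti.
  apply: contraNT; rewrite -leqNgt => le; rewrite alternant_top //; last first.
    move=> nu pnu nz; have [->//|ne] := eqVneq nu la.
    exact: leq_trans (ltnW (lalow _ pnu ne nz)) le.
  have [->|ne] := eqVneq mu la; first by rewrite /psi subrr mul0r.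
  have [->|nz] := eqVneq (Q la)@_mu 0; first by rewrite mulr0.
  by have := lalow _ pmu ne nz; lia.
have eE : A1 * (f + E *: Q la) = alternant (eigpsi X s t) (Q la).
  by rewrite mulrDr -ef /psi alternantB alternant_cst -scalerAr subrK.
suff f0 : f = 0 by rewrite -eE f0 add0r scalerAr.
have orthW := lower_orth hQ' horth.
apply: form_pos; have /orthW hfc := lower_conj hf; have := lower_conj hf.
move: (mconj f) hfc => g hg [sg glow].
have Ganti : antisym (alternant (eigpsi X s t) g).
  by move=> w M; apply: alternant_anti => //; apply: eigpsi_equiv.
have [mu pmu|g' hg' eg] := antisym_div char2 hQ' Ganti.
  apply: contraNT; rewrite -leqNgt => le; rewrite alternant_top //; last first.
    by move=> nu pnu nz; apply: leq_trans (ltnW (glow _ pnu nz)) le.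
  have [->|nz] := eqVneq g@_mu 0; first by rewrite mulr0.
  by have := glow _ pmu nz; lia.
have [v hv] := form_ex rootP s k f g.
have h1 : is_form (f + E *: Q la) g (v + E * 0).
  by apply: (formD rootP) => //; apply: (formZ rootP); exact: (formC rootP s01).
have := form_selfadj rootP s01 eE (esym eg) h1 (orthW _ hg').
by rewrite mulr0 addr0 => <-.
Qed.

End Eigen.

(** * From power series in q and t to the substitution t = q^k *)

Section Congruence.
Context (A : comNzRingType) (d1 d2 : A).

(** Congruence modulo the ideal (d1, d2); with d1 = Q^D and d2 = T^D it compares truncated power
    series in any ring. *)
Definition cong (a b : A) := exists e1 e2, a = b + d1 * e1 + d2 * e2.

Lemma cong_refl a : cong a a.
Proof. by exists 0, 0; rewrite !mulr0 !addr0. Qed.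

Lemma cong_sym a b : cong a b -> cong b a.
Proof. by case=> e1 [e2 ->]; exists (- e1), (- e2); ring. Qed.

Lemma cong_trans a b c : cong a b -> cong b c -> cong a c.
Proof.
by case=> e1 [e2 ->] [f1 [f2 ->]]; exists (e1 + f1), (e2 + f2); ring.
Qed.

Lemma congM a b a' b' : cong a b -> cong a' b' -> cong (a * a') (b * b').
Proof.
case=> e1 [e2 ->] [f1 [f2 ->]].
exists (e1 * b' + b * f1 + e1 * (d1 * f1 + d2 * f2)).
by exists (e2 * b' + b * f2 + e2 * (d1 * f1 + d2 * f2)); ring.
Qed.

Lemma congD a b a' b' : cong a b -> cong a' b' -> cong (a + a') (b + b').
Proof.
by case=> e1 [e2 ->] [f1 [f2 ->]]; exists (e1 + f1), (e2 + f2); ring.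
Qed.

Lemma cong_prod (I : Type) (r : seq I) (P : pred I) (F G : I -> A) :
  (forall i, P i -> cong (F i) (G i)) ->
  cong (\prod_(i <- r | P i) F i) (\prod_(i <- r | P i) G i).
Proof.
move=> h; elim/big_rec2: _ => [|i a b Pi hab]; first exact: cong_refl.
by apply: congM hab; apply: h.
Qed.

Lemma cong_prod1 (I : Type) (r : seq I) (P : pred I) (F : I -> A) :
  (forall i, P i -> cong (F i) 1) -> cong (\prod_(i <- r | P i) F i) 1.
Proof.
move=> h; elim/big_rec: _ => [|i a Pi ha]; first exact: cong_refl.
by rewrite -[1](mulr1 1); apply: congM ha; apply: h.
Qed.

Lemma cong_l e : cong (d1 * e) 0.
Proof. by exists e, 0; rewrite mulr0 addr0 add0r. Qed.

Lemma cong_r e : cong (d2 * e) 0.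
Proof. by exists 0, e; rewrite mulr0 addr0 add0r. Qed.

End Congruence.

Section GenWeight.
Context (A : comNzRingType) (N : nat) (u : 'I_N -> 'I_N -> A).

(** One factor of the truncated weight over an arbitrary ring, so that the formal weight and its
    specialisations correspond under ring morphisms. *)
Definition wfactor (v Q T : A) D : A :=
  \prod_(l < D) ((1 - Q ^+ l * v) * \sum_(n < D) (Q ^+ l * T * v) ^+ n).

Definition gen_weight (Q T : A) D : A :=
  \prod_(i < N) \prod_(j < N | j != i) wfactor (u i j) Q T D.

Lemma wfactorS v Q T D : cong (Q ^+ D) (T ^+ D) (wfactor v Q T D.+1) (wfactor v Q T D).
Proof.
rewrite /wfactor big_ord_recr /= -[X in cong _ _ _ X]mulr1.
apply: congM.
  apply: cong_prod => l _; apply: congM; first exact: cong_refl.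
  rewrite big_ord_recr /= -[X in cong _ _ _ X]addr0; apply: congD; first exact: cong_refl.
  by rewrite exprMn [(_ * T) ^+ D]exprMn -mulrA mulrCA; apply: cong_r.
rewrite -[X in cong _ _ _ X]mulr1; apply: congM.
  by exists (- v), 0; rewrite mulr0 addr0 mulrN.
rewrite big_ord_recl /= expr0 -[X in cong _ _ _ X]addr0; apply: congD; first exact: cong_refl.
under eq_bigr do rewrite /bump /= add1n exprS -!mulrA.
by rewrite -mulr_sumr; apply: cong_l.
Qed.

Lemma gen_weightS Q T D :
  cong (Q ^+ D) (T ^+ D) (gen_weight Q T D.+1) (gen_weight Q T D).
Proof. by apply: cong_prod => i _; apply: cong_prod => j _; apply: wfactorS. Qed.

(** At T = Q^k the product of (1 - Q^l v) / (1 - Q^(l+k) v) telescopes and leaves the first k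
    numerators. Modulo Q^D the truncation is harmless: with y = Q^(l+k) v one has (1 - y) sum_(n<D)
    y^n = 1 - y^D, and Q^D divides y^D because k > 0. *)
Lemma wfactor_lim v Q k D : (0 < k)%N ->
  cong (Q ^+ D) (Q ^+ D) (wfactor v Q (Q ^+ k) D) (\prod_(l < k) (1 - Q ^+ l * v)).
Proof.
move=> k0; rewrite /wfactor big_split /=.
have e : cong (Q ^+ D) (Q ^+ D) (\prod_(l < D) (1 - Q ^+ l * v))
    ((\prod_(l < k) (1 - Q ^+ l * v)) * \prod_(l < D) (1 - Q ^+ (l + k) * v)).
  apply: cong_sym; have -> : (\prod_(l < k) (1 - Q ^+ l * v)) * \prod_(l < D) (1 - Q ^+ (l + k) * v)
      = \prod_(l < D + k) (1 - Q ^+ l * v).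
    by rewrite addnC big_split_ord /=; congr (_ * _); apply: eq_bigr => l _; rewrite addnC.
  rewrite big_split_ord /= -[X in cong _ _ _ X]mulr1; apply: congM; first exact: cong_refl.
  apply: cong_prod1 => l _.
  by exists (- (Q ^+ l * v)), 0; rewrite exprD; ring.
apply: cong_trans (congM e (cong_refl _ _ _)) _.
rewrite -mulrA -[X in cong _ _ _ X]mulr1; apply: congM; first exact: cong_refl.
rewrite -big_split /=; apply: cong_prod1 => l _.
rewrite -exprD -[_ ^+ (l + k)]/(_ ^+ (l + k)); set y := _ * v.
have -> : (1 - y) * \sum_(n < D) y ^+ n = 1 - y ^+ D.
  by rewrite -[LHS]opprK -mulNr opprB -subrX1 opprB.
exists (- (Q ^+ ((l + k).-1 * D) * v ^+ D)), 0.
rewrite /y exprMn -exprM mulr0 addr0 mulrN mulrA -exprD; congr (1 - Q ^+ _ * _).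
by rewrite -mulSn prednK // addn_gt0 k0 orbT.
Qed.

Lemma gen_weight_lim Q k D : (0 < k)%N ->
  cong (Q ^+ D) (Q ^+ D) (gen_weight Q (Q ^+ k) D)
    (\prod_(i < N) \prod_(j < N | j != i) \prod_(l < k) (1 - Q ^+ l * u i j)).
Proof.
by move=> k0; apply: cong_prod => i _; apply: cong_prod => j _; apply: wfactor_lim.
Qed.

End GenWeight.

Lemma gen_weight_map (A B : comNzRingType) (h : {rmorphism A -> B}) N
    (u : 'I_N -> 'I_N -> A) Q T D :
  h (gen_weight u Q T D) = gen_weight (fun i j => h (u i j)) (h Q) (h T) D.
Proof.
rewrite rmorph_prod; apply: eq_bigr => i _; rewrite rmorph_prod; apply: eq_bigr => j _.
rewrite rmorph_prod; apply: eq_bigr => l _.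
rewrite rmorphM rmorphB rmorph1 rmorphM rmorphXn rmorph_sum; congr (_ * _).
by apply: eq_bigr => n _; rewrite rmorphXn !rmorphM rmorphXn.
Qed.

Lemma rmorphM3 (A B : comNzRingType) (h : {rmorphism A -> B}) a b c :
  h (a * b * c) = h a * h b * h c.
Proof. by rewrite !rmorphM. Qed.

Section Specialization.
Context (C : numClosedFieldType) (N : nat) (root : nat -> C).
Hypothesis rootP : forall n, (0 < n)%N -> n.-primitive_root (root n).

Definition xy (R : comNzRingType) (i j : 'I_N) : {mpoly R[N + N]} := xvar R i * yvar R j.

Lemma weight_truncE D :
  weight_trunc C N D = gen_weight (xy (qtpoly C)) (qvar C)%:MP (tvar C)%:MP D.
Proof.
apply: eq_bigr => i _; apply: eq_bigr => j _; apply: eq_bigr => l _.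
rewrite /= -mul_mpolyC rmorphXn; congr (_ * _); apply: eq_bigr => n _.
by rewrite -mul_mpolyC rmorphM rmorphXn.
Qed.

Lemma form_coef_stable (f g : {mpoly (qtpoly C)[N]}) a b D : (maxn a b < D)%N ->
  (const_term (at_x f * at_x_inv g * weight_trunc C N D))`_b`_a = form_coef f g a b.
Proof.
move=> lt; rewrite /form_coef -(subnKC lt); move: (D - _)%N => e.
elim: e => [|e IH]; first by rewrite addn0.
rewrite addnS; move: IH; set M := ((maxn a b).+1 + e)%N => <-.
have [e1 [e2]] := gen_weightS (xy (qtpoly C)) (qvar C)%:MP (tvar C)%:MP M.
rewrite -!weight_truncE => ->.
rewrite !mulrDr ![at_x f * _ * (_ * _)]mulrCA -!rmorphXn !mul_mpolyC !raddfD /= !const_termZ.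
have [aM bM] : (a < M)%N /\ (b < M)%N by rewrite /M; lia.
by rewrite !coefD coefCM /tvar !coefXnM aM bM coef0 !addr0.
Qed.

(** Evaluation at (s, s^k) factors through the substitution t := q^k, after which one still has a
    polynomial in q whose low coefficients can be read. *)
Lemma qt_evalE (k : nat) (s : C) (p : qtpoly C) : qt_eval s (s ^+ k) p = p.['X^k].[s].
Proof.
rewrite /qt_eval; elim/poly_ind: p => [|p c IH]; first by rewrite !horner0.
by rewrite !hornerMXaddC !hornerD !hornerM IH hornerC hornerXn.
Qed.

(** The monomial q^a t^b becomes q^(a + k b), so that only indices a, b <= n contribute to q^n. *)
Lemma low_coef_eval (p : qtpoly C) (k D : nat) : (0 < k)%N ->
  (forall a b, (a < D)%N -> (b < D)%N -> p`_b`_a = 0) ->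
  forall n, (n < D)%N -> p.['X^k]`_n = 0.
Proof.
move=> k0 h n nD; rewrite horner_coef coef_sum big1 // => b _.
rewrite -exprM coefMXn; case: ltnP => // le; apply: h; first by lia.
by nia.
Qed.

Lemma map_at_x (R S : comNzRingType) (h : {rmorphism R -> S}) (f : {mpoly R[N]}) :
  map_mpoly h (at_x f) = at_x (map_mpoly h f).
Proof.
rewrite /at_x /comp_mpoly.
pose K := maxn (msize f) (msize (map_mpoly h f)).
rewrite !(@mmapE _ _ _ _ _ _ K); try by rewrite leq_max leqnn ?orbT.
rewrite raddf_sum; apply: eq_bigr => m _ /=.
rewrite rmorphM /= map_mpolyC mcoeff_map_mpoly; congr (_ * _).
rewrite /mmap1 rmorph_prod; apply: eq_bigr => i _ /=.
by rewrite rmorphXn /= !tnth_mktuple map_mpolyX.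
Qed.

Lemma map_at_x_inv (R S : comNzRingType) (h : {rmorphism R -> S}) (f : {mpoly R[N]}) :
  map_mpoly h (at_x_inv f) = at_x_inv (map_mpoly h f).
Proof.
rewrite /at_x_inv /comp_mpoly.
pose K := maxn (msize f) (msize (map_mpoly h f)).
rewrite !(@mmapE _ _ _ _ _ _ K); try by rewrite leq_max leqnn ?orbT.
rewrite raddf_sum; apply: eq_bigr => m _ /=.
rewrite rmorphM /= map_mpolyC mcoeff_map_mpoly; congr (_ * _).
rewrite /mmap1 rmorph_prod; apply: eq_bigr => i _ /=.
by rewrite rmorphXn /= !tnth_mktuple map_mpolyX.
Qed.

(* Substituting t := q^k turns the weight into a Laurent polynomial modulo q^D
   for every D. *)
Lemma orth_is_form (f g : {mpoly (qtpoly C)[N]}) (s : C) (k : nat) : (0 < k)%N ->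
  (forall a b, form_coef f g a b = 0) ->
  is_form root s k (map_mpoly (qt_eval s (s ^+ k)) f) (map_mpoly (qt_eval s (s ^+ k)) g) 0.
Proof.
move=> k0 h.
have evE p : map_mpoly (qt_eval s (s ^+ k)) p = map_mpoly (horner_eval s) (map_mpoly (horner_eval ('X^k : {poly C})) p) :> {mpoly C[N]}.
  have -> : qt_eval s (s ^+ k) = (horner_eval s) \o (horner_eval ('X^k : {poly C})).
    by apply: boolp.funext => r; rewrite qt_evalE.
  by apply/mpolyP => m; rewrite !mcoeff_map_mpoly.
pose W (R : comNzRingType) (Q : R) : {mpoly R[N + N]} :=
  \prod_(i < N) \prod_(j < N | j != i) \prod_(l < k) (1 - (Q%:MP) ^+ l * xy R i j).
pose G (R : comNzRingType) (Q : R) (f g : {mpoly R[N]}) := at_x f * at_x_inv g * W R Q.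
have G0 : const_term (G _ 'X (map_mpoly (horner_eval ('X^k : {poly C})) f) (map_mpoly (horner_eval ('X^k : {poly C})) g)) = 0.
  apply/polyP => n; rewrite coef0; pose D := n.+1.
  pose c := const_term (at_x f * at_x_inv g * weight_trunc C N D).
  have c0 : c.['X^k]`_n = 0.
    apply: (@low_coef_eval _ _ D) => // a b aD bD.
    by rewrite form_coef_stable // gtn_max aD bD.
  have E : const_term (map_mpoly (horner_eval ('X^k : {poly C}))
      (at_x f * at_x_inv g * weight_trunc C N D)) = c.['X^k] by exact: const_term_map.
  rewrite -[RHS]c0 -E rmorphM3 /= map_at_x map_at_x_inv.
  rewrite weight_truncE gen_weight_map /=.
  rewrite !map_mpolyC /=.
  have -> : (horner_eval ('X^k : {poly C})) (qvar C) = 'X by rewrite /horner_eval hornerC.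
  have -> : (horner_eval ('X^k : {poly C})) (tvar C) = 'X^k by rewrite /horner_eval hornerX.
  have -> : (fun i j : 'I_N => map_mpoly (horner_eval ('X^k : {poly C})) (xy (qtpoly C) i j)) = xy {poly C}.
    apply: boolp.funext => i; apply: boolp.funext => j.
    by rewrite /xy rmorphM /= !map_mpolyX.
  rewrite rmorphXn.
  have [e1 [e2 ->]] := gen_weight_lim (xy {poly C}) ('X%:MP) D k0.
  rewrite !mulrDr ![_ * at_x_inv _ * (_ * _)]mulrCA -!rmorphXn !mul_mpolyC !raddfD /=.
  by rewrite !const_termZ !coefD !coefXnM ltnSn !addr0.
have := congr1 (horner_eval s) G0; rewrite -const_term_map /G !rmorphM /= map_at_x map_at_x_inv -!evE.
move: (map_mpoly _ f) (map_mpoly _ g) => f' g'.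
have -> : map_mpoly (horner_eval s) (W _ 'X) = W _ s.
  rewrite rmorph_prod; apply: eq_bigr => i _; rewrite rmorph_prod; apply: eq_bigr => j _.
  rewrite rmorph_prod; apply: eq_bigr => l _.
  by rewrite rmorphB rmorph1 rmorphM rmorphXn /= map_mpolyC /xy rmorphM /= !map_mpolyX /horner_eval hornerX.
have -> : (horner_eval s) 0 = 0 by rewrite /horner_eval horner0.
move=> e; rewrite /is_form -e; apply: has_ct_ext (has_ct_const_term rootP _) => // x hx.
rewrite !mevalM !comp_mpoly_meval; congr (_ * _ * _).
- by apply: meval_eq => i; rewrite tnth_mktuple mevalXU pair_invl.
- by apply: meval_eq => i; rewrite tnth_mktuple mevalXU pair_invr.
rewrite rmorph_prod; apply: eq_bigr => i _; rewrite rmorph_prod; apply: eq_bigr => j _.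
rewrite rmorph_prod; apply: eq_bigr => l _.
rewrite in_set0 addn0 rmorphB rmorph1 !rmorphM rmorphXn /= mevalC.
by rewrite !mevalXU pair_invl pair_invr.
Qed.

End Specialization.

Lemma fracP (R : idomainType) (a : {fraction R}) :
  exists n d : R, d != 0 /\ a = tofrac n / tofrac d.
Proof.
pose r := generic_quotient.repr a.
exists (frac r).1, (frac r).2; have d0 := denom_ratioP r; split=> //.
have e : a * tofrac (frac r).2 = tofrac (frac r).1.
  rewrite -[a in LHS]generic_quotient.reprK -/r; unlock tofrac.
  rewrite -[LHS]FracField.pi_mul; apply/generic_quotient.eqmodP.
  rewrite /FracField.mulf !numden_Ratio ?oner_neq0 //= ?mulr1 //.
  by rewrite /= FracField.equivfE !numden_Ratio ?oner_neq0 // mulr1 mulrC.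
by rewrite -e mulfK // tofrac_eq0.
Qed.

(** * Values of rational functions of q and t *)

Section Value.
Context (F : fieldType) (q t : F).
Implicit Types (a b : qtfrac F) (p : qtpoly F).

Local Notation ev := (qt_eval q t).

Lemma qt_evalD p p' : ev (p + p') = ev p + ev p'.
Proof. by rewrite /qt_eval !hornerD. Qed.

Lemma qt_evalM p p' : ev (p * p') = ev p * ev p'.
Proof. by rewrite /qt_eval !hornerM. Qed.

Lemma qt_evalC (c : F) : ev c%:P%:P = c.
Proof. by rewrite /qt_eval !hornerC. Qed.

(** Regularity together with the value, as a relation: unlike [qtfrac_eval], which returns 0 by
    default, it is compatible with sums and products, and with inverses of nonzero values. *)
Definition has_val a (v : F) := exists n d : qtpoly F,
  [/\ ev d != 0, a = tofrac n / tofrac d & v = ev n / ev d].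

Lemma ev_neq0 p : ev p != 0 -> tofrac p != 0.
Proof.
by apply: contra => /eqP/eqP; rewrite tofrac_eq0 => /eqP ->; rewrite /qt_eval !horner0.
Qed.

Lemma has_val_uniq a v v' : has_val a v -> has_val a v' -> v = v'.
Proof.
case=> n [d [d0 -> ->]] [n' [d' [d0' e ->]]].
have := e; move/(congr1 (fun z => z * tofrac d * tofrac d')).
rewrite divfK ?ev_neq0 // mulrAC divfK ?ev_neq0 // -!rmorphM.
move=> /eqP; rewrite tofrac_eq => /eqP /(congr1 ev); rewrite !qt_evalM => h.
by apply: (mulIf d0); apply: (mulIf d0'); rewrite divfK // mulrAC divfK.
Qed.

Lemma qtfrac_evalE a v : has_val a v -> qtfrac_eval q t a = v.
Proof.
move=> h; apply: classical_sets.xget_unique => // v' h'.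
exact: has_val_uniq h' h.
Qed.

Lemma has_val_tofrac p : has_val (tofrac p) (ev p).
Proof.
have e1 : ev 1 = 1 by rewrite /qt_eval !hornerC.
by exists p, 1; rewrite tofrac1 e1 oner_neq0 !divr1.
Qed.

Lemma has_val0 : has_val 0 0.
Proof. by have := has_val_tofrac 0; rewrite rmorph0 /qt_eval !horner0. Qed.

Lemma has_val1 : has_val 1 1.
Proof. by have := has_val_tofrac 1; rewrite rmorph1 /qt_eval !hornerC. Qed.

Lemma has_valD a b v w : has_val a v -> has_val b w -> has_val (a + b) (v + w).
Proof.
case=> n [d [d0 -> ->]] [n' [d' [d0' -> ->]]].
exists (n * d' + n' * d), (d * d'); rewrite !qt_evalM qt_evalD !qt_evalM mulf_neq0 //.
by split=> //; rewrite ?rmorphD ?rmorphM addf_div ?ev_neq0.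
Qed.

Lemma has_valM a b v w : has_val a v -> has_val b w -> has_val (a * b) (v * w).
Proof.
case=> n [d [d0 -> ->]] [n' [d' [d0' -> ->]]].
exists (n * n'), (d * d'); rewrite !qt_evalM mulf_neq0 //.
by split=> //; rewrite ?rmorphM mulf_div.
Qed.

Lemma has_valC (c : F) : has_val (tofrac c%:P%:P) c.
Proof. by rewrite -{2}(qt_evalC c); apply: has_val_tofrac. Qed.

Lemma has_valN a v : has_val a v -> has_val (- a) (- v).
Proof.
move=> h; rewrite -mulN1r -[- v]mulN1r; apply: has_valM => //.
by have := has_valC (-1); rewrite !polyCN !rmorphN !rmorph1.
Qed.

Lemma has_valB a b v w : has_val a v -> has_val b w -> has_val (a - b) (v - w).
Proof. by move=> ha hb; apply: has_valD ha (has_valN hb). Qed.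

Lemma has_valV a v : v != 0 -> has_val a v -> has_val a^-1 v^-1.
Proof.
move=> v0 [n [d [d0 -> ev_]]]; exists d, n.
have n0 : ev n != 0 by apply: contraNneq v0 => e; rewrite ev_ e mul0r.
by rewrite n0 ev_ !invfM !invrK ![_^-1 * _]mulrC.
Qed.

Lemma has_val_sum (I : Type) (r : seq I) (P : pred I) (f : I -> qtfrac F) (v : I -> F) :
  (forall i, P i -> has_val (f i) (v i)) ->
  has_val (\sum_(i <- r | P i) f i) (\sum_(i <- r | P i) v i).
Proof.
move=> h; elim/big_rec2: _ => [|i a b Pi hab]; first exact: has_val0.
by apply: has_valD hab; apply: h.
Qed.

Lemma has_val_prod (I : Type) (r : seq I) (P : pred I) (f : I -> qtfrac F) (v : I -> F) :
  (forall i, P i -> has_val (f i) (v i)) ->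
  has_val (\prod_(i <- r | P i) f i) (\prod_(i <- r | P i) v i).
Proof.
move=> h; elim/big_rec2: _ => [|i a b Pi hab]; first exact: has_val1.
by apply: has_valM hab; apply: h.
Qed.

Lemma has_valX a v n : has_val a v -> has_val (a ^+ n) (v ^+ n).
Proof.
move=> h; elim: n => [|n IH]; first by rewrite !expr0; apply: has_val1.
by rewrite !exprS; apply: has_valM.
Qed.

Lemma has_val_q : has_val (tofrac (qvar F)) q.
Proof. by have := has_val_tofrac (qvar F); rewrite /qt_eval hornerC hornerX. Qed.

Lemma has_val_t : has_val (tofrac (tvar F)) t.
Proof. by have := has_val_tofrac (tvar F); rewrite /qt_eval hornerX hornerC. Qed.

Context (N : nat).

(** [qtfrac_eval] is not a ring morphism; only its value 0 at 0 matters here, for the exponents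
    outside the support. *)
Lemma mcoeff_qtfrac_eval (p : {mpoly (qtfrac F)[N]}) m :
  (map_mpoly (qtfrac_eval q t) p)@_m = qtfrac_eval q t p@_m.
Proof.
rewrite /map_mpoly /mmap raddf_sum /=.
under eq_bigr do rewrite mmap1_id mul_mpolyC mcoeffZ mcoeffX.
have [pm|pm] := boolP (m \in msupp p).
  rewrite (bigD1_seq m) ?msupp_uniq //= eqxx mulr1 big1 ?addr0 // => k /negbTE ->.
  by rewrite mulr0.
rewrite (memN_msupp_eq0 pm) (qtfrac_evalE has_val0) big_seq big1 // => k kp.
by case: eqP => [e|_]; rewrite ?mulr0 //; rewrite e (negbTE pm) in kp.
Qed.

Definition constK (c : F) : qtfrac F := tofrac c%:P%:P.

Definition eigK X := @eigpsi (qtfrac F) N (constK X) (tofrac (qvar F)) (tofrac (tvar F)).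

Lemma has_val_eig X w m : has_val (eigK X w m) (eigpsi X q t w m).
Proof.
apply: has_val_prod => i _; apply: has_valD has_val1 _.
apply: has_valM (has_valX _ has_val_q); apply: has_valM (has_valX _ has_val_t).
exact: has_valC.
Qed.

Definition eig_defect (R : comNzRingType) (psi : 'S_N -> 'X_{1..N} -> R) la :=
  fun w m => psi w m - psi 1%g la.

Lemma has_val_alternant (psiK : 'S_N -> 'X_{1..N} -> qtfrac F)
    (psi : 'S_N -> 'X_{1..N} -> F) (p : {mpoly (qtfrac F)[N]}) M :
  (forall w m, has_val (psiK w m) (psi w m)) ->
  (forall m, exists v, has_val p@_m v) ->
  has_val (alternant psiK p)@_M (alternant psi (map_mpoly (qtfrac_eval q t) p))@_M.
Proof.
move=> hpsi hp; rewrite !mcoeff_alternant; apply: has_val_sum => w _.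
apply: has_valM.
  by have := has_valC ((-1) ^+ w); rewrite !rmorphXn !rmorphN !rmorph1.
apply: has_valM => //; rewrite mcoeff_qtfrac_eval.
by have [v hv] := hp (M - [multinom stair N (w i) | i < N])%MM; rewrite (qtfrac_evalE hv).
Qed.

Lemma has_val_defect X la w m :
  has_val (eig_defect (eigK X) la w m) (eig_defect (eigpsi X q t) la w m).
Proof. by apply: has_valB; apply: has_val_eig. Qed.

End Value.

(** * Density of the points (s, s^k) *)

Section Generic.
Context (C : numClosedFieldType).
Implicit Types (Q : C -> nat -> Prop).

(** Validity at the points (s, s^k) outside the zero set of one nonzero polynomial. The notion is
    stable under finite conjunctions, and by [generic_frac0] such points still detect whether a
    rational function is zero. *)
Definition generic Q := exists2 d : qtpoly C, d != 0 &
  forall s k, 0 < s < 1 -> (0 < k)%N -> qt_eval s (s ^+ k) d != 0 -> Q s k.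

Lemma generic_true Q : (forall s k, Q s k) -> generic Q.
Proof. by move=> h; exists 1; rewrite ?oner_neq0. Qed.

Lemma generic_mono Q Q' : (forall s k, 0 < s < 1 -> (0 < k)%N -> Q s k -> Q' s k) ->
  generic Q -> generic Q'.
Proof. by move=> h [d d0 hd]; exists d => // s k *; apply: h => //; apply: hd. Qed.

Lemma generic_and Q Q' : generic Q -> generic Q' -> generic (fun s k => Q s k /\ Q' s k).
Proof.
case=> d d0 h [d' d0' h']; exists (d * d'); first by rewrite mulf_neq0.
move=> s k hs hk; rewrite qt_evalM mulf_eq0 negb_or => /andP[h1 h2].
by split; [apply: h|apply: h'].
Qed.

Lemma generic_seq (I : eqType) (r : seq I) (Q : I -> C -> nat -> Prop) :
  (forall i, i \in r -> generic (Q i)) ->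
  generic (fun s k => forall i, i \in r -> Q i s k).
Proof.
elim: r => [|i r IH] h; first exact: generic_true.
have h1 := h i (mem_head _ _).
have h2 : generic (fun s k => forall i, i \in r -> Q i s k).
  by apply: IH => j jr; apply: h; rewrite in_cons jr orbT.
apply: generic_mono (generic_and h1 h2) => s k _ _ [q1 q2] j.
by rewrite in_cons => /orP[/eqP -> //|/q2].
Qed.

Lemma generic_neq0 (d : qtpoly C) : d != 0 ->
  generic (fun s k => qt_eval s (s ^+ k) d != 0).
Proof. by move=> d0; exists d. Qed.

Lemma generic_val (a : qtfrac C) : generic (fun s k => exists v, has_val s (s ^+ k) a v).
Proof.
have [n [d [d0 ->]]] := fracP a; apply: generic_mono (generic_neq0 d0) => s k _ _ h.
by exists (qt_eval s (s ^+ k) n / qt_eval s (s ^+ k) d), n, d.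
Qed.

Lemma poly_inf_roots (K : idomainType) (p : {poly K}) (r : nat -> K) :
  injective r -> (forall n, p.[r n] = 0) -> p = 0.
Proof.
move=> ri h; apply/eqP/negPn/negP => p0.
pose rs := [seq r i | i <- iota 0 (size p)].
have := @max_poly_roots K p rs p0; rewrite size_map size_iota ltnn.
have -> : all (root p) rs by apply/allP => x /mapP[i _ ->]; rewrite /root h.
by rewrite map_inj_uniq ?iota_uniq // => /(_ isT isT).
Qed.

(** For fixed s the numbers s^k are infinitely many zeros in t; each coefficient in t then vanishes
    at infinitely many s. *)
Lemma qt_poly_eq0 (p : qtpoly C) :
  (forall s k, 0 < s < 1 -> (0 < k)%N -> qt_eval s (s ^+ k) p = 0) -> p = 0.
Proof.
move=> h; apply/polyP => b; rewrite coef0.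
pose r n : C := (n.+2%:R)^-1.
have rn n : 0 < r n < 1.
  by rewrite /r invr_gt0 ltr0n /= invf_lt1 ?ltr0n // ltr1n.
apply: (@poly_inf_roots _ _ r) => [n n' /invr_inj /eqP|n].
  by rewrite eqr_nat => /eqP [].
have e : map_poly (horner_eval (r n)) p = 0.
  apply: (@poly_inf_roots _ _ (fun k => r n ^+ k.+1)) => [k k' e|k].
    have [r0 r1] := andP (rn n); apply: succn_inj.
    exact: (@ieexprIn _ (r n) r0 (negbT (lt_eqF r1))).
  rewrite -(h (r n) k.+1 (rn n) isT) /qt_eval.
  by rewrite -[RHS]/(horner_eval (r n) _) -horner_map /= [in RHS]/horner_eval hornerC.
have := congr1 (fun q : {poly C} => q`_b) e; rewrite coef0 coef_map; exact.
Qed.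

Lemma generic_frac0 (a : qtfrac C) : generic (fun s k => has_val s (s ^+ k) a 0) -> a = 0.
Proof.
case=> d d0 h; have [n [e [e0 ea]]] := fracP a.
suff : d * e * n = 0.
  by move/eqP; rewrite !mulf_eq0 (negbTE d0) (negbTE e0) /= ea => /eqP ->; rewrite rmorph0 mul0r.
apply: qt_poly_eq0 => s k hs hk; rewrite !qt_evalM.
have [->|dn] := eqVneq (qt_eval s (s ^+ k) d) 0; first by rewrite !mul0r.
have [->|en] := eqVneq (qt_eval s (s ^+ k) e) 0; first by rewrite mulr0 mul0r.
have h1 := h s k hs hk dn.
have h2 : has_val s (s ^+ k) a (qt_eval s (s ^+ k) n / qt_eval s (s ^+ k) e).
  by exists n, e.
have := has_val_uniq h1 h2; move/esym/eqP; rewrite mulf_eq0 invr_eq0 (negbTE en) orbF.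
by move/eqP ->; rewrite mulr0.
Qed.

End Generic.

Lemma mcoeff_monsym (R : nzRingType) (N : nat) (mu nu : 'X_{1..N}) :
  is_part mu -> is_part nu -> (monsym R mu)@_nu = (nu == mu)%:R.
Proof.
move=> pmu pnu; rewrite /monsym raddf_sum /=.
under eq_bigr do rewrite mcoeffX.
have [->|ne] := eqVneq nu mu.
  rewrite (bigD1 (BMultinom (ltnSn (mdeg mu)))) //= eqxx big1 ?addr0 // => m /andP[_ nm].
  by rewrite (_ : (_ == _) = false) //; apply: contraNF nm.
rewrite big1 // => m hm; case: eqP => // e; case/negP: ne; rewrite -{nu}e in pnu *.
have /tuple_permP[s es] := hm.
have e : bmnm m = [multinom mu (s i) | i < N].
  by apply/mnmP => i; rewrite (mnm_nth 0%N) mnmE es -tnth_nth tnth_mktuple.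
by rewrite e part_perm_uniq // -e.
Qed.

(** * The eigenvalue equation for Macdonald polynomials *)

Section Macdonald.
Context (C : numClosedFieldType) (N : nat) (root : nat -> C).
Hypothesis rootP : forall n, (0 < n)%N -> n.-primitive_root (root n).
Variable (P : polyfamily C N).
Hypothesis hP : is_macdonald P.
Implicit Types (la mu nu : 'X_{1..N}).

Local Notation "m # s" := [multinom m (s i) | i < N]
  (at level 40, left associativity, format "m # s").

Lemma mac_sym la : is_part la -> P la \is symmetric.
Proof. by case: hP => h _ _; apply: h. Qed.

Lemma mac_lead la : is_part la -> (P la)@_la = 1.
Proof.
move=> pla; case: hP => _ /(_ _ pla)[c ->] _.
rewrite mcoeffD mcoeff_monsym // eqxx raddf_sum /= big1 ?addr0 // => mu /andP[pmu lt].
rewrite mcoeffZ mcoeff_monsym //; case: eqP => [e|_]; last by rewrite mulr0.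
by case/and3P: lt => _ /eqP[].
Qed.

Lemma mac_low la nu : is_part la -> is_part nu -> nu != la -> (P la)@_nu != 0 ->
  (sqnorm nu < sqnorm la)%N.
Proof.
move=> pla pnu ne; case: hP => _ /(_ _ pla)[c ->] _.
rewrite mcoeffD mcoeff_monsym // (negbTE ne) add0r raddf_sum /=.
apply: contraNT => nlt; apply/eqP; apply: big1 => mu /andP[pmu lt].
rewrite mcoeffZ mcoeff_monsym //; case: eqP => [e|_]; last by rewrite mulr0.
by case/negP: nlt; apply: dom_sqnorm => //; rewrite e.
Qed.

Definition specialize (q t : C) la : {mpoly C[N]} := map_mpoly (qtfrac_eval q t) (P la).

Lemma specialize_triangular (q t : C) B : triangular (specialize q t) B.
Proof.
move=> mu pmu _; split=> [||nu pnu ne].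
- apply/issymP => s; apply/mpolyP => m.
  by rewrite mcoeff_sym !mcoeff_qtfrac_eval msym_coeff ?mac_sym.
- by rewrite mcoeff_qtfrac_eval mac_lead // (qtfrac_evalE (has_val1 q t)).
rewrite mcoeff_qtfrac_eval => h; apply: mac_low => //.
by apply: contraNneq h => ->; rewrite (qtfrac_evalE (has_val0 q t)).
Qed.

Lemma generic_regular la :
  generic (fun s k => forall m, exists v, has_val s (s ^+ k) (P la)@_m v).
Proof.
have := @generic_seq C _ (msupp (P la)) (fun m s k => exists v, has_val s (s ^+ k) (P la)@_m v)
   (fun m _ => generic_val _).
apply: generic_mono => s k _ _ h m; have [pm|pm] := boolP (m \in msupp (P la)).
  exact: h.
by exists 0; rewrite (memN_msupp_eq0 pm); apply: has_val0.
Qed.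

Lemma generic_orth la mu : is_part la -> is_part mu -> la != mu ->
  generic (fun s k => is_form root s k (specialize s (s ^+ k) la) (specialize s (s ^+ k) mu) 0).
Proof.
move=> pla pmu ne; case: hP => _ _ /(_ _ _ pla pmu ne)[c [d [f [g [c0 d0 ef eg h]]]]].
have gen := generic_and (generic_and (generic_neq0 c0) (generic_neq0 d0))
  (generic_and (generic_regular la) (generic_regular mu)).
apply: generic_mono gen => s k s01 k0 [[cn dn] [rla rmu]].
have red (e : qtpoly C) (p : {mpoly (qtpoly C)[N]}) nu :
    qt_eval s (s ^+ k) e != 0 -> (forall m, exists v, has_val s (s ^+ k) (P nu)@_m v) ->
    tofrac e *: P nu = map_mpoly (@tofrac _) p ->
    specialize s (s ^+ k) nu = (qt_eval s (s ^+ k) e)^-1 *: map_mpoly (qt_eval s (s ^+ k)) p.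
  move=> en rnu ep; apply/mpolyP => m.
  have evE : qt_eval s (s ^+ k) = horner_eval s \o horner_eval (s ^+ k)%:P by [].
  rewrite mcoeffZ evE mcoeff_map_mpoly -evE mcoeff_qtfrac_eval.
  have [v hv] := rnu m; rewrite (qtfrac_evalE hv); apply: (mulfI en); rewrite mulVKf //.
  apply: (has_val_uniq (q := s) (t := s ^+ k) (a := tofrac e * (P nu)@_m)).
    by apply: has_valM hv; apply: has_val_tofrac.
  rewrite -mcoeffZ ep mcoeff_map_mpoly; exact: has_val_tofrac.
rewrite (red _ _ _ cn rla ef) (red _ _ _ dn rmu eg).
rewrite -(mulr0 (qt_eval s (s ^+ k) c)^-1); apply: (formZ rootP); apply: (formC rootP s01).
rewrite -(mulr0 (qt_eval s (s ^+ k) d)^-1); apply: (formZ rootP); apply: (formC rootP s01).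
exact: orth_is_form.
Qed.

(* A rational function of (q,t) vanishing at almost all points (s, s^k) is zero:
   the eigenvalue equation only has to be checked at t = q^k. *)
Lemma generic_eigen la X : is_part la ->
  alternant (eig_defect (eigK X) la) (P la) = 0 :> {mpoly (qtfrac C)[N]}.
Proof.
move=> pla; apply/mpolyP => M; rewrite mcoeff0; apply: generic_frac0.
(* Partitions with smaller [sqnorm] have degree below [B], so finitely many orthogonality relations
   are involved and a single polynomial excludes the bad points. *)
pose B := (sqnorm la).+1.
have gorth : generic (fun s k => forall mu : 'X_{1..N < B}, mu \in enum {: 'X_{1..N < B}} ->
    is_part mu -> la != bmnm mu ->
    is_form root s k (specialize s (s ^+ k) la) (specialize s (s ^+ k) mu) 0).
  apply: generic_seq => mu _; case: (boolP (is_part mu)) => [pmu|_]; last exact: generic_true.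
  case: (eqVneq la mu) => [_|ne]; first exact: generic_true.
  by apply: generic_mono (generic_orth pla pmu ne) => s k _ _ h _ _.
apply: generic_mono (generic_and gorth (generic_regular la)) => s k s01 k0 [orth reg].
have := has_val_alternant M (has_val_defect s (s ^+ k) X la) reg.
suff -> : alternant (eig_defect (eigpsi X s (s ^+ k)) la)
    (map_mpoly (qtfrac_eval s (s ^+ k)) (P la)) = 0 by rewrite mcoeff0.
rewrite alternantB alternant_cst; apply/eqP; rewrite subr_eq0; apply/eqP.
apply: (@macdonald_eigen C N root rootP s k s01 (specialize s (s ^+ k)) la X pla).
  exact: specialize_triangular.
move=> mu pmu lt; have dmu : (mdeg mu < B)%N.
  by rewrite ltnS; apply: leq_trans (mdeg_sqnorm mu) (ltnW lt).
have := orth (BMultinom dmu); rewrite mem_enum => /(_ isT pmu); apply.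
by apply: contraTneq lt => ->; rewrite ltnn.
Qed.

Section Point.
Variables (q : C) (theta : nat).
Hypotheses (q01 : 0 < q < 1).

Local Notation t := (q ^+ theta).
Local Notation node mu i := (mu i + theta * stair N i)%N.

Lemma eigval_node X mu :
  eigpsi X q t 1%g mu = \prod_i (1 + X * q ^+ node mu i).
Proof.
by apply: eq_bigr => i _; rewrite perm1 -mulrA -exprM -exprD addnC.
Qed.

(** Nodes strictly decrease with the index. If every node of [la] were a node of [mu], matching
    equal nodes would give an order-preserving permutation of the indices, hence the identity. *)
Lemma node_sep la mu : (0 < theta)%N -> is_part la -> is_part mu -> la != mu ->
  exists i, forall j, node la i != node mu j.
Proof.
move=> th0 /is_partP pla /is_partP pmu ne.
suff /existsP[i /forallP hi] : [exists i, [forall j, node la i != node mu j]] by exists i.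
apply: contraNT ne; rewrite negb_exists => /forallP h; apply/eqP.
have {}h i : exists j, node la i == node mu j.
  have := h i; rewrite negb_forall => /existsP[j]; rewrite negbK => ij; by exists j.
pose sg i := xchoose (h i).
have sgE i : node la i = node mu (sg i) by apply/eqP/(xchooseP (h i)).
have st := stair_anti (N := N).
have anti la' (pla' : forall i j : 'I_N, (i <= j)%N -> (la' j <= la' i)%N) (i j : 'I_N) :
    (i < j)%N -> (node la' j < node la' i)%N.
  move=> ij; have := pla' _ _ (ltnW ij); have := st j i; rewrite ij; nia.
have sg_inj : injective sg.
  move=> i j e; have e' : node la i = node la j by rewrite sgE e -sgE.
  apply/val_inj; case: (ltngtP i j) => // /(anti _ pla); rewrite e' ltnn //.
have sg1 : perm sg_inj = 1%g.
  apply: stair_perm_part; apply/is_partP => i j ij; rewrite !mnmE !permE.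
  suff : (sg i <= sg j)%N by have := ltn_ord (sg j); lia.
  rewrite leqNgt; apply/negP => /(anti _ pmu); rewrite -!sgE.
  move: ij; rewrite leq_eqVlt => /orP[/eqP/val_inj -> |/(anti _ pla)]; first by rewrite ltnn.
  by lia.
apply/mnmP => i; have := sgE i; rewrite -(permE sg_inj) sg1 perm1; lia.
Qed.

Lemma eigval_sep la mu : (0 < theta)%N -> is_part la -> is_part mu -> la != mu ->
  exists X, eigpsi X q t 1%g mu != eigpsi X q t 1%g la.
Proof.
move=> th0 pla pmu ne; have [i hi] := node_sep th0 pla pmu ne.
have [q0 q1] := andP q01; have qn : q != 0 by rewrite gt_eqF.
(* At this X the factor of the node [i] vanishes in the eigenvalue of [la], while no factor vanishes
   in that of [mu]. *)
exists (- (q ^+ node la i)^-1); rewrite !eigval_node [X in _ != X](bigD1 i) //=.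
rewrite mulNr mulVf ?expf_neq0 // subrr mul0r; apply/prodf_neq0 => j _.
rewrite mulNr subr_eq0 -(inj_eq (mulfI (expf_neq0 (node la i) qn))) mulr1 mulVKf ?expf_neq0 //.
apply: contra (hi j) => /eqP e; apply/eqP.
exact: (@ieexprIn _ q q0 (negbT (lt_eqF q1))).
Qed.

(** Downward induction on [sqnorm]: the coefficient of the eigenvalue equation at mu + delta
    expresses (E_mu - E_la) times the coefficient of [mu] through coefficients at larger partitions,
    and X is chosen so that E_mu - E_la is nonzero at (q, q^theta). *)
Lemma mac_regular la : (0 < theta)%N -> is_part la ->
  forall m, exists v, has_val q t (P la)@_m v.
Proof.
move=> th0 pla.
suff part n mu : is_part mu -> (sqnorm la <= sqnorm mu + n)%N ->
    exists v, has_val q t (P la)@_mu v.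
  move=> m; have [s ps] := sort_part m.
  by rewrite -(msym_coeff m s) ?mac_sym //; apply: (part (sqnorm la)) => //; apply: leq_addl.
elim: n mu => [|n IH] mu pmu le.
  have [->|ne] := eqVneq mu la; first by exists 1; rewrite mac_lead //; apply: has_val1.
  have [->|nz] := eqVneq (P la)@_mu 0; first by exists 0; apply: has_val0.
  by have := mac_low pla pmu ne nz; lia.
have [->|ne] := eqVneq mu la; first by exists 1; rewrite mac_lead //; apply: has_val1.
rewrite eq_sym in ne; have [X hX] := eigval_sep th0 pla pmu ne.
have := congr1 (mcoeff (mu + stair N)) (generic_eigen X pla).
rewrite mcoeff0 mcoeff_alternant.
have st1 : stair N#(1 : 'S_N)%g = stair N by apply/mnmP => i; rewrite mnmE perm1.
rewrite (bigD1 1%g) /=; last by rewrite st1 lem_addl.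
rewrite st1 addmK odd_perm1 expr0 mul1r => /eqP; rewrite addrC addr_eq0 => /eqP.
set S := \sum_(_ | _) _ => eS.
have [v hv] : exists v, has_val q t S v.
  suff h (w : 'S_N) : exists v, (stair N#w <= mu + stair N)%MM && (w != 1%g) ->
      has_val q t ((-1) ^+ w * (eig_defect (eigK X) la w (mu + stair N - stair N#w)%MM
        * (P la)@_(mu + stair N - stair N#w))) v.
    have [v hv] := boolp.choice h.
    by exists (\sum_(w : 'S_N | (stair N#w <= mu + stair N)%MM && (w != 1%g)) v w);
      apply: has_val_sum => w; apply: hv.
  case: (boolP (_ && _)) => [/andP[le1 nw]|_]; last by exists 0.
  have [s ps] := sort_part (mu + stair N - stair N#w)%MM.
  have e : (((mu + stair N - stair N#w)%MM#s)#(s^-1)%g + stair N#w = mu + stair N)%MM.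
    by rewrite -mpermM mulVg mperm1 submK.
  have [le2 eq2] := sqnorm_perm pmu ps e.
  have lt : (sqnorm mu < sqnorm ((mu + stair N - stair N#w)%MM#s))%N.
    by rewrite ltn_neqAle le2 andbT; apply: contra nw => /eqP /eq2 ->.
  have [|v hv] := IH _ ps; first by lia.
  exists ((-1) ^+ w * (eig_defect (eigpsi X q t) la w (mu + stair N - stair N#w)%MM * v)) => _.
  apply: has_valM.
    by have := has_valC q t ((-1) ^+ w); rewrite !rmorphXn !rmorphN !rmorph1.
  apply: has_valM; first exact: has_val_defect.
  by rewrite -(msym_coeff _ s) ?mac_sym.
have hE := has_val_defect q t X la 1%g mu.
have En : eig_defect (eigpsi X q t) la 1%g mu != 0 by rewrite subr_eq0.
have EKn : eig_defect (@eigK _ N X) la 1%g mu != 0.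
  apply: contraNneq En => e; rewrite e in hE.
  by apply/eqP; apply: has_val_uniq hE (has_val0 q t).
exists ((eig_defect (eigpsi X q t) la 1%g mu)^-1 * - v).
have -> : (P la)@_mu = (eig_defect (@eigK _ N X) la 1%g mu)^-1 * - S.
  by rewrite eS opprK mulKf.
by apply: has_valM; [apply: has_valV|apply: has_valN].
Qed.

Theorem mac_eigen la X : (0 < theta)%N -> is_part la ->
  alternant (eigpsi X q t) (specialize q t la)
  = eigpsi X q t 1%g la *: (alternant (@one_psi C N) 1 * specialize q t la).
Proof.
move=> th0 pla; apply/eqP; rewrite -subr_eq0 -alternant_cst -alternantB; apply/eqP.
apply/mpolyP => M; rewrite mcoeff0.
have := has_val_alternant M (has_val_defect q t X la) (mac_regular th0 pla).
rewrite generic_eigen // mcoeff0 => h.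
exact: has_val_uniq h (has_val0 q t).
Qed.

End Point.
End Macdonald.

(** Uniqueness of digits in base [B], needed to encode a monomial in several variables by a single
    exponent. *)
Lemma base_inj B n (f g : nat -> nat) : (forall i, f i < B)%N -> (forall i, g i < B)%N ->
  (\sum_(i < n) f i * B ^ i = \sum_(i < n) g i * B ^ i)%N ->
  forall i, (i < n)%N -> f i = g i.
Proof.
elim: n f g => [|n IH] f g hf hg //; rewrite !big_ord_recl /= !muln1.
have red (h : nat -> nat) : (\sum_(i < n) h (bump 0 i) * B ^ bump 0 i
    = B * \sum_(i < n) h i.+1 * B ^ i)%N.
  by rewrite big_distrr; apply: eq_bigr => i _; rewrite /bump add1n expnS mulnCA.
rewrite !red => e; have B0 : (0 < B)%N by apply: leq_ltn_trans (hf 0%N).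
have e0 : f 0%N = g 0%N.
  have := congr1 (modn^~ B) e.
  by rewrite /= ![(B * _)%N]mulnC ![(_ + _ * B)%N]addnC !modnMDl !modn_small.
move: e; rewrite e0 => /addnI /eqP; rewrite eqn_pmul2l // => /eqP e.
case=> // i; rewrite ltnS.
exact: (IH (fun j => f j.+1) (fun j => g j.+1) (fun j => hf j.+1) (fun j => hg j.+1) e).
Qed.

(** * Principal specializations *)

Section Principal.
Context (C : numClosedFieldType) (n theta : nat) (q : C).
Hypotheses (th0 : (0 < theta)%N) (q01 : 0 < q < 1).
Local Notation N := n.+1.
Local Notation t := (q ^+ theta).
Implicit Types (x : 'I_N -> C) (S I : {set 'I_N}).

Let q0 : q != 0. Proof. by case/andP: q01 => /lt0r_neq0. Qed.
Let q_inj : injective (fun k : nat => q ^+ k).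
Proof. by have [h1 h2] := andP q01; exact: (@ieexprIn _ q h1 (negbT (lt_eqF h2))). Qed.

Variables (p : {mpoly C[N]}) (E : C -> C).
Hypothesis p_neq0 : p != 0.
Hypothesis eigen : forall X x,
  \sum_(I : {set 'I_N}) X ^+ #|I| * ad (tshift I t x) * p.@[tshift I q x]
  = E X * (ad x * p.@[x]).

Definition dot_pt (k : 'I_N -> nat) : 'I_N -> C := fun i => q ^+ (k i + theta * i).

Definition nondec (k : 'I_N -> nat) := forall i j : 'I_N, (i <= j)%N -> (k i <= k j)%N.

(** The weights i + 1 make a final segment of indices strictly heaviest among the sets of its size
    ([top_sum]). *)
Definition wgt (k : 'I_N -> nat) : nat := (\sum_(i < N) i.+1 * k i)%N.

Lemma ad_eq0P (f : 'I_N -> nat) : (forall i j, f i = f j -> i = j) -> ad (fun i => q ^+ f i) != 0.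
Proof. by move=> h; apply: ad_neq0 => i j /q_inj /h. Qed.

Lemma ad_eq0 x (i j : 'I_N) : (i < j)%N -> x i = x j -> ad x = 0.
Proof.
move=> ij e; have [b ->] := ad_vdm C N.
by rewrite /vdm (bigD1 i) //= (bigD1 j) //= e subrr !(mul0r, mulr0).
Qed.

Lemma nondecP (k : 'I_N -> nat) :
  (forall i j : 'I_N, j = i.+1 :> nat -> (k i <= k j)%N) -> nondec k.
Proof.
move=> h i j ij; have := subnKC ij; move: (j - i)%N => d.
elim: d j {ij} => [|d IH] j e; first by rewrite addn0 in e; rewrite (val_inj e).
have jN : (j.-1 < N)%N by have := ltn_ord j; lia.
apply: leq_trans (h (Ordinal jN) j _); last by rewrite /=; lia.
by apply: IH; rewrite /=; lia.
Qed.

Lemma top_sum (J T : {set 'I_N}) (h : 'I_N) :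
  (forall i, (i \in T) = (h <= i)%N) -> #|J| = #|T| -> J != T ->
  (\sum_(i in J) i.+1 < \sum_(i in T) i.+1)%N.
Proof.
move=> hT cJ ne; rewrite (big_setID T) /= [ltnRHS](big_setID J) /= setIC ltn_add2l.
have c : #|J :\: T| = #|T :\: J|.
  by have := cardsID T J; have := cardsID J T; rewrite setIC; lia.
have c0 : (0 < #|T :\: J|)%N.
  rewrite card_gt0; apply: contra ne => /eqP e0.
  by have := c; rewrite e0 cards0 => /eqP; rewrite cards_eq0 => e1;
    rewrite -subset0 in e1; rewrite eqEsubset -!setD_eq0 e0 -subset0 e1 eqxx.
apply: (@leq_ltn_trans (\sum_(i in J :\: T) h)%N).
  by apply: leq_sum => i; rewrite inE hT -ltnNge => /andP[].
rewrite sum_nat_const c -[(_ * _)%N]addn0 -sum_nat_const.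
apply: (@leq_trans (\sum_(i in T :\: J) h.+1)%N).
  by rewrite !sum_nat_const; nia.
by apply: leq_sum => i; rewrite inE hT => /andP[].
Qed.

(* A zero at (1, t, ..., t^(N-1)) propagates through the eigenvalue equation to
   all points q^mu_i t^i with mu nondecreasing. *)
Lemma vanish_all : p.@[dot_pt (fun=> 0%N)] = 0 -> forall k, nondec k -> p.@[dot_pt k] = 0.
Proof.
move=> p0 k; move: {2}(wgt k) (leqnn (wgt k)) => w.
elim: w k => [|w IH] k lw hk.
  rewrite -p0; apply: meval_eq => i; congr (q ^+ (_ + _)).
  by apply/eqP; move: lw; rewrite leqn0 sum_nat_eq0 => /forallP/(_ i); rewrite muln_eq0.
case: (pickP (fun i => 0 < k i)%N) => [i0 hi0|h0]; last first.
  rewrite -p0; apply: meval_eq => i; congr (q ^+ (_ + _)).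
  by have := h0 i; case: (k i).
(* [T] will be the final segment of indices with k i > 0, and [mu] lowers [k] by one on it. In the
   equation at [mu], the coefficient of X^#|T| involves the sets J of the size of [T]. If J differs
   from [T], either the raised point is not monotone, and then two coordinates of the point dilated
   by t coincide, or it is monotone of smaller weight; so only [T] remains. *)
have [h hh hmin] := @arg_minnP _ i0 (fun i => 0 < k i)%N (fun i : 'I_N => val i) hi0.
pose T := [set i : 'I_N | (h <= i)%N].
have TE i : (i \in T) = (h <= i)%N by rewrite inE.
have kT i : (0 < k i)%N = (i \in T).
  rewrite TE; apply/idP/idP => [/hmin //|hi]; exact: leq_trans hh (hk _ _ hi).
pose mu i := (k i - (i \in T))%N.
have kE i : k i = (mu i + (i \in T))%N by rewrite /mu -kT; lia.
pose nu (J : {set 'I_N}) i := (mu i + (i \in J))%N.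
have wnu J : wgt (nu J) = (wgt mu + \sum_(i in J) i.+1)%N.
  rewrite /wgt [X in _ = (_ + X)%N]big_mkcond -big_split /=; apply: eq_bigr => i _.
  by rewrite /nu mulnDr; case: (i \in J); rewrite ?muln1 ?muln0.
have wk : wgt k = wgt (nu T) by apply: eq_bigr => i _; rewrite kE.
have hmu : nondec mu.
  move=> i j ij; have := hk i j ij; have := kT i; have := kT j.
  by rewrite /mu !TE; lia.
have w_mu : (wgt mu <= w)%N.
  have : (0 < \sum_(i in T) i.+1)%N by rewrite (bigD1 h) ?TE.
  move=> pos; rewrite -ltnS; apply: leq_trans lw.
  by rewrite wk wnu -addn1 leq_add2l.
have pmu := IH mu w_mu hmu.
have sh (J : {set 'I_N}) (s : C) (e : nat) : s = q ^+ e -> tshift J s (dot_pt mu)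
    =1 fun i => q ^+ (e * (i \in J) + (mu i + theta * i)).
  move=> -> i; rewrite /tshift /dot_pt; case: (i \in J) => /=.
    by rewrite muln1 [RHS]exprD.
  by rewrite muln0 add0n mul1r.
pose a (J : {set 'I_N}) := ad (tshift J t (dot_pt mu)) * p.@[tshift J q (dot_pt mu)].
pose G : {poly C} := \sum_(J : {set 'I_N}) a J *: 'X^#|J|.
have G0 : G = 0.
  apply: (@poly_inf_roots C G (fun m => m%:R)) => [i j /eqP|m].
    by rewrite eqr_nat => /eqP.
  have := eigen m%:R (dot_pt mu); rewrite pmu !mulr0 => <-.
  rewrite horner_sum; apply: eq_bigr => J _.
  by rewrite hornerZ hornerXn /a mulrC mulrA.
have pk J : p.@[tshift J q (dot_pt mu)] = p.@[dot_pt (nu J)].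
  apply: meval_eq => i; rewrite (sh J q 1%N) ?expr1 // /dot_pt /nu; congr (q ^+ _); lia.
have zero (J : {set 'I_N}) : #|J| = #|T| -> J != T -> a J = 0.
  move=> cJ ne; rewrite /a pk.
  have [|nn] := boolP [forall i : 'I_N, forall j : 'I_N, (i <= j)%N ==> (nu J i <= nu J j)%N].
    move=> /forallP h'; rewrite IH ?mulr0 //; last first.
      by move=> i j ij; have /forallP/(_ j)/implyP := h' i; apply.
    rewrite -ltnS; apply: leq_trans lw; rewrite wk !wnu ltn_add2l; exact: top_sum TE cJ ne.
  suff [i [j [ij e]]] : exists i j : 'I_N, (i < j)%N /\
      tshift J t (dot_pt mu) i = tshift J t (dot_pt mu) j by rewrite (ad_eq0 ij e) mul0r.
  suff [i [j [ij le]]] : exists i j : 'I_N, j = i.+1 :> nat /\ (nu J j < nu J i)%N.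
    exists i, j; split; first by rewrite ij.
    rewrite !(sh J t theta) // ij; congr (q ^+ _).
    have := hmu i j; rewrite ij => /(_ (leqnSn _)); move: le; rewrite /nu.
    by case: (i \in J); case: (j \in J) => /=; nia.
  case: (boolP [exists i : 'I_N, exists j : 'I_N, (j == i.+1 :> nat) && (nu J j < nu J i)%N]).
    by case/existsP => i /existsP[j /andP[/eqP e lt]]; exists i, j.
  rewrite negb_exists => /forallP h'; case/negP: nn.
  apply/forallP => i; apply/forallP => j; apply/implyP; apply: nondecP => {}i {}j e.
  have := h' i; rewrite negb_exists => /forallP/(_ j); rewrite e eqxx /= -leqNgt.
  exact.
have aT : a T = 0.
  have := congr1 (fun g : {poly C} => g`_#|T|) G0; rewrite coef0 coef_sum (bigD1 T) //=.
  rewrite coefZ coefXn eqxx mulr1 big1 ?addr0 // => J ne.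
  rewrite coefZ coefXn; case: eqP => [e|_]; last by rewrite mulr0.
  by rewrite mulr1 zero.
have adT : ad (tshift T t (dot_pt mu)) != 0.
  have -> : tshift T t (dot_pt mu) = fun i => q ^+ (theta * (i \in T) + (mu i + theta * i)).
    by apply: boolp.funext => i; rewrite (sh T t theta).
  have mono (i j : 'I_N) : (i < j)%N -> (theta * (i \in T) + (mu i + theta * i)
     < theta * (j \in T) + (mu j + theta * j))%N.
    move=> ij; have := hmu i j (ltnW ij); rewrite !TE.
    have : (h <= i)%N ==> (h <= j)%N by apply/implyP => hi; apply: leq_trans hi (ltnW ij).
    by case: (h <= i)%N; case: (h <= j)%N => //= _; nia.
  apply: ad_eq0P => i j e; apply/val_inj; case: (ltngtP i j) => // /mono; rewrite e ltnn //.
move/eqP: aT; rewrite /a mulf_eq0 (negbTE adT) /= pk => /eqP <-.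
by apply: meval_eq => i; rewrite /dot_pt kE.
Qed.

(** Otherwise, by [vanish_all], p vanishes at the points whose i-th exponent is k B^i; there it
    becomes a polynomial in q^k whose exponents, the values of [enc], distinguish the monomials of
    p. *)
Lemma principal_neq0 : p.@[dot_pt (fun=> 0%N)] != 0.
Proof.
apply/negP => /eqP /vanish_all van; case/negP: p_neq0; apply/eqP.
pose B := (msize p).+1.
pose enc (m : 'X_{1..N}) : nat := (\sum_(i < N) m i * B ^ i)%N.
pose c (m : 'X_{1..N}) : C := \prod_(i < N) q ^+ (theta * i * m i).
pose G : {poly C} := \sum_(m <- msupp p) (p@_m * c m) *: 'X^(enc m).
have G0 : G = 0.
  apply: (@poly_inf_roots C G (fun k => q ^+ k) q_inj) => k.
  have nd : nondec (fun i => k * B ^ i)%N.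
    by move=> i j ij; rewrite leq_mul2l leq_pexp2l ?orbT.
  rewrite -(van _ nd) mevalE horner_sum; apply: eq_bigr => m _.
  rewrite hornerZ hornerXn -mulrA; congr (_ * _).
  rewrite -exprM /enc big_distrr /= -prodrXr /c -big_split /=; apply: eq_bigr => i _.
  by rewrite /dot_pt -exprD -exprM; congr (q ^+ _); nia.
apply/mpolyP => m; rewrite mcoeff0; have [mp|/memN_msupp_eq0 //] := boolP (m \in msupp p).
have bd m' : m' \in msupp p -> forall i, (m' i < B)%N.
  move=> /msize_mdeg_lt lt i; apply: leq_ltn_trans (ltn_trans lt (ltnSn _)).
  by rewrite mdegE (bigD1 i) //= leq_addr.
have := congr1 (fun g : {poly C} => g`_(enc m)) G0.
rewrite coef0 coef_sum (bigD1_seq m) ?msupp_uniq //= coefZ coefXn eqxx mulr1.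
rewrite big_seq_cond big1 ?addr0 => [/eqP|m' /andP[m'p ne]]; last first.
  rewrite coefZ coefXn; case: eqP => [e|_]; last by rewrite mulr0.
  case/negP: ne; apply/eqP/mnmP => i.
  pose ff (m0 : 'X_{1..N}) k := if insub k is Some j then m0 (j : 'I_N) else 0%N.
  have ffE m0 (j : 'I_N) : ff m0 j = m0 j by rewrite /ff valK.
  have := @base_inj B N (ff m') (ff m) _ _ _ i (ltn_ord i); rewrite !ffE; apply.
  - by move=> k; rewrite /ff; case: insubP => // j _ _; apply: bd.
  - by move=> k; rewrite /ff; case: insubP => // j _ _; apply: bd.
  - by under eq_bigr do rewrite ffE; under [RHS]eq_bigr do rewrite ffE; rewrite -/(enc m') -e.
rewrite mulf_eq0 => /orP[/eqP -> //|/prodf_eq0[i _]].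
by rewrite expf_eq0 (negbTE q0) andbF.
Qed.

End Principal.

(** * Elimination at the points (x, t, ..., t^(N-1)) *)

Section Slice.
Context (C : numClosedFieldType) (n theta : nat) (q : C).
Hypotheses (th0 : (0 < theta)%N) (q01 : 0 < q < 1).
Local Notation N := n.+1.
Local Notation t := (q ^+ theta).
Implicit Types (x z X : C) (S I : {set 'I_N}).

Let q0 : q != 0. Proof. by case/andP: q01 => /lt0r_neq0. Qed.
Let q_inj : injective (fun k : nat => q ^+ k).
Proof. by have [h1 h2] := andP q01; exact: (@ieexprIn _ q h1 (negbT (lt_eqF h2))). Qed.
Let t0 : t != 0. Proof. exact: expf_neq0. Qed.

Variables (p : {mpoly C[N]}) (E : C -> C).
Hypothesis eigen : forall X (x : 'I_N -> C),
  \sum_(I : {set 'I_N}) X ^+ #|I| * ad (tshift I t x) * p.@[tshift I q x]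
  = E X * (ad x * p.@[x]).

Definition slice_pt S x : 'I_N -> C :=
  fun i => if i == ord0 then x else (if i \in S then q else 1) * t ^+ i.

Definition slice S : {poly C} :=
  (map_mpoly polyC p).@[fun i => if i == ord0 then 'X else ((if i \in S then q else 1) * t ^+ i)%:P].

Lemma horner_slice S x : (slice S).[x] = p.@[slice_pt S x].
Proof.
pose K := maxn (msize p) (msize (map_mpoly polyC p)).
rewrite /slice /meval !(@mmapE _ _ _ _ _ _ K); try by rewrite leq_max leqnn ?orbT.
rewrite -[LHS]/(horner_eval x _) raddf_sum /=; apply: eq_bigr => m _.
rewrite mcoeff_map_mpoly /= /horner_eval hornerM hornerC; congr (_ * _).
rewrite horner_prod; apply: eq_bigr => i _; rewrite horner_exp /slice_pt.
by case: eqP => _; rewrite ?hornerX ?hornerC.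
Qed.

Definition ycoord S (j : 'I_N) : C := (if j \in S then t else 1) * t ^+ j.

Lemma ycoordE S j : ycoord S j = t ^+ (j + (j \in S))%N.
Proof. by rewrite /ycoord; case: (j \in S); rewrite ?addn0 ?mul1r ?addn1 ?exprS. Qed.

Definition yvdm S : C :=
  \prod_(i < N | (0 < i)%N) \prod_(j < N | (i < j)%N) (ycoord S j - ycoord S i).

Definition yprod S z : C := \prod_(j < N | (0 < j)%N) (ycoord S j - z).

Lemma vdm_slice (f : 'I_N -> C) S z : f ord0 = z ->
  (forall j, j != ord0 -> f j = ycoord S j) -> vdm f = yprod S z * yvdm S.
Proof.
move=> f0 fj; have fj' (j : 'I_N) : (0 < j)%N -> f j = ycoord S j.
  by move=> j0; apply: fj; rewrite -val_eqE /= -lt0n.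
rewrite /vdm (bigD1 ord0) //= f0; congr (_ * _).
  by apply: eq_bigr => j /fj' ->.
apply: eq_big => [i|i i0]; first by rewrite -val_eqE /= lt0n.
apply: eq_bigr => j ij; rewrite !fj' // ?(leq_ltn_trans _ ij) //.
by rewrite lt0n -val_eqE in i0 *.
Qed.

Lemma sum_sets (F : {set 'I_N} -> C) :
  \sum_(I : {set 'I_N}) F I
  = \sum_(S : {set 'I_N} | ord0 \notin S) (F S + F (ord0 |: S)).
Proof.
rewrite (bigID (fun I : {set 'I_N} => ord0 \notin I)) big_split /=; congr (_ + _).
rewrite (reindex_onto (fun S : {set 'I_N} => ord0 |: S) (fun I => I :\ ord0)) /=.
  apply: eq_bigl => S; rewrite negbK setU11 /=; apply/eqP/idP => [<-|h].
    by rewrite setD11.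
  by rewrite setU1K.
by move=> I; rewrite negbK => h; rewrite setD1K.
Qed.

(** Pairing S with [ord0 |: S] in the sum over subsets separates the values at x from those at q
    x. *)
Lemma slice_eigen X x :
  \sum_(S : {set 'I_N} | ord0 \notin S) X ^+ #|S| * yvdm S *
     (yprod S x * (slice S).[x] + X * yprod S (t * x) * (slice S).[q * x])
  = E X * (yprod set0 x * yvdm set0 * (slice set0).[x]).
Proof.
have [b hb] := ad_vdm C N; have sgn0 : (-1) ^+ b != 0 :> C by rewrite signr_eq0.
have := eigen X (slice_pt set0 x); rewrite -horner_slice sum_sets => e.
have pt0 S y (f : 'I_N -> C) : f ord0 = y -> (forall j, j != ord0 -> f j = (if j \in S then q else 1) * t ^+ j) ->
    p.@[f] = (slice S).[y].
  move=> f0 fj; rewrite horner_slice; apply: meval_eq => i; rewrite /slice_pt.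
  by case: eqP => [->|/eqP /fj].
have ad0 : ad (slice_pt set0 x) = (-1) ^+ b * (yprod set0 x * yvdm set0).
  rewrite hb; congr (_ * _); apply: vdm_slice => [|j jn]; first by rewrite /slice_pt eqxx.
  by rewrite /slice_pt (negbTE jn) /ycoord !in_set0.
apply: (mulfI sgn0); transitivity (E X * (ad (slice_pt set0 x) * (slice set0).[x])); last first.
  by rewrite ad0; ring.
rewrite -e mulr_sumr; apply: eq_bigr => S S0.
have c1 : #|ord0 |: S| = #|S|.+1 by rewrite cardsU1 S0.
rewrite c1 exprS.
have -> : ad (tshift S t (slice_pt set0 x)) = (-1) ^+ b * (yprod S x * yvdm S).
  rewrite hb; congr (_ * _); apply: vdm_slice => [|j jn].
    by rewrite /tshift (negbTE S0) mul1r /slice_pt eqxx.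
  by rewrite /tshift /slice_pt (negbTE jn) /ycoord !in_set0 mul1r.
have -> : ad (tshift (ord0 |: S) t (slice_pt set0 x)) = (-1) ^+ b * (yprod S (t * x) * yvdm S).
  rewrite hb; congr (_ * _); apply: vdm_slice => [|j jn].
    by rewrite /tshift setU11 /slice_pt eqxx.
  by rewrite /tshift /slice_pt (negbTE jn) /ycoord !inE (negbTE jn) mul1r.
rewrite (pt0 S x) => [|//|]; last first.
- by move=> j jn; rewrite /tshift /slice_pt (negbTE jn) !in_set0 mul1r.
- by rewrite /tshift (negbTE S0) mul1r /slice_pt eqxx.
rewrite (pt0 S (q * x)).
- by move: ((-1) ^+ b) (X ^+ _) (yprod _ _) (yprod _ _) (yvdm _) (horner _ _) (horner _ _) => *; ring.
- by rewrite /tshift setU11 /slice_pt eqxx.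
by move=> j jn; rewrite /tshift /slice_pt (negbTE jn) !inE (negbTE jn) mul1r.
Qed.

Definition tprod z : C := \prod_(m < N) (t ^+ m.+1 - z).

(* When [yvdm S] is nonzero the points t^(j + [j \in S]), 0 < j < N, are all of
   t, ..., t^N but one, and the exponent of the missing one is found by summing. *)
Lemma yprod_missing S z : ord0 \notin S -> yvdm S != 0 ->
  yprod S z * (t ^+ (N - #|S|) - z) = tprod z.
Proof.
move=> S0 ny; pose phi (j : 'I_N) : 'I_N := inord (j.-1 + (j \in S)).
have phiE (j : 'I_N) : (0 < j)%N -> phi j = (j.-1 + (j \in S))%N :> nat.
  by move=> j0; rewrite inordK //; have := ltn_ord j; case: (j \in S) => /=; lia.
have phi_inj : {in [set j : 'I_N | (0 < j)%N] &, injective phi}.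
  have lt (i j : 'I_N) : (0 < i)%N -> (0 < j)%N -> (i < j)%N -> phi i != phi j.
    move=> i0 j0 ij; apply: contraNneq ny => e; rewrite /yvdm (bigD1 i) //= (bigD1 j) //=.
    have e' : (i + (i \in S) = j + (j \in S))%N.
      have := congr1 val e; rewrite /= !phiE //; lia.
    by rewrite !ycoordE e' subrr !mul0r.
  move=> i j; rewrite !inE => i0 j0 e; apply/val_inj; case: (ltngtP i j) => // h.
    by have := lt _ _ i0 j0 h; rewrite e eqxx.
  by have := lt _ _ j0 i0 h; rewrite e eqxx.
pose A := phi @: [set j : 'I_N | (0 < j)%N].
have cA : #|A| = n.
  rewrite card_in_imset // -[RHS](card_ord n) -cardsT -(card_imset _ (@lift_inj _ (ord0 : 'I_N))).
  apply: eq_card => j; rewrite !inE; apply/idP/imsetP => [j0|[k _ ->]]; last by rewrite lift0.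
  have [k ek|e] := unliftP ord0 j; first by exists k; rewrite ?inE.
  by rewrite e in j0.
have /cards1P[m0 hm0] : #|~: A| == 1%N by have := cardsC A; rewrite cA card_ord; lia.
have AE (m : 'I_N) : (m \in A) = (m != m0).
  have := in_set1 m m0; rewrite -hm0 inE => h; by rewrite -h negbK.
have split_all (R : Type) (idx : R) (op : Monoid.com_law idx) (f : nat -> R) :
    \big[op/idx]_(m < N) f m = op (\big[op/idx]_(j < N | (0 < j)%N) f (j.-1 + (j \in S))%N) (f m0).
  rewrite (bigID (fun m => m \in A)) /=; congr (op _ _).
    rewrite (eq_bigl (fun m => m \in A)) // big_imset //=.
    by apply: eq_big => [j|j]; rewrite inE // => j0; rewrite phiE.
  by rewrite (big_pred1 m0) // => m; rewrite AE negbK.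
have m0E : (m0 + #|S| = n)%N.
  have e := split_all _ _ addn id.
  have e2 : (\sum_(m < N) m = \sum_(j < N | (0 < j)%N) j.-1 + n)%N.
    rewrite big_mkcond big_ord_recr /= [in RHS]big_mkcond big_ord_recl /= add0n.
    by congr (_ + _)%N; apply: eq_bigr => j _; rewrite lift0.
  move: e; rewrite e2 big_split /= -addnA => /addnI e3; rewrite [RHS]e3 addnC; congr (_ + _)%N.
  rewrite -sum1_card big_mkcond [RHS]big_mkcond /=; apply: eq_bigr => j _.
  by case: posnP => [j0|]; [rewrite (_ : j = ord0) ?(negbTE S0) //; apply/val_inj|case: (j \in S)].
rewrite /tprod (split_all _ _ *%R (fun m => t ^+ m.+1 - z)); congr (_ * _); last first.
  by congr (t ^+ _ - z); lia.
by apply: eq_bigr => j j0; rewrite ycoordE; congr (t ^+ _ - z); lia.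
Qed.

(** The one unknown that survives the elimination: by [yprod_missing], the various factors [yprod S]
    become the common factor [tprod] once the equations at X and X / t are combined. *)
Definition gam X : {poly C} :=
  \sum_(S : {set 'I_N} | ord0 \notin S) (X ^+ #|S| * yvdm S) *: slice S.

(** Take t^N times the equation at X / t minus x times the equation at X: the term of [S] acquires
    the factor t^(N - #|S|) - x, or t^(N - #|S|) - t x for the value at q x, which is exactly what
    [yprod S] lacks. *)
Lemma gam_eq X x :
  tprod x * (gam X).[x] + X / t * tprod (t * x) * (gam X).[q * x]
  = (t ^+ N * E (X / t) - x * E X) * (yprod set0 x * yvdm set0 * (slice set0).[x]).
Proof.
transitivity (t ^+ N * (E (X / t) * (yprod set0 x * yvdm set0 * (slice set0).[x]))
  - x * (E X * (yprod set0 x * yvdm set0 * (slice set0).[x]))); last first.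
  by rewrite [RHS]mulrBl !mulrA.
rewrite -!slice_eigen !horner_sum !mulr_sumr -big_split -sumrB /=.
apply: eq_bigr => S S0; rewrite !hornerZ.
have [->|ny] := eqVneq (yvdm S) 0; first by rewrite !(mulr0, mul0r, subr0, addr0).
rewrite -!(yprod_missing _ S0 ny) expr_div_n.
have leS : (#|S| <= N)%N by apply: leq_trans (max_card _) _; rewrite card_ord.
have -> : t ^+ N = t ^+ (N - #|S|) * t ^+ #|S| by rewrite -exprD subnK.
have tS : t ^+ #|S| != 0 by apply: expf_neq0.
move: (t ^+ #|S|) tS (t ^+ (N - #|S|)) (X ^+ #|S|) (yprod _ _) (yprod _ _) (yvdm _) => T T0 U V A B Y.
move: (horner _ _) (horner _ _) t0; move: t => T1 g1 g2 T10; field; rewrite T0 T10 //.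
Qed.

End Slice.

(** * The q-difference equation and its solution *)

Section Recurrence.
Context (C : numClosedFieldType) (n theta : nat) (q : C).
Hypotheses (th0 : (0 < theta)%N) (q01 : 0 < q < 1).
Local Notation N := n.+1.
Local Notation t := (q ^+ theta).

Let q0 : q != 0. Proof. by case/andP: q01 => /lt0r_neq0. Qed.
Let q_inj : injective (fun k : nat => q ^+ k).
Proof. by have [h1 h2] := andP q01; exact: (@ieexprIn _ q h1 (negbT (lt_eqF h2))). Qed.
Let t0 : t != 0. Proof. exact: expf_neq0. Qed.

Variables (p : {mpoly C[N]}) (ell : 'I_N -> nat).
Local Notation E X := (\prod_(i < N) (1 + X * q ^+ ell i)).
Hypothesis p_neq0 : p != 0.
Hypothesis eigen : forall X (x : 'I_N -> C),
  \sum_(I : {set 'I_N}) X ^+ #|I| * ad (tshift I t x) * p.@[tshift I q x]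
  = E X * (ad x * p.@[x]).
Hypothesis gaps : forall i j : 'I_N, (i < j)%N -> (ell j + theta <= ell i)%N.

Local Notation tN := (theta * N)%N.
Local Notation g0 := (slice theta q p set0).

Definition qpoch : {poly C} := \prod_(i < tN.-1) ('X - (q ^+ i.+1)%:P).
Definition hpol : {poly C} := qpoch * g0.

Lemma tN_gt0 : (0 < tN)%N. Proof. by rewrite muln_gt0 th0. Qed.

Lemma telescope (f : nat -> C) K :
  (\prod_(m < K) f m) * f K = f 0%N * \prod_(m < K) f m.+1.
Proof.
transitivity (\prod_(m < K.+1) f m); first by rewrite big_ord_recr.
by rewrite big_ord_recl.
Qed.

Lemma yprod0 x : yprod theta q (set0 : {set 'I_N}) x = \prod_(j < n) (t ^+ j.+1 - x).
Proof.
rewrite /yprod big_mkcond big_ord_recl /= mul1r; apply: eq_bigr => j _.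
by rewrite ycoordE in_set0 addn0.
Qed.

Lemma yvdm0 : yvdm theta q (set0 : {set 'I_N}) != 0.
Proof.
apply/prodf_neq0 => i _; apply/prodf_neq0 => j ij; rewrite !ycoordE !in_set0 !addn0 subr_eq0.
by apply: contraTneq ij; rewrite -!exprM => /q_inj /eqP; rewrite eqn_pmul2l // => /eqP ->; rewrite ltnn.
Qed.

Definition qscale (L : {poly C}) : {poly C} := \poly_(i < size L) (q ^+ i * L`_i).

Lemma horner_qscale L x : (qscale L).[x] = L.[q * x].
Proof.
rewrite horner_poly horner_coef; apply: eq_bigr => i _.
by rewrite exprMn; ring.
Qed.

Lemma coef_qscale L i : (qscale L)`_i = q ^+ i * L`_i.
Proof.
rewrite coef_poly; case: ltnP => // h.
by rewrite (nth_default _ h) mulr0.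
Qed.

(** The factor Phi(x) = prod_(1 <= i <= theta N) (x - q^i) satisfies Phi(q x) / Phi(x) = tprod(t x)
    / tprod(x), both quotients telescoping. It turns [gam_eq] into a relation whose coefficients in
    front of the unknown at x and at q x are constant. *)
Definition lpol X : {poly C} := \prod_(i < tN) ('X - (q ^+ i.+1)%:P) * gam theta q p X.

Lemma functional_eq X : lpol X + (X / t) *: qscale (lpol X)
  = yvdm theta q (set0 : {set 'I_N}) *: (E X *: ('X * hpol) - (t ^+ N * E (X / t)) *: hpol).
Proof.
(* The test points m + 2 exceed 1, hence avoid the powers of q and the zeros of [tprod]. *)
apply/eqP; rewrite -subr_eq0; apply/eqP; apply: (@poly_inf_roots C _ (fun m => m.+2%:R)).
  by move=> i j /eqP; rewrite eqr_nat => /eqP[].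
move=> m; set x : C := m.+2%:R; have x1 : 1 < x by rewrite ltr1n.
have qx k : q ^+ k != x.
  have [q_gt0 q_lt1] := andP q01.
  by rewrite lt_eqF // (le_lt_trans _ x1) // exprn_ile1 // ltW.
apply/eqP; rewrite hornerD hornerN subr_eq0; apply/eqP.
have tpE z : tprod n theta q z = \prod_(j < n) (t ^+ j.+1 - z) * (t ^+ N - z).
  by rewrite /tprod big_ord_recr.
have tp0 : tprod n theta q x != 0.
  by apply/prodf_neq0 => j _; rewrite subr_eq0 -exprM.
pose Phi z := \prod_(i < tN) (z - q ^+ i.+1).
pose A := \prod_(m < N) (t ^+ m - x); pose B := \prod_(i < tN) (x - q ^+ i).
have hA : A * (t ^+ N - x) = (1 - x) * tprod n theta q x.
  exact: (telescope (fun m => t ^+ m - x)).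
have hB : B * (x - t ^+ N) = (x - 1) * Phi x.
  by rewrite -exprM; exact: (telescope (fun m => x - q ^+ m)).
have eA : tprod n theta q (t * x) = t ^+ N * A.
  rewrite -[in t ^+ N](card_ord N) -prodr_const -big_split; apply: eq_bigr => j _.
  by rewrite /= mulrBr -exprS.
have eB : Phi (q * x) = t ^+ N * B.
  rewrite -exprM -[in q ^+ tN](card_ord tN) -prodr_const -big_split; apply: eq_bigr => j _.
  by rewrite /= mulrBr -exprS.
have tNx : t ^+ N - x != 0 by rewrite -exprM subr_eq0.
have cross : tprod n theta q (t * x) * Phi x = Phi (q * x) * tprod n theta q x.
  rewrite eA eB -!mulrA; congr (_ * _); apply: (mulfI tNx).
  rewrite mulrA [_ * A]mulrC hA [RHS]mulrA -[t ^+ N - x]opprB mulNr [_ * B]mulrC hB; ring.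
have hPhi z : (lpol X).[z] = Phi z * (gam theta q p X).[z].
  rewrite hornerM horner_prod; congr (_ * _); apply: eq_bigr => i _.
  by rewrite hornerXsubC.
have qp : qpoch.[x] = \prod_(i < tN.-1) (x - q ^+ i.+1).
  by rewrite horner_prod; apply: eq_bigr => i _; rewrite hornerXsubC.
have PhiE : Phi x = qpoch.[x] * (x - t ^+ N).
  rewrite qp -exprM /Phi; have := tN_gt0; case: tN => // K _.
  by rewrite big_ord_recr.
have key := gam_eq th0 q01 eigen X x.
apply: (mulfI tp0).
rewrite hornerD !hornerZ horner_qscale !hPhi hornerD hornerN !hornerZ !hornerM hornerX.
transitivity (Phi x * (tprod n theta q x * (gam theta q p X).[x]
   + X / t * tprod n theta q (t * x) * (gam theta q p X).[q * x])).
  move: cross; move: (tprod _ _ _ _) (tprod _ _ _ _) (Phi _) (Phi _) (horner _ _) (horner _ _) => a b c d e f.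
  by move: (X / t) => y cross; ring: cross.
rewrite key yprod0 PhiE tpE.
move: (\prod_(j < n) _) (E X) (E (X / t)) (yvdm _ _ _) (horner _ _) (horner _ _) (t ^+ N) => *.
by ring.
Qed.

Lemma coef_recurrence k :
  (\prod_(i < N) (q ^+ k - t * q ^+ ell i)) * ('X * hpol)`_k
  = t ^+ N * ((\prod_(i < N) (q ^+ k - q ^+ ell i)) * hpol`_k).
Proof.
have qk : q ^+ k != 0 by apply: expf_neq0.
(* At this X the factor 1 + (X / t) q^k in front of the k-th coefficient of [lpol X] vanishes, and
   the unknown polynomial disappears. *)
pose X := - t / q ^+ k.
have := congr1 (fun L : {poly C} => L`_k) (functional_eq X).
rewrite coefD coefZ coef_qscale coefZ coefB !coefZ [X / t * (_ * _)]mulrA.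
have -> : X / t * q ^+ k = -1 by rewrite /X; field; rewrite qk t0.
rewrite mulN1r subrr => /esym/eqP; rewrite mulf_eq0 (negbTE yvdm0) /= subr_eq0 => /eqP e.
have e1 : q ^+ k ^+ N * E X = \prod_(i < N) (q ^+ k - t * q ^+ ell i).
  rewrite -[in _ ^+ N](card_ord N) -prodr_const -big_split; apply: eq_bigr => i _ /=.
  by rewrite /X; field.
have e2 : q ^+ k ^+ N * E (X / t) = \prod_(i < N) (q ^+ k - q ^+ ell i).
  rewrite -[in _ ^+ N](card_ord N) -prodr_const -big_split; apply: eq_bigr => i _ /=.
  by rewrite /X; field; rewrite qk t0.
by rewrite -e1 -mulrA e -e2 !mulrA [t ^+ N * _]mulrC.
Qed.

(** In the recurrence, a run of nonzero coefficients can only start where prod_i (q^k - q^(ell i))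
    vanishes, at some ell i, and it stops before ell i + theta, where prod_i (q^k - t q^(ell i))
    vanishes. *)
Lemma hpol_support k : hpol`_k != 0 -> exists i (j : 'I_theta), k = (ell i + j)%N.
Proof.
elim: k => [|k IH] hk.
  have := coef_recurrence 0; rewrite coefXM /= mulr0 => /esym/eqP.
  rewrite !mulf_eq0 expf_eq0 (negbTE t0) andbF /= (negbTE hk) orbF => /prodf_eq0[i _].
  rewrite subr_eq0 => /eqP /q_inj e; exists i, (Ordinal th0); by rewrite addn0.
have := coef_recurrence k.+1; rewrite coefXM /=.
case: (boolP [exists i : 'I_N, ell i == k.+1]) => [/existsP[i /eqP e] _|ne e].
  by exists i, (Ordinal th0); rewrite addn0.
have nz : \prod_(i < N) (q ^+ k.+1 - q ^+ ell i) != 0.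
  apply/prodf_neq0 => i _; rewrite subr_eq0; apply: contra ne => /eqP /q_inj e'.
  by apply/existsP; exists i; rewrite e'.
have : (\prod_(i < N) (q ^+ k.+1 - t * q ^+ ell i)) * hpol`_k != 0.
  by rewrite e !mulf_neq0 // expf_neq0.
rewrite mulf_eq0 negb_or => /andP[/prodf_neq0 n1 /IH[i [j ek]]].
have jn : j.+1 != theta.
  have := n1 i isT; rewrite subr_eq0 -exprD; apply: contra => /eqP e1.
  by apply/eqP; congr (q ^+ _); rewrite ek; move: e1; clear; lia.
have jlt : (j.+1 < theta)%N by rewrite ltn_neqAle jn ltn_ord.
by exists i, (Ordinal jlt); rewrite /= ek addnS.
Qed.

Definition nodev (a : 'I_N * 'I_theta) : nat := (ell a.1 + a.2)%N.

Lemma nodev_inj : injective nodev.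
Proof.
have lt (i i' : 'I_N) (j j' : 'I_theta) : (i < i')%N -> nodev (i', j') <> nodev (i, j).
  by move=> /gaps; rewrite /nodev /=; have := ltn_ord j'; lia.
move=> [i j] [i' j'] e; case: (ltngtP i i') => [h|h|/val_inj h].
- by case: (lt _ _ j j' h); rewrite e.
- by case: (lt _ _ j' j h); rewrite e.
by move: e; rewrite /nodev /= h => /addnI /val_inj ->.
Qed.

Lemma hpol_sum x : hpol.[x] = \sum_a hpol`_(nodev a) * x ^+ nodev a.
Proof.
pose K := (maxn (size hpol) (\max_a nodev a).+1).
have Kn a : (nodev a < K)%N.
  by rewrite /K leq_max ltnS leq_bigmax orbT.
rewrite (@horner_coef_wide _ K); last by rewrite leq_maxl.
have hin a : nodev a = Ordinal (Kn a) :> nat by [].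
rewrite (bigID (fun k : 'I_K => k \in [set Ordinal (Kn a) | a in {: 'I_N * 'I_theta}])) /=.
rewrite [X in _ + X]big1 ?addr0; last first.
  move=> k nk; have [->|/hpol_support[i [j e]]] := eqVneq hpol`_k 0; first by rewrite mul0r.
  case/negP: nk; apply/imsetP; exists (i, j) => //; exact/val_inj.
rewrite big_imset /=; last by move=> a b _ _ /(congr1 val) /= /nodev_inj.
by apply: eq_bigl => a; rewrite inE.
Qed.

Lemma hpol_root m : (0 < m < tN)%N -> hpol.[q ^+ m] = 0.
Proof.
case/andP=> m0 mN; rewrite hornerM horner_prod.
have lt : (m.-1 < tN.-1)%N by lia.
by rewrite (bigD1 (Ordinal lt)) //= hornerXsubC prednK // subrr !mul0r.
Qed.

Lemma nodes_card : #|{: 'I_N * 'I_theta}| = tN.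
Proof. by rewrite card_prod !card_ord mulnC. Qed.

(* The vanishing of [hpol] at q, ..., q^(theta N - 1) says that the functional
   Q |-> \sum_a hpol_(nodev a) Q(q^(nodev a)) is evaluation at 0 up to a constant. *)
Lemma functional0 (Q : {poly C}) : (size Q <= tN)%N ->
  \sum_a hpol`_(nodev a) * Q.[q ^+ nodev a] = hpol.[1] * Q.[0].
Proof.
move=> sQ; transitivity (\sum_(m < tN) Q`_m * hpol.[q ^+ m]).
  under [RHS]eq_bigr do rewrite hpol_sum mulr_sumr.
  rewrite [RHS]exchange_big; apply: eq_bigr => a _.
  rewrite (horner_coef_wide _ sQ) mulr_sumr; apply: eq_bigr => m _.
  by rewrite exprAC mulrCA.
have := tN_gt0; move: hpol_root; case: tN => // K hr _.
rewrite big_ord_recl expr0 horner_coef0 mulrC big1 ?addr0 // => m _.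
by rewrite lift0 hr ?mulr0 ?mul0r //= ltnS ltn_ord.
Qed.

(** [functional0] is applied to the Lagrange polynomial that vanishes at the q^(nodev b) with b != a
    and equals 1 at 0; its degree is theta N - 1. *)
Lemma hpol_coef a : hpol`_(nodev a)
  = hpol.[1] * \prod_(b | b != a) (1 - q ^+ nodev a / q ^+ nodev b)^-1.
Proof.
pose Q : {poly C} := \prod_(b | b != a) (1 - (q ^+ nodev b)^-1 *: 'X).
have sz b : size (1 - (q ^+ nodev b)^-1 *: 'X : {poly C}) = 2%N.
  have nz : (q ^+ nodev b)^-1 != 0 by rewrite invr_eq0 expf_neq0.
  by rewrite addrC size_polyDl ?size_polyN ?size_scale ?size_polyX ?size_poly1.
have sQ : (size Q <= tN)%N.
  rewrite size_prod; last by move=> b _; rewrite -size_poly_eq0 sz.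
  under eq_bigr do rewrite sz.
  rewrite sum_nat_const; rewrite (eq_card (B := predC1 a)) // cardC1 nodes_card.
  by have := tN_gt0; lia.
have Qe z : Q.[z] = \prod_(b | b != a) (1 - z / q ^+ nodev b).
  rewrite horner_prod; apply: eq_bigr => b _.
  by rewrite hornerD hornerN hornerZ hornerX hornerC mulrC.
have := functional0 sQ; rewrite (bigD1 a) //= big1 ?addr0; last first.
  by move=> b ba; rewrite Qe (bigD1 b) //= divff ?expf_neq0 // subrr mul0r mulr0.
rewrite !Qe [X in _ = _ * X]big1 ?mulr1; last by move=> b _; rewrite mul0r subr0.
move=> <-; rewrite -mulrA -big_split /= big1 ?mulr1 // => b ba.
rewrite mulfV // subr_eq0; apply: contra ba => /eqP e.
apply/eqP/nodev_inj/q_inj/eqP.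
by rewrite -(inj_eq (mulIf (invr_neq0 (expf_neq0 (nodev b) q0)))) -e divff ?expf_neq0 //.
Qed.

Theorem principal_ratio x : x != 0 -> (forall k, (0 < k < tN)%N -> x != q ^+ k) ->
  p.@[slice_pt theta q set0 x] / p.@[slice_pt theta q set0 1]
  = \prod_(1 <= k < tN) ((1 - q ^+ k) / (x - q ^+ k))
    * \sum_a x ^+ nodev a * \prod_(b | b != a) (1 - q ^+ nodev a / q ^+ nodev b)^-1.
Proof.
move=> x0 hx.
have qe z : qpoch.[z] = \prod_(1 <= k < tN) (z - q ^+ k).
  rewrite horner_prod -(prednK tN_gt0) big_add1 big_mkord /=; apply: eq_bigr => i _.
  by rewrite hornerXsubC.
have qp0 z : (forall k, (0 < k < tN)%N -> z != q ^+ k) -> qpoch.[z] != 0.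
  move=> hz; rewrite qe prodf_seq_neq0; apply/allP => k; rewrite mem_index_iota.
  by rewrite /= subr_eq0; apply: hz.
have qp1 : qpoch.[1] != 0.
  apply: qp0 => k /andP[k0 _]; have [h1 h2] := andP q01.
  by rewrite gt_eqF // exprn_ilt1 ?ltW // -lt0n.
have g1 : g0.[1] != 0.
  rewrite horner_slice; have := principal_neq0 th0 q01 p_neq0 eigen.
  apply: contra => /eqP <-; apply/eqP; apply: meval_eq => i.
  rewrite /slice_pt /dot_pt in_set0 mul1r -exprM add0n.
  by case: eqP => // ->; rewrite muln0 expr0.
have hE z : hpol.[z] = qpoch.[z] * g0.[z] by rewrite hornerM.
rewrite -!horner_slice prodf_div -!qe -[RHS]mulrA.
have -> : \sum_a x ^+ nodev a * \prod_(b | b != a) (1 - q ^+ nodev a / q ^+ nodev b)^-1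
    = hpol.[x] / hpol.[1].
  rewrite hpol_sum mulr_suml; apply: eq_bigr => a _; rewrite hpol_coef.
  have h1 : hpol.[1] != 0 by rewrite hE mulf_neq0.
  by move: (\prod_(b | _) _) (x ^+ _) hpol.[1] h1 => u v w h1; field.
rewrite !hE; have hxx := qp0 x hx.
by field; rewrite g1 qp1 hxx.
Qed.

End Recurrence.

Definition mac_pt (C : numClosedFieldType) (t : C) (N : nat) (y : C) (i : 'I_N) : C :=
  if (i : nat) == 0%N then y else t ^+ i.

Lemma signature_le (N : nat) (la : N.-tuple int) (i j : 'I_N) : signature la ->
  (i <= j)%N -> tnth la j <= tnth la i.
Proof.
move=> h ij; rewrite !(tnth_nth 0).
have tr : transitive (fun a b : int => b <= a) by move=> a b c ba ac; apply: le_trans ac ba.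
apply: (sorted_leq_nth tr _ _ h) => //; rewrite ?inE ?size_tuple //.
Qed.

(** Shifting [la] by [p] shifts every node by [p]; the factor x^p so gained cancels the one coming
    from (x_1 ... x_N)^(-p). *)
Theorem macdonald_principal (C : numClosedFieldType) (root : nat -> C)
    (rootP : forall n, (0 < n)%N -> n.-primitive_root (root n))
    (q : C) (q01 : 0 < q < 1) (theta N : nat) (th0 : (0 < theta)%N) (N0 : (0 < N)%N)
    (P : polyfamily C N) (hP : is_macdonald P) (la : N.-tuple int) (hla : signature la)
    (p : nat) (x : C) :
  0 <= la`_N.-1 + p%:Z -> x != 0 ->
  (forall k : nat, (0 < k < theta * N)%N -> x != q ^+ k) ->
  macdonald_eval P q (q ^+ theta) p la (mac_pt (q ^+ theta) x)
    / macdonald_eval P q (q ^+ theta) p la (mac_pt (q ^+ theta) 1)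
  = \prod_(1 <= k < theta * N) ((1 - q ^+ k) / (x - q ^+ k))
    * \sum_(a : 'I_N * 'I_theta) x ^ (node la a.1 a.2)
      * \prod_(b | b != a) (1 - q ^ (node la a.1 a.2 - node la b.1 b.2))^-1.
Proof.
case: N N0 P hP la hla => // n _ P hP la hla hp x0 hx.
have q0 : q != 0 by case/andP: q01 => /lt0r_neq0.
have ge0 (i : 'I_n.+1) : 0 <= tnth la i + p%:Z.
  apply: le_trans hp _; rewrite lerD2r; have := @signature_le _ la i ord_max hla (leq_ord i).
  by rewrite (tnth_nth 0 _ ord_max).
pose mu := shift_part la p.
have muE i : (mu i)%:Z = tnth la i + p%:Z by rewrite mnmE gez0_abs.
have pmu : is_part mu.
  apply/is_partP => i j ij; rewrite -lez_nat !muE lerD2r; exact: signature_le.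
pose f := specialize P q (q ^+ theta) mu.
pose ell i := (mu i + theta * stair n.+1 i)%N.
have f0 : f != 0.
  have [//|_ e _] := specialize_triangular hP q (q ^+ theta) (B := (sqnorm mu).+1) pmu.
  apply: contraNneq (oner_neq0 C) => fe.
  by rewrite -[X in X == _]e -[specialize _ _ _ _]/f fe mcoeff0.
have eig X y : \sum_(I : {set 'I_n.+1}) X ^+ #|I| * ad (tshift I (q ^+ theta) y) * f.@[tshift I q y]
    = (\prod_(i < n.+1) (1 + X * q ^+ ell i)) * (ad y * f.@[y]).
  rewrite -meval_eig (mac_eigen rootP hP q01) //.
  by rewrite mevalZ mevalM eigval_node.
have gaps (i j : 'I_n.+1) : (i < j)%N -> (ell j + theta <= ell i)%N.
  move=> ij; have /is_partP/(_ i j (ltnW ij)) := pmu; have := stair_anti j i; rewrite ij /ell; nia.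
have := principal_ratio th0 q01 f0 eig gaps x0 hx.
have slE y : f.@[slice_pt theta q set0 y] = f.@[mac_pt (q ^+ theta) y].
  by apply: meval_eq => i; rewrite /slice_pt /mac_pt in_set0 mul1r.
rewrite !slE => e.
have prE y : \prod_(i < n.+1) mac_pt (q ^+ theta) y i
    = y * \prod_(i < n) (q ^+ theta) ^+ i.+1.
  by rewrite big_ord_recl.
pose T := \prod_(i < n) (q ^+ theta) ^+ i.+1.
have T0 : T != 0 by apply/prodf_neq0 => i _; rewrite !expf_neq0.
rewrite /macdonald_eval -/mu -/(specialize P q (q ^+ theta) mu) -/f !prE -/T.
have -> : (x * T) ^- p * f.@[mac_pt (q ^+ theta) x] / ((1 * T) ^- p * f.@[mac_pt (q ^+ theta) 1])
   = x ^- p * (f.@[mac_pt (q ^+ theta) x] / f.@[mac_pt (q ^+ theta) 1]).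
  have xp : x ^+ p != 0 by apply: expf_neq0.
  have Tp : T ^+ p != 0 by apply: expf_neq0.
  rewrite mul1r exprMn; have [->|g1] := eqVneq f.@[mac_pt (q ^+ theta) 1] 0.
    by rewrite mulr0 invr0 !mulr0.
  by field; rewrite xp Tp g1.
rewrite e mulrCA; congr (_ * _); rewrite mulr_sumr; apply: eq_bigr => a _.
have nodE (b : 'I_n.+1 * 'I_theta) : (nodev ell b)%:Z = node la b.1 b.2 + p%:Z.
  rewrite /nodev /node /ell !PoszD muE [stair n.+1 b.1]mnmE.
  by move: (Posz (theta * _)) (Posz b.2) (Posz p) (tnth _ _) => *; ring.
have -> : x ^+ nodev ell a = x ^ node la a.1 a.2 * x ^+ p.
  by rewrite -[x ^+ _]/(x ^ (nodev ell a)%:Z) nodE expfzDr.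
rewrite mulrA; congr (_ * _); first by rewrite mulrCA mulVf ?mulr1 // expf_neq0.
apply: eq_bigr => b _; congr ((1 - _)^-1).
rewrite -[q ^+ nodev ell a]/(q ^ (nodev ell a)%:Z) -[q ^+ nodev ell b]/(q ^ (nodev ell b)%:Z).
rewrite invr_expz -expfzDr // !nodE; congr (q ^ _); ring.
Qed.

End MacdonaldTheory.

From mathcomp Require Import all_classical all_reals all_analysis.
Import numFieldNormedType.Exports.
Import Order.TTheory GRing.Theory Num.Theory.
Local Open Scope classical_set_scope.
Local Open Scope complex_scope.
Local Open Scope ring_scope.

(** * Contour integrals *)

Section ComplexExp.
Context (R : realType).
Local Notation C := R[i].
Local Notation Re := (@complex.Re R).
Local Notation Im := (@complex.Im R).
Implicit Types (x y a b : R) (z w v : C).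

(** The modulus as a real number; the norm of [R[i]] takes its values in [R[i]]. *)
Definition nm z : R := Normc.normc z.

Lemma nm_ge0 z : 0 <= nm z.
Proof. by case: z => a b; apply: sqrtr_ge0. Qed.

Lemma nm0 : nm 0 = 0. Proof. exact: Normc.normc0. Qed.

Lemma nm1 : nm 1 = 1. Proof. exact: Normc.normc1. Qed.

Lemma nm_eq0 z : nm z = 0 -> z = 0. Proof. exact: Normc.eq0_normc. Qed.

Lemma nmM z w : nm (z * w) = nm z * nm w. Proof. exact: Normc.normcM. Qed.

Lemma nmV z : nm z^-1 = (nm z)^-1. Proof. exact: Normc.normcV. Qed.

Lemma nmD z w : nm (z + w) <= nm z + nm w. Proof. exact: (@le_normcD R). Qed.

Lemma nmN z : nm (- z) = nm z. Proof. exact: (@normcN R). Qed.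

Lemma nmB z w : nm (z - w) <= nm z + nm w. Proof. by rewrite -(nmN w); apply: nmD. Qed.

Lemma nmBC z w : nm (z - w) = nm (w - z). Proof. by rewrite -nmN opprB. Qed.

Lemma nmX z k : nm (z ^+ k) = nm z ^+ k.
Proof. by elim: k => [|k IH]; rewrite ?expr0 ?nm1 // !exprS nmM IH. Qed.

Lemma nm_real x : nm x%:C = `|x|.
Proof. by rewrite /nm /= expr0n addr0 sqrtr_sqr. Qed.

Lemma nm_sum (I : Type) (r : seq I) (P : pred I) (f : I -> C) :
  nm (\sum_(i <- r | P i) f i) <= \sum_(i <- r | P i) nm (f i).
Proof.
elim/big_rec2: _ => [|i y z _ h]; first by rewrite nm0.
by apply: le_trans (nmD _ _) _; rewrite lerD2l.
Qed.

Lemma Re_nm z : `|Re z| <= nm z.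
Proof.
case: z => a b; rewrite /nm /= -sqrtr_sqr ler_sqrt ?addr_ge0 ?sqr_ge0 //.
by rewrite lerDl sqr_ge0.
Qed.

Lemma Im_nm z : `|Im z| <= nm z.
Proof.
case: z => a b; rewrite /nm /= -sqrtr_sqr ler_sqrt ?addr_ge0 ?sqr_ge0 //.
by rewrite lerDr sqr_ge0.
Qed.

Lemma nm_ReIm z : nm z <= `|Re z| + `|Im z|.
Proof.
case: z => a b /=; rewrite -[leRHS]ger0_norm ?addr_ge0 // -sqrtr_sqr /nm /=.
rewrite ler_sqrt ?sqr_ge0 // sqrrD !real_normK ?num_real //.
by have := mulr_ge0 (normr_ge0 a) (normr_ge0 b); lra.
Qed.

Lemma nm_small z : (forall e, 0 < e -> nm z <= e) -> z = 0.
Proof.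
move=> h; apply: nm_eq0; apply/eqP; rewrite eq_le nm_ge0 andbT.
by apply/ler_addgt0Pl => e e0; rewrite addr0; apply: h.
Qed.

Lemma cexpD z w : cexp (z + w) = cexp z * cexp w.
Proof.
case: z => a b; case: w => c d; rewrite /cexp /= expRD cosD sinD.
apply/eqP; rewrite eq_complex /=; apply/andP; split; apply/eqP; ring.
Qed.

Lemma cexp0 : cexp (0 : C) = 1.
Proof. by rewrite /cexp /= expR0 cos0 sin0 mul1r. Qed.

Lemma cexp_real a : cexp a%:C = (expR a)%:C.
Proof. by rewrite /cexp /= cos0 sin0 mulr1. Qed.

Lemma cexpMn z k : cexp (z *+ k) = cexp z ^+ k.
Proof. by elim: k => [|k IH]; rewrite ?mulr0n ?cexp0 // mulrS cexpD IH exprS. Qed.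

Lemma nm_cexp z : nm (cexp z) = expR (Re z).
Proof.
rewrite /cexp nmM nm_real ger0_norm ?expR_ge0 // /nm /= cos2Dsin2 sqrtr1 mulr1 //.
Qed.

Lemma cexp_neq0 z : cexp z != 0.
Proof.
by apply: contraTneq (expR_gt0 (Re z)) => e; rewrite -nm_cexp e nm0 ltxx.
Qed.

Lemma cexpN z : cexp (- z) = (cexp z)^-1.
Proof.
apply: (mulIf (cexp_neq0 z)); rewrite mulVf ?cexp_neq0 //.
by rewrite -cexpD addNr cexp0.
Qed.

Lemma sin_le x : `|sin x| <= `|x|.
Proof.
wlog x0 : x / 0 <= x.
  move=> h; have [/h //|/ltW x0] := leP 0 x.
  by rewrite -[`|sin x|]normrN -sinN -[`|x|]normrN; apply: h; rewrite oppr_ge0.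
have [c _] := @MVT_segment R (@sin R) (@cos R) 0 x x0
  (fun y _ => is_derive_sin y) (continuous_subspaceT (@continuous_sin R)).
rewrite sin0 !subr0 => ->; rewrite normrM -[leRHS]mul1r.
by apply: ler_wpM2r => //; apply: cos_max.
Qed.

Lemma cos_le x : `|cos x - 1| <= x ^+ 2 / 2.
Proof.
have e : cos x = cos ((x / 2) *+ 2) by congr cos; rewrite -mulr_natr; field.
rewrite e cos_mulr2n cos2sin2.
have -> : (1 - sin (x / 2) ^+ 2) *+ 2 - 1 - 1 = - (2 * sin (x / 2) ^+ 2) by ring.
rewrite normrN ger0_norm; last by rewrite mulr_ge0 ?sqr_ge0.
have := sin_le (x / 2); rewrite -ler_sqr ?nnegrE // !real_normK ?num_real //.
by rewrite expr_div_n => h; lra.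
Qed.

Lemma sin_sub_le x : `|x| <= 1 -> `|sin x - x| <= x ^+ 2.
Proof.
wlog x0 : x / 0 <= x.
  move=> h; have [/h //|/ltW x0] := leP 0 x.
  rewrite -[`|sin x - x|]normrN opprB addrC -[x ^+ 2]sqrrN -[`|x|]normrN => x1.
  by have := h (- x); rewrite oppr_ge0 sinN opprK => /(_ x0 x1); rewrite addrC.
move=> x1; pose f y := sin y - y; pose df y : R := cos y - 1.
have df_ y : is_derive y 1 f (df y) by rewrite /f /df; apply: is_deriveB.
have cf : continuous f.
  by move=> y; apply: cvgB; [apply: continuous_sin|apply: cvg_id].
have [c] := @MVT_segment R f df 0 x x0 (fun y _ => df_ y) (continuous_subspaceT cf).
rewrite in_itv /= => /andP[c0 cx]; rewrite /f sin0 !subr0 => ->.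
rewrite normrM; have := cos_le c; rewrite /df => h1.
have hx : `|x| = x by rewrite ger0_norm.
rewrite hx in x1 *; apply: (@le_trans _ _ (c ^+ 2 / 2 * x)); first exact: ler_wpM2r.
have : c ^+ 2 <= x ^+ 2 by rewrite ler_sqr ?nnegrE.
have : 0 <= c ^+ 2 by apply: sqr_ge0.
nra.
Qed.

(** From e^(-a) >= 1 - a follows e^a (1 - a) <= 1, hence (e^a - 1 - a)(1 - a) <= a^2, where 1 - a >=
    1/2. *)
Lemma expR_small a : `|a| <= 2^-1 -> `|expR a - 1 - a| <= 2 * a ^+ 2.
Proof.
rewrite ler_norml => /andP[a1 a2].
have l1 := @expR_ge1Dx R a; have l2 := @expR_ge1Dx R (- a).
have e : expR a * expR (- a) = 1 by rewrite -expRD subrr expR0.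
have p := expR_gt0 a.
rewrite ler_norml; apply/andP; split; first by have := sqr_ge0 a; lra.
have h1 : expR a * (1 - a) <= 1 by rewrite -[X in _ <= X]e ler_pM2l //; lra.
have : (expR a - 1 - a) * (1 - a) <= a ^+ 2 by nra.
have : 0 <= a ^+ 2 by apply: sqr_ge0.
by move=> h2 h3; nra.
Qed.

Lemma cexp_small v : nm v <= 2^-1 -> nm (cexp v - 1 - v) <= 12 * nm v ^+ 2.
Proof.
move=> hv; have := Re_nm v; have := Im_nm v; have n0 := nm_ge0 v.
move: (nm v) hv n0 => r hr r0; case: v => a b hb ha; rewrite /= in ha hb.
have ha' : `|a| <= 2^-1 by apply: le_trans hr.
have hb' : `|b| <= 1 by apply: le_trans hb (le_trans hr _); lra.
have e1 := expR_small ha'; have c1 := cos_le b; have s1 := sin_sub_le hb'.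
have s2 := sin_le b; have c2 := cos_max b.
have ea : `|expR a - 1| <= 2 * r.
  have -> : expR a - 1 = (expR a - 1 - a) + a by ring.
  apply: le_trans (ler_normD _ _) _.
  have : a ^+ 2 <= r * 2^-1.
    by rewrite -[a ^+ 2]ger0_norm ?sqr_ge0 // normrX; have := normr_ge0 a; nra.
  lra.
have a2 : a ^+ 2 <= r ^+ 2.
  by rewrite -[a ^+ 2]ger0_norm ?sqr_ge0 // normrX; have := normr_ge0 a; nra.
have b2 : b ^+ 2 <= r ^+ 2.
  by rewrite -[b ^+ 2]ger0_norm ?sqr_ge0 // normrX; have := normr_ge0 b; nra.
have ea3 : `|expR a| <= 3.
  have -> : expR a = (expR a - 1) + 1 by ring.
  apply: le_trans (ler_normD _ _) _; rewrite normr1; lra.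
apply: le_trans (nm_ReIm _) _; rewrite /cexp /=.
have -> : expR a * cos b - 0 * sin b - 1 - a = (expR a - 1 - a) + expR a * (cos b - 1) by ring.
have -> : expR a * sin b + 0 * cos b - 0 - b = (expR a - 1) * sin b + (sin b - b) by ring.
have h1 := ler_normD (expR a - 1 - a) (expR a * (cos b - 1)).
have h2 := ler_normD ((expR a - 1) * sin b) (sin b - b).
rewrite !normrM in h1 h2.
have h3 : `|expR a| * `|cos b - 1| <= 3 * (b ^+ 2 / 2) by apply: ler_pM.
have h4 : `|expR a - 1| * `|sin b| <= 2 * r * r.
  by apply: ler_pM => //; apply: le_trans s2 hb.
nra.
Qed.

Lemma nm_geom z w (M : R) k : 1 <= M -> (forall i, (i < k)%N -> nm (z ^+ i) <= M) ->
  (forall i, (i < k)%N -> nm (w ^+ i) <= M) ->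
  nm (z ^+ k - w ^+ k) <= nm (z - w) * (k%:R * (M * M)).
Proof.
move=> M1 hz hw; rewrite subrXX nmM; apply: ler_wpM2l; first exact: nm_ge0.
apply: le_trans (nm_sum _ _ _) _.
apply: (@le_trans _ _ (\sum_(i < k) M * M)); last first.
  by rewrite sumr_const card_ord mulr_natl.
apply: ler_sum => i _; rewrite nmM; apply: ler_pM; rewrite ?nm_ge0 //.
  by apply: hz; have := ltn_ord i; lia.
exact: hw.
Qed.

Lemma le1DnX a k : 0 <= a -> (1 + a) ^+ k <= expR (a *+ k).
Proof.
by move=> a0; rewrite -mulr_natl expRM_natl; apply: lerXn2r; rewrite ?nnegrE ?expR_ge0 ?addr_ge0 // expR_ge1Dx.
Qed.

(** e^w is the n-th power of e^(w/n), which differs from 1 + w/n by at most 12 (rho/n)^2, while the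
    cofactor in the difference of n-th powers is at most n e^(2 rho): the error is O(1/n), uniformly
    in w. *)
Lemma exp_approx (rho e : R) : 0 < rho -> 0 < e -> exists n0, forall n, (n0 <= n)%N ->
  forall w, nm w <= rho -> nm (cexp w - (1 + w / n%:R) ^+ n) <= e.
Proof.
move=> r0 e0.
(* The first term yields the final estimate, the second the bound |w/n| <= 1/2 required by
   [cexp_small]. *)
pose K := 12 * rho ^+ 2 * (expR rho * expR rho) / e + 2 * rho + 1.
have H0 : 0 <= 12 * rho ^+ 2 * (expR rho * expR rho) / e.
  apply: divr_ge0; last exact: ltW.
  by apply: mulr_ge0; apply: mulr_ge0; rewrite ?expR_ge0 ?sqr_ge0.
have K0 : 0 < K by rewrite /K; lra.
exists (Num.truncn K).+1 => n ln w hw.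
have Kn : K <= n%:R.
  by apply: ltW; apply: lt_le_trans (truncnS_gt _) _; rewrite ler_nat.
have n0 : 0 < n%:R :> R by apply: lt_le_trans Kn.
have nC : n%:R != 0 :> C by rewrite pnatr_eq0 -lt0n -(ltr0n R).
have wn : nm (w / n%:R) <= rho / n%:R.
  rewrite nmM nmV -(rmorph_nat (real_complex R)) nm_real ger0_norm ?ler0n //.
  by apply: ler_wpM2r => //; rewrite invr_ge0 ltW.
have half : rho / n%:R <= 2^-1.
  have h : 2 * rho <= n%:R by apply: le_trans Kn; rewrite /K; lra.
  by rewrite ler_pdivrMr //; lra.
have -> : cexp w = cexp (w / n%:R) ^+ n by rewrite -cexpMn -(mulr_natr (w / n%:R) n) divfK.
have M1 : 1 <= expR rho by rewrite -[1]expR0 ler_expR ltW.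
have bd i (t : R) : (i < n)%N -> 0 <= t -> t <= rho / n%:R -> t *+ i <= rho.
  move=> lin t0 tr; apply: (@le_trans _ _ (rho / n%:R *+ n)).
    apply: (@le_trans _ _ (t *+ n)); first by rewrite -(mulr_natl t i) -(mulr_natl t n); apply: ler_wpM2r; rewrite // ler_nat ltnW.
    by rewrite lerMn2r tr orbT.
  by rewrite -(mulr_natr (rho / n%:R) n) divfK // gt_eqF.
have := @nm_geom (cexp (w / n%:R)) (1 + w / n%:R) (expR rho) n M1.
move=> h; apply: le_trans (h _ _) _.
- move=> i lin; rewrite nmX nm_cexp -expRM_natl ler_expR.
  have := Re_nm (w / n%:R); rewrite ler_norml => /andP[_ h1].
  apply: le_trans (bd i (nm (w / n%:R)) lin (nm_ge0 _) wn).
  by rewrite -(mulr_natl (nm (w / n%:R)) i); apply: ler_wpM2l.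
- move=> i lin; rewrite nmX; apply: (@le_trans _ _ ((1 + nm (w / n%:R)) ^+ i)).
    apply: lerXn2r; rewrite ?nnegrE ?nm_ge0 ?addr_ge0 ?nm_ge0 //.
    by apply: le_trans (nmD _ _) _; rewrite nm1.
  apply: le_trans (le1DnX _ (nm_ge0 _)) _.
  by rewrite ler_expR; apply: bd => //; apply: nm_ge0.
rewrite opprD addrA.
have h2 : nm (cexp (w / n%:R) - 1 - w / n%:R) <= 12 * (rho / n%:R) ^+ 2.
  apply: le_trans (cexp_small (le_trans wn half)) _; apply: ler_wpM2l => //.
  by apply: lerXn2r; rewrite ?nnegrE ?nm_ge0 // divr_ge0 ?ltW.
apply: le_trans (ler_wpM2r _ h2) _; first by rewrite !mulr_ge0 ?expR_ge0.
have -> : 12 * (rho / n%:R) ^+ 2 * (n%:R * (expR rho * expR rho))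
   = (12 * rho ^+ 2 * (expR rho * expR rho)) / n%:R by field; rewrite gt_eqF.
have h3 : 12 * rho ^+ 2 * (expR rho * expR rho) / e <= n%:R.
  by apply: le_trans Kn; rewrite /K; lra.
by move: h3; rewrite !ler_pdivrMr // [n%:R * e]mulrC.
Qed.

End ComplexExp.

(** * Integration of complex functions of a real variable *)

Section Integral.
Context (R : realType).
Local Notation C := R[i].
Local Notation Re := (@complex.Re R).
Local Notation Im := (@complex.Im R).
Local Notation mu := (@lebesgue_measure R).
Implicit Types (s : R) (z w : C) (h : R -> C) (f : R -> R).

Definition ccat h s :=
  {for s, continuous (fun u => Re (h u))} /\ {for s, continuous (fun u => Im (h u))}.

Definition cc h := forall s, 0 <= s <= 1 -> ccat h s.

Lemma complex_ReM z w : Re (z * w) = Re z * Re w - Im z * Im w.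
Proof. by case: z; case: w. Qed.

Lemma complex_ImM z w : Im (z * w) = Re z * Im w + Im z * Re w.
Proof. by case: z => a b; case: w => c d /=. Qed.

Lemma complex_ReD z w : Re (z + w) = Re z + Re w. Proof. by case: z; case: w. Qed.
Lemma complex_ImD z w : Im (z + w) = Im z + Im w. Proof. by case: z; case: w. Qed.
Lemma complex_ReN z : Re (- z) = - Re z. Proof. by case: z. Qed.
Lemma complex_ImN z : Im (- z) = - Im z. Proof. by case: z. Qed.

Lemma complex_ReV z : Re z^-1 = Re z / (Re z ^+ 2 + Im z ^+ 2).
Proof. by case: z. Qed.

Lemma complex_ImV z : Im z^-1 = - Im z / (Re z ^+ 2 + Im z ^+ 2).
Proof. by case: z => a b /=; rewrite mulNr. Qed.

Lemma sqnorm_eq0 z : Re z ^+ 2 + Im z ^+ 2 = 0 -> z = 0.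
Proof.
case: z => a b /= /eqP; rewrite paddr_eq0 ?sqr_ge0 // !sqrf_eq0.
by case/andP => /eqP -> /eqP ->.
Qed.

Lemma ccat_ext h h' s : h =1 h' -> ccat h s -> ccat h' s.
Proof. by move=> e; rewrite (funext e). Qed.

Lemma ccat_cst z s : ccat (fun=> z) s.
Proof. by split; apply: cvg_cst. Qed.

Lemma ccatD h h' s : ccat h s -> ccat h' s -> ccat (fun u => h u + h' u) s.
Proof.
case=> a b [c d]; split.
  rewrite (_ : (fun u => _) = (fun u => Re (h u) + Re (h' u))); first exact: cvgD.
  by apply: funext => u; rewrite complex_ReD.
rewrite (_ : (fun u => _) = (fun u => Im (h u) + Im (h' u))); first exact: cvgD.
by apply: funext => u; rewrite complex_ImD.
Qed.

Lemma ccatM h h' s : ccat h s -> ccat h' s -> ccat (fun u => h u * h' u) s.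
Proof.
case=> a b [c d]; split.
  rewrite (_ : (fun u => _) = (fun u => Re (h u) * Re (h' u) - Im (h u) * Im (h' u))).
    by apply: cvgB; apply: cvgM.
  by apply: funext => u; rewrite complex_ReM.
rewrite (_ : (fun u => _) = (fun u => Re (h u) * Im (h' u) + Im (h u) * Re (h' u))).
  by apply: cvgD; apply: cvgM.
by apply: funext => u; rewrite complex_ImM.
Qed.

Lemma ccatN h s : ccat h s -> ccat (fun u => - h u) s.
Proof.
move=> hh; apply: ccat_ext (ccatM (ccat_cst (-1) s) hh) => u.
by rewrite mulN1r.
Qed.

Lemma ccatB h h' s : ccat h s -> ccat h' s -> ccat (fun u => h u - h' u) s.
Proof. by move=> a b; apply: ccatD a (ccatN b). Qed.

Lemma ccatV h s : h s != 0 -> ccat h s -> ccat (fun u => (h u)^-1) s.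
Proof.
move=> h0 [a b].
have n0 : Re (h s) ^+ 2 + Im (h s) ^+ 2 != 0.
  by apply: contra h0 => /eqP /sqnorm_eq0 ->.
have c2 : {for s, continuous (fun u => (Re (h u) ^+ 2 + Im (h u) ^+ 2)^-1)}.
  apply: cvgV => //; rewrite (_ : (fun u => _) = (fun u => Re (h u) * Re (h u) + Im (h u) * Im (h u))).
    by rewrite !expr2; apply: cvgD; apply: cvgM.
  by apply: funext => u; rewrite !expr2.
split.
  rewrite (_ : (fun u => _) = (fun u => Re (h u) / (Re (h u) ^+ 2 + Im (h u) ^+ 2))).
    exact: cvgM.
  by apply: funext => u; rewrite complex_ReV.
rewrite (_ : (fun u => _) = (fun u => - Im (h u) / (Re (h u) ^+ 2 + Im (h u) ^+ 2))).
  by apply: cvgM => //; apply: cvgN.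
by apply: funext => u; rewrite complex_ImV.
Qed.

Lemma ccatX h s k : ccat h s -> ccat (fun u => h u ^+ k) s.
Proof.
move=> hh; elim: k => [|k IH]; first exact: ccat_cst.
by apply: ccat_ext (ccatM hh IH) => u; rewrite exprS.
Qed.

Lemma ccat_sum (I : Type) (r : seq I) (P : pred I) (F : I -> R -> C) s :
  (forall i, P i -> ccat (F i) s) -> ccat (fun u => \sum_(i <- r | P i) F i u) s.
Proof.
move=> hF; elim: r => [|i r IH].
  by apply: ccat_ext (ccat_cst 0 s) => u; rewrite big_nil.
have [Pi|nPi] := boolP (P i); last by apply: ccat_ext IH => u; rewrite big_cons (negbTE nPi).
by apply: ccat_ext (ccatD (hF i Pi) IH) => u; rewrite big_cons Pi.
Qed.

Lemma ccat_cexp h s : ccat h s -> ccat (fun u => cexp (h u)) s.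
Proof.
case=> a b.
have ce : {for s, continuous (fun u => expR (Re (h u)))}.
  exact: (continuous_comp (f := fun u => Re (h u)) (g := expR) a (@continuous_expR R _)).
have cs : {for s, continuous (fun u => sin (Im (h u)))}.
  exact: (continuous_comp (f := fun u => Im (h u)) (g := @sin R) b (@continuous_sin R _)).
have co : {for s, continuous (fun u => cos (Im (h u)))}.
  exact: (continuous_comp (f := fun u => Im (h u)) (g := @cos R) b (@continuous_cos R _)).
split.
  rewrite (_ : (fun u => _) = (fun u => expR (Re (h u)) * cos (Im (h u)))); first exact: cvgM.
  by apply: funext => u; rewrite /cexp complex_ReM /= mul0r subr0.
rewrite (_ : (fun u => _) = (fun u => expR (Re (h u)) * sin (Im (h u)))); first exact: cvgM.
by apply: funext => u; rewrite /cexp complex_ImM /= mul0r addr0.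
Qed.

Lemma itv01 s : `[0, 1]%classic s <-> 0 <= s <= 1.
Proof. by rewrite /= in_itv. Qed.

Lemma within01 f : (forall s, 0 <= s <= 1 -> {for s, continuous f}) ->
  {within `[0, 1], continuous f}.
Proof.
move=> hf; apply: continuous_in_subspaceT => s; rewrite inE => /itv01; exact: hf.
Qed.

Lemma integ01 f : (forall s, 0 <= s <= 1 -> {for s, continuous f}) ->
  mu.-integrable `[0, 1] (EFin \o f).
Proof.
by move=> hf; apply: continuous_compact_integrable; [apply: segment_compact|apply: within01].
Qed.

Lemma eq_cint h h' : (forall s, 0 <= s <= 1 -> h s = h' s) -> cintegral01 h = cintegral01 h'.
Proof.
move=> e; congr (_ +i* _); apply: eq_Rintegral => s; rewrite inE => /itv01 hs; by rewrite e.
Qed.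

Lemma cintD h h' : cc h -> cc h' ->
  cintegral01 (fun s => h s + h' s) = cintegral01 h + cintegral01 h'.
Proof.
move=> ch ch'; rewrite /cintegral01; apply/eqP; rewrite eq_complex /=.
by apply/andP; split; rewrite -RintegralD //=; try (by apply: integ01 => s /ch []);
  try (by apply: integ01 => s /ch' []); apply/eqP; apply: eq_Rintegral => s _; rewrite ?complex_ReD ?complex_ImD.
Qed.

Lemma cintZ z h : cc h -> cintegral01 (fun s => z * h s) = z * cintegral01 h.
Proof.
move=> ch; have iR : mu.-integrable `[0, 1] (EFin \o (fun s => Re (h s))).
  by apply: integ01 => s /ch [].
have iI : mu.-integrable `[0, 1] (EFin \o (fun s => Im (h s))).
  by apply: integ01 => s /ch [].
have iZ a f : (forall s, 0 <= s <= 1 -> {for s, continuous f}) ->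
    mu.-integrable `[0, 1] (EFin \o (fun s => a * f s)).
  by move=> hf; apply: integ01 => s hs; apply: cvgM; [apply: cvg_cst|apply: hf].
have cR s : 0 <= s <= 1 -> {for s, continuous (fun s => Re (h s))} by move=> /ch [].
have cI s : 0 <= s <= 1 -> {for s, continuous (fun s => Im (h s))} by move=> /ch [].
apply/eqP; rewrite eq_complex complex_ReM complex_ImM /=; apply/andP; split; apply/eqP.
  rewrite -!RintegralZl // -RintegralB //; try exact: iZ.
  by apply: eq_Rintegral => s _; rewrite complex_ReM.
rewrite -!RintegralZl // -RintegralD //; try exact: iZ.
by apply: eq_Rintegral => s _; rewrite complex_ImM.
Qed.

Lemma Rint_bound f (B : R) : (forall s, 0 <= s <= 1 -> {for s, continuous f}) ->
  (forall s, 0 <= s <= 1 -> `|f s| <= B) -> `|Rintegral mu `[0, 1] f| <= B.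
Proof.
move=> cf hB; apply: le_trans (le_normr_Rintegral _ (integ01 cf)) _; first by [].
apply: (@le_trans _ _ (Rintegral mu `[0, 1] (cst B))).
  apply: le_Rintegral; first by [].
  - by apply: integ01 => s /cf hs; exact: (continuous_comp hs (@norm_continuous _ _ _)).
  - by apply: integ01 => s _; apply: cvg_cst.
  - by move=> s /itv01; apply: hB.
rewrite Rintegral_cst //= lebesgue_measure_itv /= lte_fin ltr01 /= oppr0 addr0 mulr1 //.
Qed.

(** The factor 2 comes from bounding the real and imaginary parts separately. *)
Lemma cint_bound h (B : R) : cc h -> (forall s, 0 <= s <= 1 -> nm (h s) <= B) ->
  nm (cintegral01 h) <= 2 * B.
Proof.
move=> ch hB; apply: le_trans (nm_ReIm _) _; rewrite /= mulrDl mul1r.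
apply: lerD; apply: Rint_bound => s hs; try by case: (ch s hs).
  exact: le_trans (Re_nm _) (hB s hs).
exact: le_trans (Im_nm _) (hB s hs).
Qed.

Definition cder h d := forall s, is_derive s 1 (fun u => Re (h u)) (Re (d s))
  /\ is_derive s 1 (fun u => Im (h u)) (Im (d s)).

Lemma is_derive_cont f s (a : R) : is_derive s 1 f a -> {for s, continuous f}.
Proof. by move=> h; apply/differentiable_continuous/derivable1_diffP; case: h. Qed.

Lemma cder_cc h d : cder h d -> forall s, ccat h s.
Proof. by move=> hd s; have [a b] := hd s; split; apply: is_derive_cont; eassumption. Qed.

Lemma FTC01 f (d : R -> R) : (forall s, is_derive s 1 f (d s)) ->
  (forall s, 0 <= s <= 1 -> {for s, continuous d}) ->
  Rintegral mu `[0, 1] d = f 1 - f 0.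
Proof.
move=> hd cd; rewrite /Rintegral (@continuous_FTC2 _ d f 0 1) //=.
- exact: within01.
- split.
  + by move=> s _; have := hd s; case.
  + by apply: cvg_at_right_filter; apply: is_derive_cont (hd 0).
  + by apply: cvg_at_left_filter; apply: is_derive_cont (hd 1).
- by move=> s _; rewrite derive1E; have := hd s; case.
Qed.

Lemma cFTC h d : cder h d -> cc d -> cintegral01 d = h 1 - h 0.
Proof.
move=> hd cd; apply/eqP; rewrite eq_complex complex_ReD complex_ImD complex_ReN complex_ImN /=.
apply/andP; split; apply/eqP.
  by apply: (@FTC01 (fun u => Re (h u))) => s; [case: (hd s)|case/cd].
by apply: (@FTC01 (fun u => Im (h u))) => s; [case: (hd s)|case/cd].
Qed.

Lemma cder_ext h h' d d' : h =1 h' -> d =1 d' -> cder h d -> cder h' d'.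
Proof. by move=> /funext -> /funext ->. Qed.

Lemma cderM h h' d d' : cder h d -> cder h' d' ->
  cder (fun s => h s * h' s) (fun s => d s * h' s + h s * d' s).
Proof.
move=> hd hd' s; have [a b] := hd s; have [a' b'] := hd' s; split.
  rewrite (_ : (fun u => _) = (fun u => Re (h u)) * (fun u => Re (h' u))
     - (fun u => Im (h u)) * (fun u => Im (h' u))); last by apply: funext => u; rewrite complex_ReM.
  by apply: is_derive_eq; rewrite complex_ReD !complex_ReM /GRing.scale /=; ring.
rewrite (_ : (fun u => _) = (fun u => Re (h u)) * (fun u => Im (h' u))
   + (fun u => Im (h u)) * (fun u => Re (h' u))); last by apply: funext => u; rewrite complex_ImM.
by apply: is_derive_eq; rewrite complex_ImD !complex_ImM /GRing.scale /=; ring.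
Qed.

Lemma cder_cst z : cder (fun=> z) (fun=> 0).
Proof. by move=> s; split => /=; apply: is_derive_cst. Qed.

Lemma cderX h d k : cder h d -> cder (fun s => h s ^+ k.+1) (fun s => k.+1%:R * h s ^+ k * d s).
Proof.
move=> hd; elim: k => [|k IH].
  by apply: cder_ext hd => s; rewrite ?expr1 // expr0 !mul1r.
apply: cder_ext (cderM hd IH) => s; first by rewrite [RHS]exprS.
by rewrite [k.+2%:R]mulrS [h s ^+ k.+1]exprS; ring.
Qed.

End Integral.

Lemma geom_small (R : realType) (ka A e : R) : 0 <= ka < 1 -> 0 < A -> 0 < e ->
  exists m, ka ^+ m * A <= e.
Proof.
move=> /andP[k0 k1] A0 e0.
have /cvgr0Pnorm_le : (GRing.exp ka : R ^nat) @ \oo --> (0 : R).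
  by apply: cvg_expr; rewrite ger0_norm.
move=> /(_ (e / A)).
rewrite divr_gt0 // => /(_ isT) [m _ hm]; exists m.
rewrite -ler_pdivlMr //; apply: le_trans (ler_norm _) _; exact: hm (leqnn m).
Qed.

(** * Closed contours and Cauchy transforms *)

Section Contour.
Context (R : realType).
Local Notation C := R[i].
Local Notation Re := (@complex.Re R).
Local Notation Im := (@complex.Im R).
Implicit Types (s : R) (z w : C) (h : R -> C).

Lemma continuous_bounded01 (f : R -> R) : (forall s, 0 <= s <= 1 -> {for s, continuous f}) ->
  exists B, forall s, 0 <= s <= 1 -> f s <= B.
Proof.
move=> cf; have [c _ hc] := EVT_max ler01 (within01 cf).
by exists (f c) => s hs; apply: hc; rewrite in_itv.
Qed.

Lemma cc_bounded h : cc h -> exists2 B, 0 < B & forall s, 0 <= s <= 1 -> nm (h s) <= B.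
Proof.
move=> ch.
have [B1 h1] : exists B, forall s, 0 <= s <= 1 -> `|Re (h s)| <= B.
  apply: continuous_bounded01 => s /ch [a _].
  exact: (continuous_comp a (@norm_continuous _ _ _)).
have [B2 h2] : exists B, forall s, 0 <= s <= 1 -> `|Im (h s)| <= B.
  apply: continuous_bounded01 => s /ch [_ a].
  exact: (continuous_comp a (@norm_continuous _ _ _)).
exists (`|B1 + B2| + 1) => [|s hs]; first by rewrite ltr_wpDl.
apply: le_trans (nm_ReIm _) _; apply: (@le_trans _ _ (B1 + B2)).
  by apply: lerD; [exact: h1|exact: h2].
by apply: le_trans (ler_norm _) _; rewrite lerDl.
Qed.

Context (n : nat) (g : 'I_n -> R -> C) (hg : closed_contour g).
Implicit Types (k : 'I_n) (f : C -> C).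

Definition adm f := forall k, cc (fun s => f (g k s)).

Lemma arc_cder k : cder (g k) (velocity (g k)).
Proof.
move=> s; have [[[dR _] [dI _]] _] := (hg.1 k, tt); split => /=.
  by apply: DeriveDef; rewrite ?derive1E.
by apply: DeriveDef; rewrite ?derive1E.
Qed.

Lemma arc_ccat k s : ccat (g k) s.
Proof. exact: cder_cc (arc_cder k) s. Qed.

Lemma vel_ccat k s : ccat (velocity (g k)) s.
Proof. by have [[_ cR] [_ cI]] := hg.1 k; split; [apply: cR|apply: cI]. Qed.

Lemma adm_cst z : adm (fun=> z).
Proof. by move=> k s _; apply: ccat_cst. Qed.

Lemma adm_id : adm id.
Proof. by move=> k s _; apply: arc_ccat. Qed.

Lemma admD f f' : adm f -> adm f' -> adm (fun z => f z + f' z).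
Proof. by move=> a b k s hs; apply: ccatD; [apply: a|apply: b]. Qed.

Lemma admM f f' : adm f -> adm f' -> adm (fun z => f z * f' z).
Proof. by move=> a b k s hs; apply: ccatM; [apply: a|apply: b]. Qed.

Lemma admB f f' : adm f -> adm f' -> adm (fun z => f z - f' z).
Proof. by move=> a b k s hs; apply: ccatB; [apply: a|apply: b]. Qed.

Lemma admV f : (forall z, on_contour g z -> f z != 0) -> adm f -> adm (fun z => (f z)^-1).
Proof.
by move=> f0 a k s hs; apply: ccatV; [apply: f0; exists k; exists s|apply: a].
Qed.

Lemma adm_cexp f : adm f -> adm (fun z => cexp (f z)).
Proof. by move=> a k s hs; apply: ccat_cexp; apply: a. Qed.

Lemma admX f m : adm f -> adm (fun z => f z ^+ m).
Proof. by move=> a k s hs; apply: ccatX; apply: a. Qed.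

Lemma adm_ext f f' : f =1 f' -> adm f -> adm f'.
Proof. by move=> /funext ->. Qed.

Lemma adm_poly (p : {poly C}) : adm (fun z => p.[z]).
Proof.
apply: (@adm_ext (fun z => \sum_(i < size p) p`_i * z ^+ i)).
  by move=> z; rewrite horner_coef.
move=> k s hs; apply: ccat_sum => i _; apply: ccatM; first exact: ccat_cst.
by apply: ccatX; apply: arc_ccat.
Qed.

Lemma adm_cauchy w : ~ on_contour g w -> adm (fun z => (z - w)^-1).
Proof.
move=> hw; apply: admV => [z hz|]; last by apply: admB; [apply: adm_id|apply: adm_cst].
by rewrite subr_eq0; apply: contra_notN hw => /eqP <-.
Qed.

Lemma adm_bounded f : adm f -> exists2 B, 0 < B & forall z, on_contour g z -> nm (f z) <= B.
Proof.
move=> af.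
have /boolp.choice [B hB] k : exists B, 0 < B /\ forall s, 0 <= s <= 1 -> nm (f (g k s)) <= B.
  by have [B B0 hB] := cc_bounded (af k); exists B.
exists (1 + \sum_k B k).
  by apply: ltr_pwDl => //; apply: sumr_ge0 => k _; apply: ltW; case: (hB k).
move=> _ [k [s hs ->]]; have [_ h] := hB k; apply: le_trans (h s hs) _.
rewrite (bigD1 k) //= addrCA lerDl addr_ge0 ?ler01 //.
by apply: sumr_ge0 => i _; apply: ltW; case: (hB i).
Qed.

Lemma contour_integralD f f' : adm f -> adm f' ->
  contour_integral g (fun z => f z + f' z) = contour_integral g f + contour_integral g f'.
Proof.
move=> a b; rewrite /contour_integral -big_split; apply: eq_bigr => k _ /=.
rewrite -cintD; first by apply: eq_cint => s _; rewrite mulrDl.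
  by move=> s hs; apply: ccatM; [apply: a|apply: vel_ccat].
by move=> s hs; apply: ccatM; [apply: b|apply: vel_ccat].
Qed.

Lemma contour_integralZ z f : adm f ->
  contour_integral g (fun w => z * f w) = z * contour_integral g f.
Proof.
move=> a; rewrite /contour_integral mulr_sumr; apply: eq_bigr => k _ /=.
rewrite -cintZ; first by apply: eq_cint => s _; rewrite mulrA.
by move=> s hs; apply: ccatM; [apply: a|apply: vel_ccat].
Qed.

Lemma eq_contour_integral f f' : (forall z, on_contour g z -> f z = f' z) ->
  contour_integral g f = contour_integral g f'.
Proof.
move=> e; apply: eq_bigr => k _; apply: eq_cint => s hs; rewrite e //.
by exists k; exists s.
Qed.

Lemma contour_integral0 : contour_integral g (fun=> 0) = 0.
Proof.
rewrite -[RHS](mul0r (contour_integral g (fun=> 0))) -contour_integralZ; last exact: adm_cst.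
by apply: eq_contour_integral => z _; rewrite mul0r.
Qed.

Lemma adm_sum (I : Type) (r : seq I) (F : I -> C -> C) :
  (forall i, adm (F i)) -> adm (fun z => \sum_(i <- r) F i z).
Proof. by move=> aF k s hs; apply: ccat_sum => i _; apply: aF. Qed.

Lemma contour_integral_sum (I : Type) (r : seq I) (F : I -> C -> C) :
  (forall i, adm (F i)) ->
  contour_integral g (fun z => \sum_(i <- r) F i z) = \sum_(i <- r) contour_integral g (F i).
Proof.
move=> aF; elim: r => [|i r IH].
  by rewrite big_nil -[RHS]contour_integral0; apply: eq_contour_integral => z _; rewrite big_nil.
rewrite big_cons -IH -contour_integralD //; last exact: adm_sum.
by apply: eq_contour_integral => z _; rewrite big_cons.
Qed.

Lemma contour_integralB f f' : adm f -> adm f' ->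
  contour_integral g (fun z => f z - f' z) = contour_integral g f - contour_integral g f'.
Proof.
move=> a b; rewrite -[- _]mulN1r -contour_integralZ // -contour_integralD //.
  by apply: eq_contour_integral => z _; rewrite mulN1r.
by apply: admM => //; apply: adm_cst.
Qed.

Lemma contour_integral_bound : exists2 L, 0 < L & forall f (B : R), adm f -> 0 <= B ->
  (forall z, on_contour g z -> nm (f z) <= B) -> nm (contour_integral g f) <= L * B.
Proof.
have /boolp.choice [V hV] k : exists B, 0 < B /\ forall s, 0 <= s <= 1 -> nm (velocity (g k) s) <= B.
  have [s _|B B0 hB] := @cc_bounded (velocity (g k)); first exact: vel_ccat.
  by exists B.
have V0 : 0 <= \sum_k V k by apply: sumr_ge0 => k _; apply: ltW; case: (hV k).
exists (1 + 2 * \sum_k V k); first by lra.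
move=> f B af B0 hB.
rewrite mulrDl mul1r -[leLHS]add0r; apply: lerD => //.
apply: le_trans (nm_sum _ _ _) _; rewrite mulr_sumr mulr_suml; apply: ler_sum => k _.
rewrite -mulrA; apply: cint_bound => [s hs|s hs].
  by apply: ccatM; [apply: af|apply: vel_ccat].
rewrite nmM mulrC; apply: ler_pM; rewrite ?nm_ge0 //; first by case: (hV k) => _; apply.
by apply: hB; exists k; exists s.
Qed.

Lemma contour_integral_small f : adm f ->
  (forall e, 0 < e -> exists2 f', adm f' & contour_integral g f' = 0 /\
     forall z, on_contour g z -> nm (f z - f' z) <= e) ->
  contour_integral g f = 0.
Proof.
move=> af h; have [L L0 hL] := contour_integral_bound.
apply: nm_small => e e0; have [f' af' [i0 hf']] := h (e / L) (divr_gt0 e0 L0).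
rewrite -[contour_integral g f]subr0 -i0 -contour_integralB //.
apply: le_trans (hL _ (e / L) _ _ hf') _; [exact: admB|by rewrite divr_ge0 ?ltW|].
by rewrite mulrCA divff ?mulr1 // gt_eqF.
Qed.

(** Each arc contributes a difference of end values, and these cancel cyclically since each arc
    starts where the preceding one ends. *)
Lemma contour_integral_exact f (F : C -> C) :
  (forall k, cder (fun s => F (g k s)) (fun s => f (g k s) * velocity (g k) s)) ->
  adm f -> contour_integral g f = 0.
Proof.
move=> hF af; rewrite /contour_integral.
under eq_bigr => k _.
  rewrite (cFTC (hF k)); last by move=> s hs; apply: ccatM; [apply: af|apply: vel_ccat].
  over.
rewrite sumrB; apply/eqP; rewrite subr_eq0; apply/eqP.
under eq_bigr => k _ do rewrite hg.2.
rewrite [RHS](reindex_inj (@ordS_inj n)) //.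
Qed.

Lemma contour_integralX m : contour_integral g (fun z => z ^+ m) = 0.
Proof.
apply: (@contour_integral_exact _ (fun z => m.+1%:R^-1 * z ^+ m.+1)).
  move=> k; apply: cder_ext (cderM (cder_cst m.+1%:R^-1) (cderX m (arc_cder k))) => s //=.
  by rewrite mul0r add0r !mulrA mulVf ?mul1r // pnatr_eq0.
by apply: admX; apply: adm_id.
Qed.

Lemma contour_integral_poly (p : {poly C}) : contour_integral g (fun z => p.[z]) = 0.
Proof.
transitivity (contour_integral g (fun z => \sum_(i < size p) p`_i * z ^+ i)).
  by apply: eq_contour_integral => z _; rewrite horner_coef.
rewrite contour_integral_sum => [|i]; last first.
  by apply: admM; [apply: adm_cst|apply: admX; apply: adm_id].
apply: big1 => i _; rewrite contour_integralZ; first by rewrite contour_integralX mulr0.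
by apply: admX; apply: adm_id.
Qed.

Definition cauchy_transform w := contour_integral g (fun z => (z - w)^-1).

(** p - p(w) is divisible by z - w, and polynomials integrate to zero; only p(w) / (z - w) is
    left. *)
Lemma contour_integral_horner (p : {poly C}) w : ~ on_contour g w ->
  contour_integral g (fun z => p.[z] / (z - w)) = p.[w] * cauchy_transform w.
Proof.
move=> hw; have /factor_theorem [p1 e] : root (p - p.[w]%:P) w.
  by rewrite /root hornerD hornerN hornerC subrr.
have ac := adm_cauchy hw.
transitivity (contour_integral g (fun z => p1.[z] + p.[w] * (z - w)^-1)).
  apply: eq_contour_integral => z hz.
  have zw : z - w != 0 by rewrite subr_eq0; apply: contra_notN hw => /eqP <-.
  have -> : p = p1 * ('X - w%:P) + p.[w]%:P by rewrite -e subrK.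
  rewrite !hornerE subrr mulr0 add0r mulrDl mulfK //.
rewrite contour_integralD ?contour_integral_poly ?add0r ?contour_integralZ //.
  exact: adm_poly.
by apply: admM => //; apply: adm_cst.
Qed.

(* Expand 1 / (z - w) in powers of z - c. *)
Lemma cauchy_far c w (ka : R) : 0 <= ka < 1 -> c != w ->
  (forall z, on_contour g z -> nm (z - c) <= ka * nm (w - c)) -> cauchy_transform w = 0.
Proof.
move=> hka cw hz; have /andP[k0 k1] := hka.
have v0 : w - c != 0 by rewrite subr_eq0 eq_sym.
have nv0 : 0 < nm (w - c) by rewrite lt_def nm_ge0 andbT; apply: contra v0 => /eqP /nm_eq0 ->.
have low z : on_contour g z -> (1 - ka) * nm (w - c) <= nm (z - w).
  move=> /hz h; have := nmB (z - c) (z - w).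
  have -> : z - c - (z - w) = w - c by ring.
  by rewrite mulrBl mul1r; lra.
have off : ~ on_contour g w.
  move=> /low; rewrite subrr nm0 leNgt => /negP; apply; apply: mulr_gt0 => //; lra.
apply: contour_integral_small; first exact: adm_cauchy.
have d0 : 0 < (1 - ka) * nm (w - c) by rewrite mulr_gt0 // subr_gt0.
have dV0 : 0 < ((1 - ka) * nm (w - c))^-1 by rewrite invr_gt0.
move=> e e0; have [m hm] := geom_small hka dV0 e0.
(* Partial sum of the expansion; the remainder is ((z - c) / (w - c))^m / (z - w), of modulus at
   most ka^m / ((1 - ka) |w - c|). *)
pose p : {poly C} := - \sum_(i < m) (w - c)^-1 ^+ i.+1 *: ('X - c%:P) ^+ i.
exists (fun z => p.[z]); first exact: adm_poly.
split=> [|z oz]; first exact: contour_integral_poly.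
have zw : z - w != 0 by rewrite subr_eq0; apply: contra_notN off => /eqP <-.
have -> : (z - w)^-1 - p.[z] = ((z - c) / (w - c)) ^+ m / (z - w).
  apply: (mulfI zw); rewrite mulrBr divff // [RHS]mulrCA divff // mulr1.
  have -> : p.[z] = - ((w - c)^-1 * \sum_(i < m) ((z - c) / (w - c)) ^+ i).
    rewrite /p hornerN horner_sum mulr_sumr; congr (- _); apply: eq_bigr => i _.
    by rewrite hornerZ horner_exp hornerXsubC exprS expr_div_n exprVn -mulrA; congr (_ * _); rewrite mulrC.
  have -> : (z - w) = (z - c) - (w - c) by ring.
  rewrite mulrN opprK mulrA mulrBl divff // -subrX1; ring.
rewrite nmM nmX nmV nmM nmV; apply: le_trans hm.
apply: ler_pM; rewrite ?invr_ge0 ?exprn_ge0 ?divr_ge0 ?nm_ge0 //.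
  apply: lerXn2r; rewrite ?nnegrE ?divr_ge0 ?nm_ge0 //.
  by rewrite ler_pdivrMr //; apply: hz.
by rewrite lef_pV2 ?posrE //; [apply: low|apply: lt_le_trans (low z oz)].
Qed.

(** With [B] a bound of 1 / |z - w| on the contour, |z - w'| stays above 1 / (2 B) when w' is within
    1 / (2 B) of w, and the resolvent identity gives the estimate. *)
Lemma cauchy_lipschitz w : ~ on_contour g w -> exists d K : R, [/\ 0 < d, 0 < K &
  forall w', nm (w' - w) <= d -> ~ on_contour g w' /\ nm (cauchy_transform w' - cauchy_transform w) <= K * nm (w' - w)].
Proof.
move=> hw; have [B B0 hB] := adm_bounded (adm_cauchy hw).
have [L L0 hL] := contour_integral_bound.
have zw z : on_contour g z -> z - w != 0.
  by move=> oz; rewrite subr_eq0; apply: contra_notN hw => /eqP <-.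
have low z : on_contour g z -> B^-1 <= nm (z - w).
  move=> oz; have := hB z oz; rewrite nmV => h.
  rewrite -[nm (z - w)]invrK lef_pV2 ?posrE // invr_gt0 lt_def nm_ge0 andbT.
  by apply: contra (zw z oz) => /eqP /nm_eq0 ->.
exists (2^-1 * B^-1), (L * (2 * B ^+ 2)); split.
- by rewrite mulr_gt0 // invr_gt0.
- by rewrite !mulr_gt0 // exprn_gt0.
move=> w' hw'.
have low' z : on_contour g z -> 2^-1 * B^-1 <= nm (z - w').
  move=> oz; have := low z oz; have := nmD (z - w') (w' - w).
  have -> : z - w' + (w' - w) = z - w by ring.
  move: hw'; lra.
have B1 : 0 < B^-1 by rewrite invr_gt0.
have off' : ~ on_contour g w'.
  by move=> /low'; rewrite subrr nm0 leNgt => /negP; apply; rewrite mulr_gt0 // invr_gt0.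
split=> //; rewrite -contour_integralB; try exact: adm_cauchy.
rewrite -mulrA; apply: hL.
- by apply: admB; exact: adm_cauchy.
- by rewrite !mulr_ge0 ?nm_ge0 ?exprn_ge0 // ltW.
move=> z oz; have z1 := zw z oz.
have z2 : z - w' != 0 by rewrite subr_eq0; apply: contra_notN off' => /eqP <-.
have -> : (z - w')^-1 - (z - w)^-1 = (w' - w) * ((z - w')^-1 * (z - w)^-1) by field; apply/andP.
rewrite !nmM mulrC; apply: ler_wpM2r; first exact: nm_ge0.
have -> : 2 * B ^+ 2 = (2 * B) * B by ring.
rewrite nmV; apply: ler_pM; rewrite ?invr_ge0 ?nm_ge0 //; last exact: hB.
rewrite -[leRHS]invrK lef_pV2 ?posrE ?invr_gt0 ?mulr_gt0 //; last first.
  by apply: lt_le_trans (low' z oz); rewrite mulr_gt0 // invr_gt0.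
by rewrite invfM; apply: low'.
Qed.

End Contour.

(** * Roots of unity *)

Section Roots.
Context (R : realType).
Local Notation C := R[i].
Local Notation Re := (@complex.Re R).
Local Notation Im := (@complex.Im R).
Local Notation T := (two_pi_i R).
Implicit Types (x y : R) (z w : C).

Lemma cexp_two_pi_i : cexp T = 1.
Proof.
rewrite /cexp /= expR0 mul1r mulrC mulr_natr.
by have := @cosD2pi R 0; have := @sinD2pi R 0; rewrite add0r => -> ->; rewrite cos0 sin0.
Qed.

(** If cos x <= 1/2, the real part is at least 1/2 >= x / (2 pi). Otherwise sin x = x cos c for some
    c between 0 and x, where cos c >= 1/2. *)
Lemma nm_1Bcexp x : 0 <= x <= pi -> x / (2 * pi) <= nm (1 - cexp (0 +i* x)).
Proof.
move=> /andP[x0 xpi]; have p2 := @pi_ge2 R; have pp := @pi_gt0 R.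
have hR : `|1 - cos x| <= nm (1 - cexp (0 +i* x)).
  by have := Re_nm (1 - cexp (0 +i* x)); rewrite /cexp /= expR0 mul1r mul0r subr0.
have hI : `|sin x| <= nm (1 - cexp (0 +i* x)).
  have := Im_nm (1 - cexp (0 +i* x)); rewrite /cexp /= expR0 mul1r mul0r addr0 sub0r normrN //.
have [c1|c1] := leP (cos x) (2^-1).
  apply: le_trans hR; apply: le_trans (ler_norm _); apply: (@le_trans _ _ 2^-1); last by lra.
  by rewrite ler_pdivrMr; lra.
apply: le_trans hI; apply: le_trans (ler_norm _).
have [c hc] := @MVT_segment R (@sin R) (@cos R) 0 x x0
  (fun y _ => is_derive_sin y) (continuous_subspaceT (@continuous_sin R)).
rewrite sin0 !subr0 => ->.
move: hc; rewrite in_itv /= => /andP[hc0 hcx].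
have cc : 2^-1 <= cos c.
  apply: le_trans (ltW c1) _; move: hcx; rewrite le_eqVlt => /orP[/eqP ->//|cx].
  apply: ltW; rewrite ltr_cos // in_itv /= ?x0 ?xpi // hc0 /=.
  exact: le_trans (ltW cx) xpi.
rewrite ler_pdivrMr; last by lra.
have : 1 <= cos c * (2 * pi) by apply: (@le_trans _ _ (2^-1 * (2 * pi))); [lra|apply: ler_wpM2r => //; lra].
by move=> h; have := ler_wpM2r x0 h; lra.
Qed.

Lemma two_pi_iE x : T * x%:C = 0 +i* (2 * pi * x).
Proof. by rewrite /two_pi_i; apply/eqP; rewrite eq_complex /=; apply/andP; split; apply/eqP; ring. Qed.

Lemma nat_divC (j m : nat) : j%:R / m%:R = (j%:R / m%:R : R)%:C.
Proof. by rewrite rmorphM /= fmorphV !rmorph_nat. Qed.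

Lemma nm_1Bcexp_root (j m : nat) : (0 < m)%N -> (j.*2 <= m)%N ->
  j%:R / m%:R <= nm (1 - cexp (T * j%:R / m%:R)).
Proof.
move=> m0 jm; rewrite -mulrA nat_divC two_pi_iE.
have mR : 0 < m%:R :> R by rewrite ltr0n.
have pp := @pi_gt0 R.
apply: le_trans (nm_1Bcexp _).
  by rewrite [2 * pi * _]mulrC mulfK // mulf_neq0 // gt_eqF.
have h : 2 * (j%:R / m%:R) <= 1 :> R.
  by rewrite mulrA ler_pdivrMr // mul1r -natrM ler_nat mul2n.
have h0 : 0 <= j%:R / m%:R :> R by rewrite divr_ge0.
have := ler_wpM2l (ltW pp) h; have := mulr_ge0 (ltW pp) h0; move=> a b.
by apply/andP; split; lra.
Qed.

Lemma nm_1Bcexp_rootN (j m : nat) : (0 < m)%N -> (j.*2 <= m)%N ->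
  j%:R / m%:R <= nm (1 - cexp (- (T * j%:R) / m%:R)).
Proof.
move=> m0 jm; apply: le_trans (nm_1Bcexp_root m0 jm) _.
rewrite mulNr cexpN; set e := cexp _; have e0 : e != 0 by apply: cexp_neq0.
have n1 : nm e = 1.
  by rewrite /e -mulrA nat_divC two_pi_iE nm_cexp expR0.
have -> : 1 - e^-1 = - (1 - e) / e by field.
by rewrite nmM nmN nmV n1 invr1 mulr1.
Qed.

Definition uroot (m : nat) : C := cexp (T / m%:R).

Lemma urootX m j : uroot m ^+ j = cexp (T * j%:R / m%:R).
Proof. by rewrite /uroot -cexpMn; congr cexp; rewrite mulrAC mulr_natr. Qed.

Lemma natC_neq0 m : (0 < m)%N -> m%:R != 0 :> C.
Proof. by move=> m0; rewrite pnatr_eq0 -lt0n. Qed.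

Lemma urootXm m : (0 < m)%N -> uroot m ^+ m = 1.
Proof. by move=> m0; rewrite urootX mulfK ?cexp_two_pi_i // natC_neq0. Qed.

(** Indices close to m stand for small negative ones. *)
Lemma cexp_root_sym (j m : nat) : (0 < m)%N -> (j <= m)%N ->
  cexp (T * j%:R / m%:R) = cexp (- (T * (m - j)%:R) / m%:R).
Proof.
move=> m0 jm; rewrite natrB // -[RHS]mul1r -[X in _ = X * _]cexp_two_pi_i -cexpD; congr cexp.
have mR := natC_neq0 m0; move: T => U.
by field.
Qed.

Lemma uroot_neq1 m j : (0 < j < m)%N -> uroot m ^+ j != 1.
Proof.
move=> /andP[j0 jm]; have m0 : (0 < m)%N by lia.
have mR : 0 < m%:R :> R by rewrite ltr0n.
rewrite eq_sym -subr_eq0; apply/negP => /eqP e.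
have [h|h] := leqP j.*2 m.
  have := nm_1Bcexp_root m0 h; rewrite -urootX e nm0 leNgt divr_gt0 // ltr0n //.
have h2 : ((m - j).*2 <= m)%N by lia.
have := nm_1Bcexp_rootN m0 h2; rewrite -cexp_root_sym; last exact: ltnW.
  by rewrite -urootX e nm0 leNgt divr_gt0 // ltr0n; lia.
exact: m0.
Qed.

Lemma uroot_prim m : (0 < m)%N -> m.-primitive_root (uroot m).
Proof.
move=> m0; rewrite /primitive_root_of_unity m0 /=; apply/forallP => i.
rewrite unity_rootE; apply/eqP; have := ltn_ord i; rewrite leq_eqVlt => /orP[/eqP e|h].
  by rewrite e urootXm // !eqxx.
by rewrite (negbTE (uroot_neq1 _)) ?h //; apply/esym/negbTE; rewrite neq_ltn h.
Qed.

(** After multiplication by 1 - y^m the right-hand side is a double sum over j and over powers y^l,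
    in which the sum over j kills every l != 0. *)
Lemma inv_1BX m (y : C) : (0 < m)%N -> 1 - y ^+ m != 0 ->
  (1 - y ^+ m)^-1 = m%:R^-1 * \sum_(j < m) (1 - y / uroot m ^+ j)^-1.
Proof.
move=> m0 y1; have mR := natC_neq0 m0.
have r0 j : uroot m ^+ j != 0 by rewrite urootX cexp_neq0.
have r1 j : (1 - y / uroot m ^+ j) * \sum_(l < m) (y / uroot m ^+ j) ^+ l = 1 - y ^+ m.
  rewrite -[1 - _ / _]opprB mulNr -subrX1 opprB expr_div_n.
  by rewrite exprAC urootXm // expr1n divr1.
have n0 j : 1 - y / uroot m ^+ j != 0.
  by apply: contra y1 => /eqP e; rewrite -(r1 j) e mul0r.
apply: (mulfI y1); rewrite divff // mulrCA mulr_sumr.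
transitivity (m%:R^-1 * \sum_(j < m) \sum_(l < m) y ^+ l * ((uroot m ^+ l)^-1) ^+ j).
  rewrite exchange_big /= (bigD1 (Ordinal m0)) //= [X in _ + X]big1 ?addr0.
    under eq_bigr do rewrite !expr0 mul1r invr1 expr1n.
    by rewrite sumr_const card_ord mulVf.
  move=> l /eqP l0; rewrite -mulr_sumr; apply/eqP; rewrite mulf_eq0; apply/orP; right.
  have hl : (0 < l < m)%N.
    rewrite ltn_ord andbT lt0n; apply/eqP => e; apply: l0; exact: val_inj.
  have := subrX1 ((uroot m ^+ l)^-1) m; rewrite exprVn exprAC urootXm // expr1n invr1 subrr.
  move=> /esym/eqP; rewrite mulf_eq0 subr_eq0 invr_eq1 (negbTE (uroot_neq1 hl)) //.
congr (_ * _); apply: eq_bigr => j _; rewrite -(r1 j) mulrC mulKf //.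
by apply: eq_bigr => l _; rewrite expr_div_n exprVn exprAC.
Qed.

End Roots.

Lemma eventually_le (P : nat -> nat -> Prop) :
  (forall j, exists m0, forall m, (m0 <= m)%N -> P j m) ->
  forall J, exists m0, forall m, (m0 <= m)%N -> forall j, (j <= J)%N -> P j m.
Proof.
move=> h; elim=> [|J [m1 IH]].
  have [m0 h0] := h 0%N; exists m0 => m hm j; rewrite leqn0 => /eqP ->; exact: h0.
have [m0 h0] := h J.+1; exists (maxn m0 m1) => m; rewrite geq_max => /andP[a b] j.
by rewrite leq_eqVlt => /orP[/eqP ->|hj]; [exact: h0|exact: IH].
Qed.

(** * Limits under the contour integral *)

Section Approximation.
Context (R : realType).
Local Notation C := R[i].
Local Notation T := (two_pi_i R).
Implicit Types (z w : C).

Lemma nat_above (K : R) : exists m0, (0 < m0)%N /\ forall m, (m0 <= m)%N -> K <= m%:R.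
Proof.
exists (Num.bound `|K|).+1; split=> // m hm.
apply: le_trans (ler_norm K) _; apply: ltW; apply: lt_le_trans (archi_boundP (normr_ge0 K)) _.
by rewrite ler_nat; apply: leq_trans hm.
Qed.

Lemma poly_bounded (p : {poly C}) (r : R) :
  exists2 B, 0 < B & forall z, nm z <= r -> nm p.[z] <= B.
Proof.
exists (1 + \sum_(i < size p) nm p`_i * `|r| ^+ i).
  by apply: ltr_pwDl => //; apply: sumr_ge0 => i _; rewrite mulr_ge0 ?nm_ge0 ?exprn_ge0.
move=> z hz; rewrite horner_coef; apply: le_trans (nm_sum _ _ _) _.
rewrite -[leLHS]add0r; apply: lerD => //; apply: ler_sum => i _.
rewrite nmM nmX; apply: ler_wpM2l; first exact: nm_ge0.
by apply: lerXn2r; rewrite ?nnegrE ?nm_ge0 //; apply: le_trans hz (ler_norm _).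
Qed.

Context (n : nat) (g : 'I_n -> R -> C) (hg : closed_contour g).

Definition ucv (F : nat -> C -> C) (f : C -> C) := forall e : R, 0 < e ->
  exists m0, forall m, (m0 <= m)%N -> forall z, on_contour g z -> nm (F m z - f z) <= e.

Lemma contour_integral_lim (F D_ : nat -> C -> C) (f D : C -> C) :
  (forall m, adm g (F m)) -> adm g f -> (forall m, adm g (D_ m)) -> adm g D ->
  (forall z, on_contour g z -> D z != 0) -> ucv F f -> ucv D_ D ->
  forall e : R, 0 < e -> exists m0, forall m, (m0 <= m)%N ->
    (forall z, on_contour g z -> D_ m z != 0) /\
    nm (contour_integral g (fun z => F m z / D_ m z)
        - contour_integral g (fun z => f z / D z)) <= e.
Proof.
move=> aF af aD_ aD D0 cF cD e e0.
have [L L0 hL] := contour_integral_bound hg.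
have [B B0 hB] := adm_bounded (admV D0 aD).
have [A A0 hA] := adm_bounded af.
(* The difference of the quotients is (F_m - f) / D_m - f (D_m - D) / (D_m D), where |1 / D_m| <= 2
   B, |f| <= A and |1 / D| <= B; hence it is at most [S * e1]. *)
pose S := 2 * B + A * (2 * B) * B.
have S0 : 0 < S by rewrite /S addr_gt0 // !mulr_gt0.
pose e1 := Num.min (2^-1 * B^-1) (e / (L * S)).
have e10 : 0 < e1 by rewrite /e1 lt_min mulr_gt0 ?invr_gt0 // divr_gt0 // mulr_gt0.
have [m1 h1] := cF e1 e10; have [m2 h2] := cD e1 e10.
exists (maxn m1 m2) => m; rewrite geq_max => /andP[hm1 hm2].
have low z : on_contour g z -> 2^-1 * B^-1 <= nm (D_ m z).
  move=> oz; have := hB z oz; rewrite nmV => h.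
  have nD : 0 < nm (D z) by rewrite lt_def nm_ge0 andbT; apply: contra (D0 z oz) => /eqP /nm_eq0 ->.
  have hD : B^-1 <= nm (D z) by rewrite -[leRHS]invrK lef_pV2 ?posrE ?invr_gt0.
  have := nmB (D_ m z) (D_ m z - D z); rewrite subKr => k1.
  have k2 : nm (D_ m z - D z) <= 2^-1 * B^-1.
    by apply: le_trans (h2 m hm2 z oz) _; rewrite /e1 ge_min lexx.
  by lra.
have B1 : 0 < 2^-1 * B^-1 by rewrite mulr_gt0 // invr_gt0.
have Dm0 z : on_contour g z -> D_ m z != 0.
  by move=> /low h; apply: contraTneq h => ->; rewrite nm0 -ltNge.
have nDm z : on_contour g z -> nm (D_ m z)^-1 <= 2 * B.
  move=> oz; rewrite nmV -[leRHS]invrK lef_pV2 ?posrE ?invr_gt0 ?mulr_gt0 //.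
    by rewrite invfM; apply: low.
  by apply: lt_le_trans (low z oz).
split=> //; rewrite -contour_integralB //; last 2 first.
- by apply: admM => //; apply: admV.
- by apply: admM => //; apply: admV.
apply: le_trans (hL _ (S * e1) _ _ _) _.
- by apply: admB; apply: admM => //; apply: admV.
- by rewrite mulr_ge0 // ltW.
- move=> z oz; have d0 := D0 z oz; have d1 := Dm0 z oz.
  have -> : F m z / D_ m z - f z / D z =
      (F m z - f z) * (D_ m z)^-1 - f z * (D_ m z)^-1 * (D z)^-1 * (D_ m z - D z).
    by field; apply/andP.
  apply: le_trans (nmB _ _) _; rewrite /S [leRHS]mulrDl; apply: lerD.
    by rewrite nmM mulrC; apply: ler_pM; rewrite ?nm_ge0 //; [apply: nDm|apply: h1].
  rewrite !nmM; apply: ler_pM; rewrite ?mulr_ge0 ?nm_ge0 //; last exact: h2.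
  apply: ler_pM; rewrite ?mulr_ge0 ?nm_ge0 //; last exact: hB.
  by apply: ler_pM; rewrite ?nm_ge0 //; [apply: hA|apply: nDm].
have k : e1 <= e / (L * S) by rewrite /e1 ge_min lexx orbT.
rewrite mulrA -[leRHS](@divfK _ (L * S)) ?gt_eqF ?mulr_gt0 //.
by rewrite mulrC; apply: ler_wpM2r => //; apply: ltW; apply: mulr_gt0.
Qed.

Lemma cauchy_near0 w (p : {poly C}) (e : R) : ~ on_contour g w -> cauchy_transform g w = 0 -> 0 < e ->
  exists2 d : R, 0 < d & forall w', nm (w' - w) <= d -> nm (p.[w'] * cauchy_transform g w') <= e.
Proof.
move=> ow w0 e0; have [d [K [d0 K0 h]]] := cauchy_lipschitz hg ow.
have [B B0 hB] := poly_bounded p (nm w + 1).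
exists (Num.min (Num.min d 1) (e / (B * K))).
  by rewrite !lt_min d0 ltr01 divr_gt0 // mulr_gt0.
move=> w'; rewrite !le_min => /andP[/andP[k1 k2] k3].
have [_] := h w' k1; rewrite w0 subr0 => k4.
rewrite nmM; apply: (@le_trans _ _ (B * (K * nm (w' - w)))).
  apply: ler_pM; rewrite ?nm_ge0 //; apply: hB.
  by have := nmD w (w' - w); rewrite addrC subrK; lra.
by rewrite mulrA mulrC -ler_pdivlMr // mulr_gt0.
Qed.

End Approximation.

(** * The integral of an entire function over 1 - e^(-be z) *)

Section Residue.
Context (R : realType).
Local Notation C := R[i].
Local Notation T := (two_pi_i R).
Implicit Types (z w : C).
Context (n : nat) (g : 'I_n -> R -> C) (hg : closed_contour g).
Context (be : R) (be0 : 0 < be).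

Definition expo_den z : C := 1 - cexp (- (be%:C * z)).

Definition expo_den_approx (m : nat) z : C := 1 - (1 + (- (be%:C * z)) / m%:R) ^+ m.

(** At u = 2 pi i j, 0 <= j < m, these are the zeros of [expo_den_approx m]; for fixed u they tend
    to - u / be, a zero of [expo_den]. *)
Definition approx_zero (m : nat) z : C := m%:R / be%:C * (1 - cexp (z / m%:R)).

Let beC : be%:C != 0 :> C.
Proof. by apply/eqP => -[] /eqP; rewrite gt_eqF. Qed.

Lemma approx_zero_lim (u : C) (e : R) : 0 < e -> exists m0, forall m, (m0 <= m)%N ->
  nm (approx_zero m u - (- (u / be%:C))) <= e.
Proof.
move=> e0; have [m0 [m00 hm0]] := nat_above (2 * nm u + 12 * nm u ^+ 2 / (be * e)).
exists m0 => m hm; have m1 : (0 < m)%N by apply: leq_trans hm.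
have mC := natC_neq0 R m1; have mR : 0 < m%:R :> R by rewrite ltr0n.
have hK := hm0 m hm.
have q0 : 0 <= 12 * nm u ^+ 2 / (be * e).
  by apply: divr_ge0; rewrite mulr_ge0 ?sqr_ge0 // ltW.
have nu := nm_ge0 u.
have nmm : nm (m%:R : C) = m%:R.
  by rewrite -(rmorph_nat (real_complex R)) nm_real ger0_norm ?ler0n.
have nv : nm (u / m%:R) = nm u / m%:R by rewrite nmM nmV nmm.
have half : nm (u / m%:R) <= 2^-1.
  by rewrite nv ler_pdivrMr //; lra.
have -> : approx_zero m u - - (u / be%:C) =
    - (m%:R / be%:C) * (cexp (u / m%:R) - 1 - u / m%:R).
  by rewrite /approx_zero; move: (cexp _) (be%:C) beC => E b b0; field; apply/andP.
rewrite nmM nmN nmM nmV nmm nm_real gtr0_norm //.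
apply: le_trans (ler_wpM2l _ (cexp_small half)) _; first by rewrite divr_ge0 // ltW.
rewrite nv; have -> : m%:R / be * (12 * (nm u / m%:R) ^+ 2) = (12 * nm u ^+ 2 / be) / m%:R.
  by field; rewrite !gt_eqF.
rewrite ler_pdivrMr // -ler_pdivrMl //.
have -> : e^-1 * (12 * nm u ^+ 2 / be) = 12 * nm u ^+ 2 / (be * e) by field; rewrite !gt_eqF.
lra.
Qed.

Lemma approx_zero_root (m j : nat) : (0 < m)%N ->
  expo_den_approx m (approx_zero m (T * j%:R)) = 0.
Proof.
move=> m0; have mC := natC_neq0 R m0; rewrite /expo_den_approx /approx_zero.
have -> : 1 + - (be%:C * (m%:R / be%:C * (1 - cexp (T * j%:R / m%:R)))) / m%:R
   = cexp (T * j%:R / m%:R).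
  by move: (cexp _) (be%:C) beC => E b b0; field; apply/andP.
by rewrite -urootX exprAC urootXm // expr1n subrr.
Qed.

Lemma approx_zero_sym (m j : nat) : (0 < m)%N -> (j <= m)%N ->
  approx_zero m (T * j%:R) = approx_zero m (- (T * (m - j)%:R)).
Proof. by move=> m0 jm; rewrite /approx_zero cexp_root_sym. Qed.

(** The bound is independent of m: zeros of large index stay away from the contour however large m
    is. *)
Lemma approx_zero_low (m j : nat) : (0 < m)%N -> (j.*2 <= m)%N ->
  j%:R / be <= nm (approx_zero m (T * j%:R)) /\ j%:R / be <= nm (approx_zero m (- (T * j%:R))).
Proof.
move=> m0 jm; have mR : 0 < m%:R :> R by rewrite ltr0n.
have e : j%:R / be = m%:R / be * (j%:R / m%:R) by field; rewrite !gt_eqF.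
have nmm : nm (m%:R / be%:C : C) = m%:R / be.
  by rewrite nmM nmV -(rmorph_nat (real_complex R)) !nm_real ger0_norm ?ler0n // gtr0_norm.
have mb : 0 <= m%:R / be by rewrite divr_ge0 // ltW.
rewrite /approx_zero !nmM -nmM nmm e; split; apply: ler_wpM2l => //.
  exact: nm_1Bcexp_root.
exact: nm_1Bcexp_rootN.
Qed.

(** This is [inv_1BX] at y = 1 - be z / m, for which 1 - y / zeta^j is proportional to the distance
    of z from the j-th zero. *)
Lemma expo_den_approx_inv (m : nat) z : (0 < m)%N -> expo_den_approx m z != 0 ->
  (expo_den_approx m z)^-1 =
  be%:C^-1 * \sum_(j < m) uroot R m ^+ j * (z - approx_zero m (T * j%:R))^-1.
Proof.
move=> m0 hz; have mC := natC_neq0 R m0; rewrite /expo_den_approx inv_1BX //.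
rewrite !mulr_sumr; apply: eq_bigr => j _; rewrite urootX /approx_zero.
have E0 := cexp_neq0 (T * j%:R / m%:R); move: (cexp _) E0 => E E0.
have -> : 1 - (1 + - (be%:C * z) / m%:R) / E = (be%:C / m%:R) * E^-1 * (z - m%:R / be%:C * (1 - E)).
  by move: (be%:C) beC => b b0; field; rewrite ?mC ?b0 ?E0.
rewrite !invfM invrK; move: (z - _)^-1 => I.
by move: (be%:C) beC => b b0; rewrite invrK; field; rewrite ?mC ?b0 ?E0.
Qed.

Lemma adm_expo_den_approx m : adm g (expo_den_approx m).
Proof.
apply: admB; first exact: adm_cst; apply: admX; apply: admD; first exact: adm_cst.
apply: adm_ext (admM (adm_cst g (- be%:C / m%:R)) (adm_id hg)) => z.
by rewrite mulrAC mulNr.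
Qed.

Lemma adm_expo_den : adm g expo_den.
Proof.
apply: admB; first exact: adm_cst; apply: adm_cexp.
by apply: adm_ext (admM (adm_cst g (- be%:C)) (adm_id hg)) => z; rewrite mulNr.
Qed.

Lemma contour_bounded : exists2 rho : R, 0 < rho & forall z, on_contour g z -> nm z <= rho.
Proof. exact: adm_bounded (adm_id hg). Qed.

Lemma ucv_exp (al : C) : ucv g (fun m z => (1 + (al * z) / m%:R) ^+ m) (fun z => cexp (al * z)).
Proof.
move=> e e0; have [rho r0 hr] := contour_bounded.
have r1 : 0 < nm al * rho + 1 by rewrite ltr_wpDl // mulr_ge0 ?nm_ge0 // ltW.
have [n0 h] := exp_approx r1 e0; exists n0 => m hm z oz.
rewrite nmBC; apply: h => //; rewrite nmM; apply: (@le_trans _ _ (nm al * rho)).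
  by apply: ler_wpM2l; [exact: nm_ge0|exact: hr].
by rewrite lerDl.
Qed.

Hypothesis off : forall w, expo_den w = 0 -> ~ on_contour g w.
Hypothesis W0 : cauchy_transform g 0 = T.
Hypothesis W1 : forall w, expo_den w = 0 -> w != 0 -> cauchy_transform g w = 0.

Lemma expo_den_zero (j : nat) : (0 < j)%N -> [/\ expo_den (- (T * j%:R / be%:C)) = 0,
  expo_den (T * j%:R / be%:C) = 0 & T * j%:R / be%:C != 0].
Proof.
move=> j0; have e : cexp (T * j%:R) = 1 by rewrite mulr_natr cexpMn cexp_two_pi_i expr1n.
split.
- by rewrite /expo_den mulrN opprK mulrC divfK // e subrr.
- by rewrite /expo_den mulrC divfK // cexpN e invr1 subrr.
rewrite mulf_neq0 ?invr_eq0 //; rewrite mulf_neq0 ?natC_neq0 //.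
by rewrite /two_pi_i eq_complex /= eqxx /= mulf_neq0 // gt_eqF ?pi_gt0.
Qed.

Lemma cauchy_approx_zero (p : {poly C}) (e : R) (j : nat) : 0 < e -> exists m0, forall m, (m0 <= m)%N ->
  (0 < j)%N ->
  nm (p.[approx_zero m (T * j%:R)] * cauchy_transform g (approx_zero m (T * j%:R))) <= e /\
  nm (p.[approx_zero m (- (T * j%:R))] * cauchy_transform g (approx_zero m (- (T * j%:R)))) <= e.
Proof.
move=> e0; have [->|j0] := posnP j; first by exists 0%N.
have [z1 z2 n0] := expo_den_zero j0.
have h u : expo_den (- (u / be%:C)) = 0 -> - (u / be%:C) != 0 -> exists m0, forall m, (m0 <= m)%N ->
   nm (p.[approx_zero m u] * cauchy_transform g (approx_zero m u)) <= e.
  move=> zu nu; have [d d0 hd] := cauchy_near0 hg p (off zu) (W1 zu nu) e0.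
  have [m0 hm0] := approx_zero_lim u d0; exists m0 => m /hm0; exact: hd.
have [m1 h1] := h (T * j%:R) z1 ltac:(by rewrite oppr_eq0).
have [m2 h2] := h (- (T * j%:R)) ltac:(by rewrite mulNr opprK) ltac:(by rewrite mulNr opprK).
by exists (maxn m1 m2) => m; rewrite geq_max => /andP[/h1 a /h2 b].
Qed.

End Residue.

Lemma sum_ltn_le (m J : nat) : (\sum_(i < m) (i < J) <= J)%N.
Proof.
suff : (\sum_(i < m) (i < J) <= minn m J)%N by move=> h; apply: leq_trans h _; exact: geq_minr.
elim: m => [|m IH]; first by rewrite big_ord0.
rewrite big_ord_recr /=; move: (\sum_(i < m) _)%N IH => S.
by case: (ltnP m J); rewrite ?addn0 ?addn1; lia.
Qed.

Section Residue.
Context (R : realType).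
Local Notation C := R[i].
Local Notation T := (two_pi_i R).
Implicit Types (z w : C).
Context (n : nat) (g : 'I_n -> R -> C) (hg : closed_contour g).
Context (be : R) (be0 : 0 < be).
Hypothesis off : forall w, expo_den be w = 0 -> ~ on_contour g w.
Hypothesis W0 : cauchy_transform g 0 = T.
Hypothesis W1 : forall w, expo_den be w = 0 -> w != 0 -> cauchy_transform g w = 0.

Lemma expo_den_neq0 z : on_contour g z -> expo_den be z != 0.
Proof. by move=> oz; apply/negP => /eqP /off. Qed.

Lemma residue_approx (p : {poly C}) m : (0 < m)%N ->
  (forall z, on_contour g z -> expo_den_approx be m z != 0) ->
  contour_integral g (fun z => p.[z] / expo_den_approx be m z) =
  be%:C^-1 * \sum_(j < m) uroot R m ^+ j *
     (p.[approx_zero be m (T * j%:R)] * cauchy_transform g (approx_zero be m (T * j%:R))).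
Proof.
move=> m0 hD; pose ze (j : 'I_m) := approx_zero be m (T * j%:R).
have oz j : ~ on_contour g (ze j).
  by move=> /hD; rewrite /ze approx_zero_root // eqxx.
have a1 j : adm g (fun z => p.[z] / (z - ze j)).
  by apply: admM; [exact: adm_poly|exact: adm_cauchy].
have a2 (j : 'I_m) : adm g (fun z => uroot R m ^+ j * (p.[z] / (z - ze j))).
  by apply: admM; [exact: adm_cst|exact: a1].
transitivity (contour_integral g (fun z => be%:C^-1 *
   \sum_(j < m) uroot R m ^+ j * (p.[z] / (z - ze j)))).
  apply: eq_contour_integral => z /hD hz; rewrite expo_den_approx_inv // mulrCA mulr_sumr.
  by congr (_ * _); apply: eq_bigr => j _; rewrite mulrCA.
rewrite contour_integralZ //; last by apply: adm_sum => j; exact: a2.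
rewrite contour_integral_sum //; congr (_ * _); apply: eq_bigr => j _.
by rewrite contour_integralZ // contour_integral_horner.
Qed.

Lemma nm_uroot m j : nm (uroot R m ^+ j) = 1.
Proof.
have [->|m0] := posnP m.
  by rewrite urootX invr0 mulr0 cexp0 nm1.
rewrite urootX -mulrA nat_divC two_pi_iE nm_cexp expR0 //.
Qed.

(* Of the m zeros of the approximate denominator, those with min(j, m - j) large
   lie far outside the contour, and each of the other ones tends to a zero of the
   exact denominator, where the winding number vanishes unless j = 0. *)
Lemma residue_poly (p : {poly C}) :
  contour_integral g (fun z => p.[z] / expo_den be z) = T / be%:C * p.[0].
Proof.
apply/eqP; rewrite -subr_eq0; apply/eqP; apply: nm_small => e e0.
have [rho r0 hr] := contour_bounded hg.
(* From index J on, the bound j / be on the modulus of the zeros is at least 2 rho, so that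
   [cauchy_far] applies with center 0 and ratio 1/2. *)
have [J [J0 hJ]] := nat_above (2 * rho * be).
have JR : 0 < J%:R :> R by rewrite ltr0n.
(* At most 2 J nonzero indices are not far, each contributing at most [e']; divided by [be], the
   total is at most e / 2. *)
pose e' := e / 2 * be / (2 * J%:R).
have e'0 : 0 < e' by rewrite /e' !divr_gt0 // !mulr_gt0.
have [m1 h1] := eventually_le (fun j => cauchy_approx_zero hg be0 off W1 p j e'0) J.
have e20 : 0 < e / 2 by rewrite divr_gt0.
have aD := adm_expo_den hg be.
have ap : adm g (fun z => p.[z]) by exact: adm_poly.
have cp : ucv g (fun=> (fun z => p.[z])) (fun z => p.[z]).
  by move=> d d0; exists 0%N => m _ z _; rewrite subrr nm0 ltW.
have cD : ucv g (expo_den_approx be) (expo_den be).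
  move=> d d0; have [m0 h0] := ucv_exp hg (- be%:C) d0.
  exists m0 => m hm z oz; have := h0 m hm z oz.
  rewrite mulNr => h.
  have -> : expo_den_approx be m z - expo_den be z
     = - ((1 + - (be%:C * z) / m%:R) ^+ m - cexp (- (be%:C * z))).
    by rewrite /expo_den_approx /expo_den; ring.
  by rewrite nmN.
have [m2 h2] := contour_integral_lim hg (fun=> ap) ap (adm_expo_den_approx hg be) aD
  expo_den_neq0 cp cD e20.
pose m := maxn (maxn m1 m2) (J.*2.+1).
have hm1 : (m1 <= m)%N by rewrite /m; lia.
have hm2 : (m2 <= m)%N by rewrite /m; lia.
have hm3 : (J.*2 < m)%N by rewrite /m; lia.
have m0 : (0 < m)%N by lia.
clearbody m; have [hD hI] := h2 m hm2.
(* The two indicators, shifted by one, encode j <= J and m - j <= J; with j counted from 0 in the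
   sum below, each of them adds up to at most J. *)
have tail j : (0 < j < m)%N ->
    nm (p.[approx_zero be m (T * j%:R)] * cauchy_transform g (approx_zero be m (T * j%:R)))
    <= e' * ((j.-1 < J)%N + (m.-1 - j < J)%N)%:R.
  move=> /andP[j0 jm].
  have far : cauchy_transform g (approx_zero be m (T * j%:R)) = 0 \/ (j <= J)%N || (m - j <= J)%N.
    have [h|h] := boolP ((j <= J)%N || (m - j <= J)%N); [by right|left].
    move: h; rewrite negb_or -!ltnNge => /andP[hj hmj].
    have low : 2 * rho <= nm (approx_zero be m (T * j%:R)).
      have hl k : (J < k)%N -> 2 * rho <= k%:R / be.
        by move=> hk; rewrite ler_pdivlMr //; apply: le_trans (hJ k (ltnW hk)).
      have [h|h] := leqP j.*2 m.
        by apply: le_trans (hl j hj) _; case: (approx_zero_low be0 m0 h).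
      rewrite approx_zero_sym ?(ltnW jm) //; apply: le_trans (hl _ hmj) _.
      by have [//|_] := @approx_zero_low R be be0 m (m - j) m0; lia.
    apply: (@cauchy_far _ _ _ hg 0 _ 2^-1).
    - by rewrite invr_ge0 ler0n /= invf_lt1 // ltr1n.
    - by apply: contraTneq low => <-; rewrite nm0 -ltNge; lra.
    - by move=> z oz; rewrite !subr0; have := hr z oz; lra.
  case: far => [->|far]; first by rewrite mulr0 nm0 mulr_ge0 // ltW.
  apply: (@le_trans _ _ e'); last first.
    rewrite -[leLHS]mulr1 ler_pM2l // (ler_nat R 1).
    by move: far; case: (ltnP j.-1 J); case: (ltnP (m.-1 - j) J) => //; lia.
  have [h|h] := leqP j J; first by case: (h1 m hm1 j h j0).
  have h' : (m - j <= J)%N by lia.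
  rewrite approx_zero_sym ?(ltnW jm) //.
  by case: (h1 m hm1 (m - j)%N h' _); first by rewrite subn_gt0.
have S : nm (contour_integral g (fun z => p.[z] / expo_den_approx be m z) - T / be%:C * p.[0]) <= e / 2.
  rewrite residue_approx //; clear hI hm1 hm2 hm3 hD.
  move: tail; case: m m0 => [//|m'] _ tail.
  rewrite big_ord_recl /= expr0 mul1r mulr0.
  have -> : approx_zero be m'.+1 0 = 0 by rewrite /approx_zero mul0r cexp0 subrr mulr0.
  rewrite W0; set S := \sum_(i < m') _.
  have -> : be%:C^-1 * (p.[0] * T + S) - T / be%:C * p.[0] = be%:C^-1 * S by ring.
  rewrite nmM nmV nm_real gtr0_norm // mulrC ler_pdivrMr //.
  apply: le_trans (nm_sum _ _ _) _.
  apply: (@le_trans _ _ (e' * (2 * J%:R))); last by rewrite /e' divfK // gt_eqF // mulr_gt0.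
  apply: (@le_trans _ _ (\sum_(i < m') e' * ((i < J)%N + (m' - i.+1 < J)%N)%:R)).
    apply: ler_sum => i _; rewrite nmM nm_uroot mul1r.
    by have := tail i.+1; rewrite /= ltnS ltn_ord => /(_ isT).
  rewrite -mulr_sumr; apply: ler_wpM2l; first exact: ltW.
  rewrite -natr_sum -natrM ler_nat big_split /= mul2n -addnn leq_add ?sum_ltn_le //.
  rewrite (reindex_inj rev_ord_inj) /=; apply: leq_trans (sum_ltn_le m' J).
  by apply: leq_sum => i _; have := ltn_ord i => hi; rewrite (_ : (m' - (m' - i.+1).+1)%N = i) //; lia.
have := nmD (contour_integral g (fun z => p.[z] / expo_den be z) - contour_integral g (fun z => p.[z] / expo_den_approx be m z)) (contour_integral g (fun z => p.[z] / expo_den_approx be m z) - T / be%:C * p.[0]).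
rewrite addrA subrK => h; apply: le_trans h _; rewrite nmBC; lra.
Qed.

(** The polynomials (1 + al z / m)^m tend to e^(al z) uniformly on the contour, and all of them
    equal 1 at 0. *)
Theorem residue_exp (al : C) :
  contour_integral g (fun z => cexp (al * z) / expo_den be z) = T / be%:C.
Proof.
apply/eqP; rewrite -subr_eq0; apply/eqP; apply: nm_small => e e0.
pose pl m : {poly C} := (1 + (al / m%:R) *: 'X) ^+ m.
have plE m z : (pl m).[z] = (1 + al * z / m%:R) ^+ m.
  by rewrite /pl !hornerE mulrAC.
have aD := adm_expo_den hg be.
have cF : ucv g (fun m z => (pl m).[z]) (fun z => cexp (al * z)).
  by move=> d d0; have [m0 h] := ucv_exp hg al d0; exists m0 => m hm z oz; rewrite plE; exact: h.
have cD : ucv g (fun=> expo_den be) (expo_den be).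
  by move=> d d0; exists 0%N => m _ z _; rewrite subrr nm0 ltW.
have aF : adm g (fun z => cexp (al * z)).
  by apply: adm_cexp; apply: admM; [exact: adm_cst|exact: adm_id].
have [m0 h] := contour_integral_lim hg (fun m => adm_poly hg (pl m)) aF (fun=> aD) aD
  expo_den_neq0 cF cD e0.
have [_] := h m0 (leqnn _).
by rewrite residue_poly plE mulr0 mul0r addr0 expr1n mulr1 nmBC.
Qed.

End Residue.

(** Cleared of denominators, the difference of the two sides is a polynomial in [Q] of degree less
    than #|I| that vanishes at the #|I| points 1 / u a. For an empty index set the identity would
    read 1 = 0, whence [i0]. *)
Lemma partial_fraction_inv (F : fieldType) (I : finType) (i0 : I) (u : I -> F) (Q : F) :
  injective u -> (forall a, u a != 0) -> (forall a, 1 - Q * u a != 0) ->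
  (\prod_a (1 - Q * u a))^-1 =
  \sum_a (\prod_(b | b != a) (1 - u b / u a)^-1) * (1 - Q * u a)^-1.
Proof.
move=> ui u0 Q0.
pose p : {poly F} := \sum_a (\prod_(b | b != a) (1 - u b / u a)^-1) *: \prod_(b | b != a) (1 - u b *: 'X) - 1.
have d0 a b : b != a -> 1 - u b / u a != 0.
  move=> ba; rewrite subr_eq0 eq_sym; apply: contra ba => /eqP e; apply/eqP; apply: ui.
  by rewrite -[u b](divfK (u0 a)) e mul1r.
have p0 : p = 0.
  apply: (@roots_geq_poly_eq0 _ _ [seq (u a)^-1 | a <- enum I]).
  - apply/allP => _ /mapP [a _ ->]; rewrite /root /p hornerD hornerN hornerC horner_sum.
    rewrite (bigD1 a) //= [X in _ + X - _]big1 ?addr0.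
      rewrite hornerZ horner_prod -big_split big1 ?subrr // => b ba.
      by rewrite /= !hornerE mulVf // d0.
    move=> c ca; rewrite hornerZ horner_prod [X in _ * X](bigD1 a) 1?eq_sym //= !hornerE.
    by rewrite divff // subrr /= mulr0 mul0r.
  - by rewrite map_inj_uniq ?enum_uniq // => a b /invr_inj /ui.
  - rewrite size_map -cardE; apply: leq_trans (size_polyD _ _) _.
    rewrite geq_max size_polyN size_poly1; apply/andP; split; last by apply/card_gt0P; exists i0.
    apply: leq_trans (size_sum _ _ _) _; apply/bigmax_leqP => a _.
    apply: leq_trans (size_scale_leq _ _) _; apply: leq_trans (size_poly_prod_leq _ _) _.
    have h : (\sum_(b | b != a) size (1 - u b *: 'X : {poly F})%R <= \sum_(b | b != a) 2)%N.
      apply: leq_sum => b _; apply: leq_trans (size_polyD _ _) _.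
      rewrite geq_max size_poly1 size_polyN /=; apply: leq_trans (size_scale_leq _ _) _.
      by rewrite size_polyX.
    move: h; rewrite sum_nat_const; have := cardC1 a; rewrite /predC1 => e.
    have -> : #|[pred i | i != a]| = #|I|.-1 by rewrite -e; apply: eq_card => b.
    have : (0 < #|I|)%N by apply/card_gt0P; exists i0.
    by move: #|I| (\sum_(b | _) _)%N; lia.
have P0 : \prod_a (1 - Q * u a) != 0 by apply/prodf_neq0 => a _.
apply: (mulfI P0); rewrite divff // mulr_sumr.
have := congr1 (fun r : {poly F} => r.[Q]) p0; rewrite horner0 /p hornerD hornerN hornerC horner_sum.
move=> /eqP; rewrite subr_eq0 => /eqP e; rewrite -[LHS]e; apply: eq_bigr => a _.
rewrite hornerZ horner_prod [X in _ = X * _](bigD1 a) //= [RHS]mulrCA; congr (_ * _).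
rewrite mulrAC divff // mul1r; apply: eq_bigr => b _.
by rewrite !hornerE mulrC.
Qed.

(** * Complex powers and translation of contours *)

Section Power.
Context (R : realType).
Local Notation C := R[i].
Local Notation Re := (@complex.Re R).
Local Notation Im := (@complex.Im R).
Local Notation T := (two_pi_i R).
Implicit Types (x y : R) (z w : C).

Lemma cexpMz z (k : int) : cexp (z *~ k) = cexp z ^ k.
Proof.
case: k => k; first by rewrite -pmulrn cexpMn.
by rewrite (_ : z *~ Negz k = - (z *+ k.+1)) // cexpN cexpMn.
Qed.

Lemma cabsE z : cabs z = nm z.
Proof. by case: z. Qed.

Lemma cexp_clog z : z != 0 -> cexp (clog z) = z.
Proof.
move=> z0; have r0 : 0 < nm z.
  by rewrite lt_def nm_ge0 andbT; apply: contra z0 => /eqP /nm_eq0 ->.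
rewrite /cexp /clog cabsE /= lnK //; rewrite /carg cabsE.
have hy : -1 <= Re z / nm z <= 1.
  rewrite -ler_norml normrM normfV (ger0_norm (nm_ge0 z)) ler_pdivrMr // mul1r.
  exact: Re_nm.
have hs : Num.sqrt (1 - (Re z / nm z) ^+ 2) = `|Im z| / nm z.
  have -> : 1 - (Re z / nm z) ^+ 2 = (Im z / nm z) ^+ 2.
    have e : nm z ^+ 2 = Re z ^+ 2 + Im z ^+ 2.
      by rewrite -cabsE /cabs sqr_sqrtr // addr_ge0 ?sqr_ge0.
    rewrite !expr_div_n e; have : Re z ^+ 2 + Im z ^+ 2 != 0 by rewrite -e gt_eqF // exprn_gt0.
    by move=> h; field.
  by rewrite sqrtr_sqr normrM normfV (ger0_norm (nm_ge0 z)).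
have rn : nm z != 0 by rewrite gt_eqF.
case: leP => hI; apply/eqP; rewrite eq_complex /= ?cosN ?sinN acosK // sin_acos // hs;
 rewrite !mul0r subr0 addr0 ?mulrN [X in X == _]mulrC divfK // eqxx /=.
  by rewrite mulrC divfK // ger0_norm.
by rewrite [nm z * _]mulrC divfK // ltr0_norm // opprK.
Qed.

Lemma clog_pos x : 0 < x -> clog x%:C = (ln x)%:C.
Proof.
move=> x0; rewrite /clog /carg cabsE nm_real gtr0_norm //= lexx divff ?gt_eqF // acos1 //.
Qed.

Lemma cpow_pos x z : 0 < x -> cpow x%:C z = cexp (- ((ln x^-1)%:C * z)).
Proof.
move=> x0; rewrite /cpow clog_pos // lnV // rmorphN mulNr opprK mulrC //.
Qed.

(** At integers the power does not see the branch of the logarithm, which is why the node sum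
    contains plain powers of x. *)
Lemma cpow_int z (k : int) : z != 0 -> cpow z k%:~R = z ^ k.
Proof. by move=> z0; rewrite /cpow mulrzl cexpMz cexp_clog. Qed.

Lemma cpowD z w v : cpow z (w + v) = cpow z w * cpow z v.
Proof. by rewrite /cpow mulrDl cexpD. Qed.

Lemma expo_den_real be (r : R) : 0 < be -> expo_den be r%:C = 0 -> r = 0.
Proof.
move=> b0; rewrite /expo_den -rmorphM -rmorphN cexp_real => /eqP; rewrite subr_eq0 => /eqP /(congr1 Re) /= e.
have : - (be * r) = 0 by apply: expR_inj; rewrite expR0.
by move=> /eqP; rewrite oppr_eq0 mulf_eq0 gt_eqF //= => /eqP.
Qed.

Section Shift.
Context (n : nat) (g : 'I_n -> R -> C) (hg : closed_contour g) (c : C).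

(** Translation by a node brings the pole under study to 0, the situation of [residue_exp]. *)
Definition shift_contour : 'I_n -> R -> C := fun k s => g k s - c.

Lemma derive1_shift (f : R -> R) (a : R) : (forall s, derivable f s 1) ->
  (forall s, derivable (fun u => f u - a) s 1) /\ derive1 (fun u => f u - a) = derive1 f.
Proof.
move=> df; have e : (fun u => f u - a) = f - cst a by [].
split=> [s|]; first by rewrite e; apply: derivableB; [exact: df|exact: derivable_cst].
apply: funext => s; rewrite !derive1E e deriveB //.
by rewrite derive_cst subr0.
Qed.

Lemma shift_closed : closed_contour shift_contour /\ forall k s, velocity (shift_contour k) s = velocity (g k) s.
Proof.
have hR k : (fun s => Re (shift_contour k s)) = (fun s => Re (g k s) - Re c).
  by apply: funext => s; rewrite /shift_contour complex_ReD complex_ReN.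
have hI k : (fun s => Im (shift_contour k s)) = (fun s => Im (g k s) - Im c).
  by apply: funext => s; rewrite /shift_contour complex_ImD complex_ImN.
split=> [|k s]; last first.
  have [[dR _] [dI _]] := hg.1 k; rewrite /velocity hR hI.
  by rewrite (derive1_shift _ dR).2 (derive1_shift _ dI).2.
split=> k; last by rewrite /shift_contour hg.2.
have [[dR cR] [dI cI]] := hg.1 k; rewrite /C1_arc hR hI /C1_fun.
have [a ->] := derive1_shift (Re c) dR; have [b ->] := derive1_shift (Im c) dI.
by [].
Qed.

Lemma contour_integral_shift f :
  contour_integral shift_contour f = contour_integral g (fun z => f (z - c)).
Proof. by apply: eq_bigr => k _; apply: eq_cint => s _; rewrite shift_closed.2. Qed.

Lemma on_shift_contour w : on_contour shift_contour w -> on_contour g (w + c).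
Proof. by case=> k [s hs ->]; exists k; exists s => //; rewrite subrK. Qed.

Lemma cauchy_shift w : cauchy_transform shift_contour w = cauchy_transform g (w + c).
Proof.
rewrite /cauchy_transform contour_integral_shift; apply: eq_contour_integral => z _.
by rewrite opprD addrAC addrA.
Qed.

End Shift.
End Power.

(** The blocks of theta consecutive integers attached to the successive i are disjoint; hence the
    real poles are simple and partial fractions apply. *)
Lemma node_inj (theta N : nat) (la : N.-tuple int) : signature la ->
  injective (fun a : 'I_N * 'I_theta => node la a.1 a.2).
Proof.
move=> hla.
have lt (i i' : 'I_N) (j j' : 'I_theta) : (i < i')%N -> node la i' j' < node la i j.
  move=> ii'; rewrite /node; have le := MacdonaldTheory.signature_le hla (ltnW ii').
  apply: ler_ltD le _; rewrite ltz_nat; have := ltn_ord i'; have := ltn_ord j' => hj hi.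
  have : (theta * (N - i'.+1) + theta <= theta * (N - i.+1))%N.
    by rewrite -mulnSr leq_mul2l; apply/orP; right; lia.
  by lia.
move=> [i j] [i' j'] /= e; case: (ltngtP i i') => [h|h|/val_inj h].
- by have := lt _ _ j j' h; rewrite e ltxx.
- by have := lt _ _ j' j h; rewrite e ltxx.
by move: e; rewrite /node h => /addrI [] /addnI /val_inj ->.
Qed.

(** * The contour integral as a sum over the nodes *)

Section Formula.
Context (R : realType).
Local Notation C := R[i].
Local Notation Re := (@complex.Re R).
Local Notation Im := (@complex.Im R).
Local Notation T := (two_pi_i R).
Context (q : R) (hq : 0 < q < 1) (theta N : nat) (th0 : (0 < theta)%N) (N0 : (0 < N)%N)
  (la : N.-tuple int) (hla : signature la).

Let be : R := ln q^-1.
Let nu (a : 'I_N * 'I_theta) : C := (node la a.1 a.2)%:~R.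

Lemma ln_inv_gt0 : 0 < be.
Proof. by case/andP: hq => q0 q1; rewrite /be ln_gt0 // invf_gt1. Qed.

(** The factor of the denominator attached to [a] is 1 - Q u_a, with Q = q^z and u_a = q^(-
    node). *)
Let u (a : 'I_N * 'I_theta) : C := cexp (be%:C * nu a).

Lemma uE a : u a = (q%:C)^-1 ^ node la a.1 a.2.
Proof.
case/andP: hq => q0 q1.
have e : cexp be%:C = (q%:C)^-1 by rewrite cexp_real /be lnK ?posrE ?invr_gt0 // fmorphV.
by rewrite /u /nu mulrzr cexpMz e.
Qed.

Lemma u_inj : injective u.
Proof.
move=> a b e; apply: (node_inj hla); apply: (@intr_inj R).
have nuR c : nu c = ((node la c.1 c.2)%:~R)%:C by rewrite /nu rmorph_int.
move: e; rewrite /u !nuR -!rmorphM !cexp_real => /(congr1 Re) /= /expR_inj.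
by apply: mulfI; rewrite gt_eqF // ln_inv_gt0.
Qed.

Lemma denominatorE z : denominator q theta la z = \prod_a expo_den be (z - nu a).
Proof.
case/andP: hq => q0 q1.
rewrite /denominator pair_bigA; apply: eq_bigr => a _ /=.
by rewrite cpow_pos.
Qed.

Lemma expo_denE z a : expo_den be (z - nu a) = 1 - cexp (- (be%:C * z)) * u a.
Proof. by rewrite /expo_den mulrBr opprB [be%:C * nu a - _]addrC cexpD. Qed.

Lemma denominator_neq0 z a : denominator q theta la z != 0 -> expo_den be (z - nu a) != 0.
Proof. by rewrite denominatorE (bigD1 a) //= mulf_eq0 negb_or => /andP[]. Qed.

Lemma contour_formula (n : nat) (g : 'I_n -> R -> C) (x : C) : x != 0 -> suitable q theta la g ->
  contour_integral g (integrand q theta la x) = T / be%:C *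
  \sum_(a : 'I_N * 'I_theta) x ^ (node la a.1 a.2) * \prod_(b | b != a) (1 - q%:C ^ (node la a.1 a.2 - node la b.1 b.2))^-1.
Proof.
move=> x0 [hg hz]; have b0 := ln_inv_gt0.
have q0 : q%:C != 0 :> C.
  by case/andP: hq => q0 _; apply/eqP => -[] /eqP; rewrite gt_eqF.
have D0 z : on_contour g z -> denominator q theta la z != 0.
  by move=> oz; apply/eqP => /hz [].
have zero w a : expo_den be w = 0 -> denominator q theta la (w + nu a) = 0.
  by move=> e; rewrite denominatorE (bigD1 a) //= addrK e mul0r.
have T0 : T != 0.
  by rewrite /two_pi_i eq_complex /= eqxx /= mulf_neq0 // gt_eqF ?pi_gt0.
have WE w : cauchy_transform g w = T * winding_number g w.
  by rewrite /winding_number mulVKf.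
have aP a : adm g (fun z => cpow x z / expo_den be (z - nu a)).
  apply: admM; first by apply: adm_cexp; apply: admM; [exact: adm_id|exact: adm_cst].
  apply: admV => [z /D0|]; first exact: denominator_neq0.
  apply: admB; first exact: adm_cst; apply: adm_cexp.
  apply: (@adm_ext _ _ _ (fun z => (- be%:C) * (z - nu a))); first by move=> z; rewrite mulNr.
  by apply: admM; [exact: adm_cst|apply: admB; [exact: adm_id|exact: adm_cst]].
(* The poles of this term are nu a + (2 pi i / be) Z, of which only nu a is real: the winding number
   is 1 there and 0 at the others. Writing x^z = x^(nu a) e^(log x (z - nu a)) and shifting by nu a
   leads to [residue_exp]. *)
have term a : contour_integral g (fun z => cpow x z / expo_den be (z - nu a))
    = T / be%:C * x ^ (node la a.1 a.2).
  have [hg' _] := shift_closed hg (nu a).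
  have off w : expo_den be w = 0 -> ~ on_contour (shift_contour g (nu a)) w.
    by move=> /(zero _ a) /hz [h _ _] /on_shift_contour.
  have e0 : expo_den be 0 = 0 :> C by rewrite /expo_den mulr0 oppr0 cexp0 subrr.
  have W0 : cauchy_transform (shift_contour g (nu a)) 0 = T.
    rewrite cauchy_shift // WE; have [_ h _] := hz _ (zero 0 a e0).
    by rewrite h ?mulr1 // add0r; exists a.1, a.2.
  have W1 w : expo_den be w = 0 -> w != 0 -> cauchy_transform (shift_contour g (nu a)) w = 0.
    move=> ew w0; rewrite cauchy_shift // WE; have [_ _ h] := hz _ (zero w a ew).
    rewrite h ?mulr0 // => -[i [j]] e; move/negP: w0; apply; apply/eqP.
    have we : w = ((node la i j - node la a.1 a.2)%:~R)%:C.
      by rewrite rmorph_int intrB -e addrK.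
    by rewrite we; rewrite we in ew; rewrite (expo_den_real b0 ew).
  have := residue_exp hg' b0 off W0 W1 (clog x).
  rewrite contour_integral_shift // -cpow_int // => <-.
  have e z : cpow x z = cpow x (nu a) * cexp (clog x * (z - nu a)).
    by rewrite -{1}(subrKC (nu a) z) cpowD [clog x * _]mulrC.
  rewrite mulrC -contour_integralZ //; last first.
    apply: (@adm_ext _ _ _ (fun z => (cpow x (nu a))^-1 * (cpow x z / expo_den be (z - nu a)))).
      by move=> z; rewrite (e z) -mulrA mulKf ?cexp_neq0.
    by apply: admM; [exact: adm_cst|exact: aP].
  by apply: eq_contour_integral => z _; rewrite (e z) -mulrA.
pose B a := \prod_(b | b != a) (1 - u b / u a)^-1.
have i0 : 'I_N * 'I_theta by exact: (Ordinal N0, Ordinal th0).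
transitivity (contour_integral g (fun z => \sum_a B a * (cpow x z / expo_den be (z - nu a)))).
  apply: eq_contour_integral => z /D0 hD; rewrite /integrand denominatorE.
  under eq_bigr => a _ do rewrite expo_denE.
  rewrite (partial_fraction_inv i0 u_inj) => [|a|a].
  - by rewrite mulr_sumr; apply: eq_bigr => a _; rewrite expo_denE mulrCA.
  - exact: cexp_neq0.
  - by rewrite -expo_denE; apply: denominator_neq0.
rewrite contour_integral_sum // => [|a]; last by apply: admM; [exact: adm_cst|exact: aP].
rewrite mulr_sumr; apply: eq_bigr => a _; rewrite contour_integralZ // term.
rewrite [LHS]mulrC -[LHS]mulrA; congr (_ * (_ * _)); apply: eq_bigr => b _; congr ((1 - _)^-1).
rewrite !uE !exprz_inv invr_expz opprK -expfzDr // addrC //.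
Qed.

End Formula.

(** * The rectangular contour *)

Section Rectangle.
Context (R : realType).
Local Notation C := R[i].
Local Notation Re := (@complex.Re R).
Local Notation Im := (@complex.Im R).
Local Notation T := (two_pi_i R).
Implicit Types (x y s : R) (z w : C).

Lemma cos_eq1 y : cos y = 1 -> y != 0 -> 2 * pi <= `|y|.
Proof.
move=> c1 y0; rewrite leNgt; apply/negP => h.
have s0 : 0 < sin (`|y| / 2).
  apply: sin_gt0_pi; rewrite divr_gt0 ?normr_gt0 //= ltr_pdivrMr // mulrC //.
have : cos `|y| = 1 by rewrite cos_norm.
have -> : `|y| = (`|y| / 2) *+ 2 by rewrite -(mulr_natr (`|y| / 2) 2) divfK.
rewrite cos_mulr2n cos2sin2 => e.
have : sin (`|y| / 2) ^+ 2 = 0 by move: e; move: (sin _) => t; lra.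
by move=> /eqP; rewrite sqrf_eq0 gt_eqF.
Qed.

Lemma expo_den_eq0 (be : R) z : 0 < be -> expo_den be z = 0 ->
  Re z = 0 /\ (Im z = 0 \/ 2 * pi / be <= `|Im z|).
Proof.
move=> b0 /eqP; rewrite /expo_den subr_eq0 => /eqP e.
have e1 : Re (- (be%:C * z)) = - (be * Re z) by rewrite complex_ReN complex_ReM /= mul0r subr0.
have e2 : Im (- (be%:C * z)) = - (be * Im z) by rewrite complex_ImN complex_ImM /= mul0r addr0.
have r0 : Re z = 0.
  have := nm_cexp (- (be%:C * z)); rewrite -e nm1 e1 => /esym h.
  have : - (be * Re z) = 0 by apply: expR_inj; rewrite expR0.
  by move=> /eqP; rewrite oppr_eq0 mulf_eq0 gt_eqF //= => /eqP.
split=> //; have [->|i0] := eqVneq (Im z) 0; [by left|right].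
move: e; rewrite /cexp e1 e2 r0 mulr0 oppr0 expR0 => /(congr1 Re) /=.
rewrite mul1r mul0r subr0 cosN => /esym /cos_eq1; rewrite mulf_eq0 negb_or gt_eqF //= => /(_ i0).
by rewrite normrM (gtr0_norm b0) ler_pdivrMr // [_ * be]mulrC.
Qed.

Lemma atan_inv x : 0 < x -> atan x + atan x^-1 = pi / 2.
Proof.
move=> x0; suff -> : atan x^-1 = pi / 2 - atan x by rewrite addrC subrK.
have a0 : 0 < atan x by rewrite -[ltLHS]atan0 lt_atan.
have a1 := @atan_ltpi2 R x.
rewrite -[RHS]tanK; last by rewrite in_itv /=; apply/andP; split; lra.
congr atan; rewrite /tan sinB cosB sin_pihalf cos_pihalf !mul0r !mul1r subr0 add0r.
by rewrite -[X in X^-1](atanK x) /tan invf_div.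
Qed.

Lemma is_derive_affine (a b s : R) : is_derive s 1 (fun u => a + u * b) b.
Proof.
have -> : (fun u => a + u * b) = cst a + (id * cst b) by [].
by apply: is_derive_eq; rewrite add0r scaler0 add0r /GRing.scale /= mulr1.
Qed.

(** In the half-plane of positive real part ln(d^2 + y^2) / 2 + i atan(y / d) is the logarithm of d
    + i y, a primitive of 1/z, and no branch cut is crossed. *)
Lemma side_integral (d a b : R) : 0 < d ->
  cintegral01 (fun s => (d +i* (a + s * b))^-1 * (0 +i* b)) =
  (ln (d ^+ 2 + (a + b) ^+ 2) / 2 - ln (d ^+ 2 + a ^+ 2) / 2)
  +i* (atan ((a + b) / d) - atan (a / d)).
Proof.
move=> d0; pose y s := a + s * b; pose S s := d ^+ 2 + y s ^+ 2.
have S0 s : 0 < S s by rewrite /S ltr_pwDl ?exprn_gt0 ?sqr_ge0.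
have dy s : is_derive s 1 y b by exact: is_derive_affine.
have yE s : (d +i* (a + s * b))^-1 * (0 +i* b) = (b * y s / S s) +i* (b * d / S s).
  apply/eqP; rewrite eq_complex /= -/(y s) -/(S s) !mulr0; apply/andP; split; apply/eqP; field;
    by rewrite gt_eqF.
have -> : (fun s => (d +i* (a + s * b))^-1 * (0 +i* b)) = (fun s => (b * y s / S s) +i* (b * d / S s)).
  by apply: funext => s; exact: yE.
have cy s : {for s, continuous y} by apply: is_derive_cont (dy s).
have dS s : is_derive s 1 S (2 * y s * b).
  have -> : S = cst (d ^+ 2) + y * y by apply: funext => u; rewrite /S expr2.
  by apply: is_derive_eq; rewrite /GRing.scale /=; ring.
have cS s : {for s, continuous (fun s => (S s)^-1)}.
  by apply: cvgV; [rewrite gt_eqF|exact: is_derive_cont (dS s)].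
pose h s : C := (ln (S s) / 2) +i* atan (y s / d).
have dh : cder h (fun s => (b * y s / S s) +i* (b * d / S s)).
  move=> s; split => /=.
    have dl := is_derive1_ln (S0 s).
    have := @is_derive1_comp _ (@ln R) S s _ _ dl (dS s) => hc.
    have -> : (fun u => ln (S u) / 2) = (@ln R \o S) * cst 2^-1 by [].
    by apply: is_derive_eq; rewrite /GRing.scale /=; field; rewrite gt_eqF.
  have dq : is_derive s 1 (fun u => y u / d) (b / d).
    have -> : (fun u => y u / d) = y * cst d^-1 by [].
    by apply: is_derive_eq; rewrite /GRing.scale /=; ring.
  have := @is_derive1_comp _ (@atan R) (fun u => y u / d) s _ _ (is_derive1_atan _) dq.
  have -> : (1 + (y s / d) ^+ 2)^-1 * (b / d) = b * d / S s => //.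
  have h0 := gt_eqF (S0 s); rewrite /S in h0 *; field.
  by rewrite h0 gt_eqF.
rewrite (cFTC dh).
  rewrite /h /y mul1r mul0r addr0 /S /y mul1r mul0r addr0 //.
move=> s _; split => /=.
  by apply: cvgM; [apply: cvgM; [apply: cvg_cst|apply: cy]|apply: cS].
by apply: cvgM; [apply: cvg_cst|apply: cS].
Qed.

Context (M r : R) (M0 : 0 < M) (r0 : 0 < r).

Definition corner (k : nat) : C := nth 0 [:: (- M) -i* r; M -i* r; M +i* r; (- M) +i* r] k.

Lemma rectangleE (k : 'I_4) s :
  rectangle M r k s = corner k + s%:C * (corner (k.+1 %% 4) - corner k).
Proof. by rewrite /rectangle !(tnth_nth 0). Qed.

Lemma affine_C1 (a b : R) : C1_fun (fun s => a + s * b) /\ derive1 (fun s => a + s * b) = cst b.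
Proof.
have e : derive1 (fun s => a + s * b) = cst b.
  by apply: funext => s; rewrite derive1E; case: (is_derive_affine a b s).
split=> //; split=> [s|]; first by case: (is_derive_affine a b s).
by rewrite e => s; exact: cvg_cst.
Qed.

Lemma rectangle_closed : closed_contour (rectangle M r) /\
  forall k s, velocity (rectangle M r k) s = corner (k.+1 %% 4) - corner k.
Proof.
have hR (k : 'I_4) : (fun s => Re (rectangle M r k s)) =
    (fun s => Re (corner k) + s * Re (corner (k.+1 %% 4) - corner k)).
  by apply: funext => s; rewrite rectangleE complex_ReD complex_ReM /= mul0r subr0.
have hI (k : 'I_4) : (fun s => Im (rectangle M r k s)) =
    (fun s => Im (corner k) + s * Im (corner (k.+1 %% 4) - corner k)).
  by apply: funext => s; rewrite rectangleE complex_ImD complex_ImM /= mul0r addr0.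
split=> [|k s]; last first.
  rewrite /velocity hR hI !(affine_C1 _ _).2 /=; by case: (_ - _).
split=> k; last by rewrite /rectangle mul1r mul0r addr0 addrC subrK.
by rewrite /C1_arc hR hI; split; apply: (affine_C1 _ _).1.
Qed.

Lemma on_rectangle z : on_contour (rectangle M r) z ->
  [/\ `|Re z| <= M, `|Im z| <= r & `|Re z| = M \/ `|Im z| = r].
Proof.
have seg (a s : R) : 0 < a -> 0 <= s <= 1 -> `|- a + s * (a - - a)| <= a /\ `|a + s * (- a - a)| <= a.
  by move=> a0 /andP[s0 s1]; rewrite !ler_norml; split; apply/andP; split; nra.
have nM : `|M| = M by rewrite gtr0_norm.
have nr : `|r| = r by rewrite gtr0_norm.
case=> -[[|[|[|[|//]]]] hk] [s hs ->]; rewrite rectangleE /corner /= !(subrr, mulr0, mul0r, addr0, subr0, normrN, nM, nr).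
- by split => //; [case: (seg M s M0 hs)|right].
- by split => //; [case: (seg r s r0 hs)|left].
- by split => //; [case: (seg M s M0 hs)|right].
- by split => //; [case: (seg r s r0 hs)|left].
Qed.

(* Seen from a center far away on the other side of the rectangle, w is farther
   than every point of the contour. *)
Lemma winding_rectangle_out w : `|Re w| < M -> r < `|Im w| ->
  winding_number (rectangle M r) w = 0.
Proof.
move=> hR hI; rewrite /winding_number -/(cauchy_transform _ w).
suff -> : cauchy_transform (rectangle M r) w = 0 by rewrite mulr0.
(* The center [c] lies below or above w, at distance t from the real axis on the side opposite to w.
   The contour is within sqrt S of it and w is at distance y + t; the choice of t makes (y + t)^2 -
   S equal to (y - r)(y + r) > 0. *)
pose y := `|Im w|; pose t := 2 * M ^+ 2 / (y - r).
have yr : 0 < y - r by rewrite subr_gt0.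
have t0 : 0 < t by rewrite /t divr_gt0 // mulr_gt0 // exprn_gt0.
have te : t * (y - r) = 2 * M ^+ 2 by rewrite /t divfK // gt_eqF.
pose sg := Num.sg (Im w).
have I0 : Im w != 0 by rewrite -normr_gt0; apply: lt_trans hI.
have sI : Im w = sg * y by rewrite /sg /y -numEsg.
have sg2 : sg ^+ 2 = 1 by rewrite sqr_sg I0.
pose c : C := Re w -i* (sg * t).
have yt : 0 < y + t by rewrite addr_gt0 // (lt_trans r0).
have nwc : nm (w - c) = y + t.
  have -> : w - c = 0 +i* (sg * (y + t)).
    by apply/eqP; rewrite eq_complex complex_ReD complex_ImD complex_ReN complex_ImN /= subrr eqxx /= opprK sI mulrDr.
  rewrite /nm /= expr0n /= add0r exprMn sg2 mul1r sqrtr_sqr gtr0_norm //.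
pose S := (2 * M) ^+ 2 + (r + t) ^+ 2.
have SL : S < (y + t) ^+ 2.
  rewrite -subr_gt0; have -> : (y + t) ^+ 2 - S = (y - r) * (y + r) by rewrite /S; nra.
  by rewrite mulr_gt0 // addr_gt0 // (lt_trans r0).
have S0 : 0 <= S by rewrite /S addr_ge0 ?sqr_ge0.
apply: (@cauchy_far _ _ _ rectangle_closed.1 c w (Num.sqrt S / (y + t))).
- rewrite divr_ge0 ?sqrtr_ge0 ?(ltW yt) //= ltr_pdivrMr // mul1r.
  by rewrite -(ger0_norm (ltW yt)) -sqrtr_sqr ltr_sqrt // exprn_gt0.
- by apply: contraTneq yt => e; rewrite -nwc e subrr nm0 ltxx.
move=> z /on_rectangle [zR zI _]; rewrite nwc divfK ?gt_eqF //.
have -> : z - c = (Re z - Re w) +i* (Im z + sg * t).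
  by apply/eqP; rewrite eq_complex complex_ReD complex_ImD complex_ReN complex_ImN /= opprK !eqxx.
rewrite /nm /= ler_sqrt // /S; apply: lerD.
  rewrite -[leLHS]real_normK ?num_real //; apply: lerXn2r; rewrite ?nnegrE //.
    by rewrite mulr_ge0 // ltW.
  by apply: le_trans (ler_normB _ _) _; lra.
rewrite -[leLHS]real_normK ?num_real //; apply: lerXn2r; rewrite ?nnegrE //.
  by rewrite addr_ge0 // ltW.
apply: le_trans (ler_normD _ _) _; apply: lerD => //.
by rewrite normrM /sg normr_sg I0 mul1r gtr0_norm.
Qed.

(** The logarithms at the four corners cancel around the rectangle, and the angles, paired by atan x
    + atan(1/x) = pi / 2, add up to 2 pi. *)
Lemma winding_rectangle_in (c : R) : `|c| < M -> winding_number (rectangle M r) c%:C = 1.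
Proof.
rewrite ltr_norml => /andP[c1 c2]; have [_ vel] := rectangle_closed.
have A0 : 0 < M - c by rewrite subr_gt0.
have B0 : 0 < M + c by lra.
have T0 : T != 0.
  by rewrite /two_pi_i eq_complex /= eqxx /= mulf_neq0 // gt_eqF ?pi_gt0.
rewrite /winding_number; suff -> : contour_integral (rectangle M r) (fun z => (z - c%:C)^-1) = T.
  by rewrite mulVf.
(* z - c = ze * (d + i y) on each side, with d > 0 its distance to c *)
have side (k : 'I_4) (ze : C) (d a b : R) : ze != 0 -> 0 < d ->
    corner k - c%:C = ze * (d +i* a) -> corner (k.+1 %% 4) - corner k = ze * (0 +i* b) ->
    cintegral01 (fun s => (rectangle M r k s - c%:C)^-1 * velocity (rectangle M r k) s)
    = (ln (d ^+ 2 + (a + b) ^+ 2) / 2 - ln (d ^+ 2 + a ^+ 2) / 2)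
      +i* (atan ((a + b) / d) - atan (a / d)).
  move=> z0 d0 e1 e2; rewrite -side_integral //; apply: eq_cint => s _.
  rewrite vel rectangleE addrAC e1 e2.
  have -> : ze * (d +i* a) + s%:C * (ze * (0 +i* b)) = ze * (d +i* (a + s * b)).
    rewrite mulrCA -mulrDr; congr (_ * _); apply/eqP; rewrite eq_complex /=.
    by rewrite !(mul0r, mulr0, subr0, addr0) !eqxx.
  by rewrite invfM mulrACA mulVf // mul1r.
have n1 : - 'i%C != 0 :> C by rewrite oppr_eq0 eq_complex /= oner_eq0 andbF.
have n2 : 'i%C != 0 :> C by rewrite eq_complex /= oner_eq0 andbF.
have n3 : - 1 != 0 :> C by rewrite oppr_eq0 oner_eq0.
rewrite /contour_integral !big_ord_recl big_ord0.
rewrite (side _ (- 'i%C) r (- (M + c)) (2 * M)) //; last 2 first.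
- by apply/eqP; rewrite eq_complex /=; apply/andP; split; apply/eqP; ring.
- by apply/eqP; rewrite eq_complex /=; apply/andP; split; apply/eqP; ring.
rewrite (side _ 1 (M - c) (- r) (2 * r)) ?oner_neq0 //; last 2 first.
- by apply/eqP; rewrite eq_complex /=; apply/andP; split; apply/eqP; ring.
- by apply/eqP; rewrite eq_complex /=; apply/andP; split; apply/eqP; ring.
rewrite (side _ 'i%C r (- (M - c)) (2 * M)) //; last 2 first.
- by apply/eqP; rewrite eq_complex /=; apply/andP; split; apply/eqP; ring.
- by apply/eqP; rewrite eq_complex /=; apply/andP; split; apply/eqP; ring.
rewrite (side _ (- 1) (M + c) (- r) (2 * r)) //; last 2 first.
- by apply/eqP; rewrite eq_complex /=; apply/andP; split; apply/eqP; ring.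
- by apply/eqP; rewrite eq_complex /=; apply/andP; split; apply/eqP; ring.
have -> : - (M + c) + 2 * M = M - c by ring.
have -> : - (M - c) + 2 * M = M + c by ring.
have -> : - r + 2 * r = r by ring.
rewrite !mulNr !atanN !sqrrN.
have a1 := atan_inv (divr_gt0 A0 r0); have a2 := atan_inv (divr_gt0 B0 r0).
rewrite !invf_div in a1 a2.
apply/eqP; rewrite /two_pi_i eq_complex /=; apply/andP; split; apply/eqP; first by ring.
lra.
Qed.

End Rectangle.

Section Suitable.
Context (R : realType).
Local Notation C := R[i].
Local Notation Re := (@complex.Re R).
Local Notation Im := (@complex.Im R).

Lemma node_bounds (theta N : nat) (la : N.-tuple int) (i : 'I_N) (j : 'I_theta) : signature la ->
  la`_N.-1 <= node la i j <= la`_0 + (theta * N)%N%:Z - 1.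
Proof.
move=> hla; have N0 : (0 < N)%N by apply: leq_ltn_trans (ltn_ord i).
have hN : (N.-1 < N)%N by rewrite prednK.
have -> : la`_0 = tnth la (Ordinal N0) by rewrite (tnth_nth 0).
have -> : la`_N.-1 = tnth la (Ordinal hN) by rewrite (tnth_nth 0).
have h1 : tnth la (Ordinal hN) <= tnth la i.
  by apply: MacdonaldTheory.signature_le => //=; have := ltn_ord i; lia.
have h2 : tnth la i <= tnth la (Ordinal N0) by apply: MacdonaldTheory.signature_le.
have h3 : (theta * (N - i.+1) + theta <= theta * N)%N.
  by rewrite -mulnSr leq_mul2l; apply/orP; right; have := ltn_ord i; lia.
rewrite /node; have := ltn_ord j => hj.
have h4 : (theta * (N - i.+1) + j < theta * N)%N by lia.
apply/andP; split; first by apply: le_trans h1 _; rewrite lerDl.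
move: (tnth _ _) (tnth _ _) (tnth _ _) h1 h2 h4 => a b c.
by move: (theta * (N - i.+1) + j)%N (theta * N)%N => s t; lia.
Qed.

(** The zeros of the denominator are the nodes translated by (2 pi i / be) Z, where 2 pi / be = - 2
    pi / ln q: the bound on [r] leaves the nonreal ones above or below the rectangle, and the bound
    on [M] encloses all the nodes. *)
Lemma rectangle_suitable (q : R) (theta N : nat) (la : N.-tuple int) (M r : R) :
  0 < q < 1 -> signature la -> 0 < r < - (2 * pi / ln q) ->
  Num.max 0 (Num.max (- (la`_N.-1)%:~R) ((la`_0 + (theta * N)%N%:Z - 1)%:~R)) < M ->
  suitable q theta la (rectangle M r).
Proof.
move=> hq hla /andP[r0 rq]; rewrite !gt_max => /andP[M0 /andP[M1 M2]].
have [hg _] := rectangle_closed M r; split=> // w hw.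
have b0 := ln_inv_gt0 hq.
have [a ha] : exists a : 'I_N * 'I_theta, expo_den (ln q^-1) (w - (node la a.1 a.2)%:~R) = 0.
  move: hw => /eqP; rewrite denominatorE // => /eqP hw; apply: contrapT => /forallNP h.
  move/eqP: hw; apply/negP; apply/prodf_neq0 => a _; apply/eqP; exact: h.
have [hR hI] := expo_den_eq0 b0 ha.
have nuR : (node la a.1 a.2)%:~R = ((node la a.1 a.2)%:~R)%:C :> C by rewrite rmorph_int.
move: hR hI; rewrite nuR complex_ReD complex_ImD complex_ReN complex_ImN /= oppr0 addr0 => hR hI.
have eR : Re w = (node la a.1 a.2)%:~R by apply/eqP; rewrite -subr_eq0 hR.
have aM : `|Re w| < M.
  have /andP[l1 l2] := node_bounds a.1 a.2 hla.
  rewrite -(ler_int R) in l1; rewrite -(ler_int R) in l2.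
  by rewrite eR ltr_norml; apply/andP; split; lra.
have rI : Im w = 0 \/ r < `|Im w|.
  case: hI => [->|h]; [by left|right]; apply: lt_le_trans rq (le_trans _ h).
  by rewrite lnV ?posrE ?(andP hq).1 // invrN mulrN.
have on : ~ on_contour (rectangle M r) w.
  move=> /(on_rectangle M0 r0) [_ hr [h|h]]; first by move: aM; rewrite h ltxx.
  case: rI => [e|h']; first by move: h; rewrite e normr0 => h; move: r0; rewrite h ltxx.
  by move: h'; rewrite h ltxx.
split=> // [[i [j e]]|nreal].
  have ew : w = (Re w)%:C by rewrite e -(rmorph_int (real_complex R)).
  by rewrite ew; apply: winding_rectangle_in.
case: rI => [e|h]; last exact: winding_rectangle_out.
case: nreal; exists a.1, a.2; rewrite nuR -eR.
by apply/eqP; rewrite eq_complex /= e !eqxx.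
Qed.

End Suitable.

Theorem theorem3p1 (R : realType) (q : R) (hq : 0 < q < 1)
    (theta N : nat) (htheta : (0 < theta)%N) (hN : (0 < N)%N)
    (P : polyfamily R[i] N) (hP : is_macdonald P)
    (la : N.-tuple int) (hla : signature la) :
  (forall (p : nat) (x : R[i]) (n : nat) (g : 'I_n -> R -> R[i]),
     0 <= la`_N.-1 + p%:Z ->
     x != 0 ->
     (forall k : nat, (0 < k < theta * N)%N -> x != (q ^+ k)%:C) ->
     suitable q theta la g ->
     let t := q ^+ theta in
     let pt (y : R[i]) (i : 'I_N) :=
       if (i : nat) == 0%N then y else (t ^+ i)%:C in
     macdonald_eval P q%:C t%:C p la (pt x)
       / macdonald_eval P q%:C t%:C p la (pt 1)
     = (ln (q^-1))%:C
       * (\prod_(1 <= k < theta * N) ((1 - q ^+ k)%:C / (x - (q ^+ k)%:C)))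
       * ((two_pi_i R)^-1
          * contour_integral g (integrand q theta la x)))
  /\
  (forall M r : R,
     0 < r < - (2 * pi / ln q) ->
     Num.max 0 (Num.max (- (la`_N.-1)%:~R)
                  ((la`_0 + (theta * N)%N%:Z - 1)%:~R)) < M ->
     suitable q theta la (rectangle M r)).
Proof.
split; last by move=> M r; exact: rectangle_suitable.
move=> p x n g hp x0 hx hg t pt.
have q01 : (0 : R[i]) < q%:C < 1 by rewrite -[0]/(0%:C) -[1]/(1%:C) !ltcR.
have ptE y : pt y = MacdonaldTheory.mac_pt (q%:C ^+ theta) y.
  by apply: funext => i; rewrite /pt /MacdonaldTheory.mac_pt /t !rmorphXn.
have hx' k : (0 < k < theta * N)%N -> x != q%:C ^+ k by rewrite -rmorphXn; exact: hx.
rewrite !ptE /t rmorphXn (MacdonaldTheory.macdonald_principal (@uroot_prim R) q01 htheta hN hP hla hp x0 hx').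
rewrite (contour_formula hq htheta hN hla x0 hg).
have T0 : two_pi_i R != 0.
  by rewrite /two_pi_i eq_complex /= eqxx /= mulf_neq0 // gt_eqF ?pi_gt0.
have b0 : (ln q^-1)%:C != 0 :> R[i].
  by apply/eqP => -[] /eqP; rewrite gt_eqF // ln_inv_gt0.
have -> : \prod_(1 <= k < theta * N) ((1 - q ^+ k)%:C / (x - (q ^+ k)%:C)) =
   \prod_(1 <= k < theta * N) ((1 - q%:C ^+ k) / (x - q%:C ^+ k)).
  by apply: eq_bigr => k _; rewrite -rmorphXn rmorphB rmorph1.
by rewrite -[_ / _ * _]mulrA mulKf // mulrACA divff // mul1r.
Qed.
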